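(* Let $T$ be an operator, and assume that there exist $\epsilon>0$, $k\geq 1$ and $f_0\in H^{k}(\mathbb{T})$ such that for all $f\in H^k(\mathbb T)$ with $\|f-f_0\|_{H^{k}(\mathbb T)}\lesssim \epsilon$ the following hold: (a) (Boundedness) $T(f)\in H^{k}(\mathbb{T})$ and $\|T(f)\|_{H^{k}(\mathbb{T})}\lesssim 1$; (b) (Existence and boundedness of the Fréchet derivative) the Fréchet derivative $D_f(T(f))$ exists and $\|D_{f}(T(f))[h]\|_{H^{k}(\mathbb{T})}\lesssim \|h\|_{H^k(\mathbb{T})}$; (c) ($L^2$ boundedness of the Fréchet derivative) $\|D_{f}(T(f))[h]\|_{L^{2}(\mathbb{T})}\lesssim \|h\|_{L^2(\mathbb{T})}$; (d) $\frac{d}{dx}T(f)=D_{f}(T(f))\left[\frac{df}{dx}\right]$; (e) $iD_f(T(f))[h]=D_f(T(f))[ih]$. If $f_0$ also satisfies the equation $f_0'(x)=T(f_0)(x)$, then $f_0$ must be real analytic.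
   Context: $\mathbb{T}$ is the torus of length $2\pi$ and $H^k(\mathbb T)$, $L^2(\mathbb T)$ are the usual spaces of complex-valued functions. The notation $A\lesssim B$ means $A\le CB$ with a constant $C$ independent of $f$ (in the stated neighborhood of $f_0$) and of $h$. $D_f(T(f))[h]$ is the Fréchet derivative of $T:H^k(\mathbb T)\to H^k(\mathbb T)$ at $f$ in direction $h$; by (c) it is understood as extended to directions in $L^2(\mathbb T)$ whenever needed, for instance in (d), where $\frac{df}{dx}\in H^{k-1}(\mathbb T)\subset L^2(\mathbb T)$. *)

(* Defs.v *)
From HB Require Import structures.
From mathcomp Require Import all_boot all_order all_algebra.
From mathcomp Require Import all_classical all_reals all_analysis.
From mathcomp Require Export complex.

Set Implicit Arguments.
Unset Strict Implicit.
Unset Printing Implicit Defensive.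

Import Order.TTheory GRing.Theory Num.Theory.
Import numFieldNormedType.Exports.
Import ComplexField.Normc.

Local Open Scope classical_set_scope.
Local Open Scope complex_scope.
Local Open Scope ring_scope.

(* A function on the torus is a 2pi-periodic function on the line.  Elements of
   L^2 and H^k are represented by functions, and equality in these spaces is
   [eqT], equality almost everywhere. *)
Section Torus.
Context {R : realType}.
Implicit Types (f g h : R -> R[i]) (phi : R -> R) (L E : (R -> R[i]) -> R -> R[i]).

Definition period : R := pi *+ 2.
Definition circle : set R := `[0, period]%classic.
Notation leb := (@lebesgue_measure R).

Definition eqT f g : Prop := ae_eq leb circle f g.

Definition intT f : R[i] :=
  (\int[leb]_(x in circle) complex.Re (f x))%R +i* (\int[leb]_(x in circle) complex.Im (f x))%R.

Definition inL2 f : Prop :=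
  [/\ periodic f period,
      measurable_fun [set: R] (fun x => complex.Re (f x)),
      measurable_fun [set: R] (fun x => complex.Im (f x)) &
      leb.-integrable circle (fun x => (normc (f x) ^+ 2)%:E)].

(* Only meaningful on [inL2]: [Rintegral] of a non-integrable function is a
   junk value. *)
Definition normL2 f : R := Num.sqrt (\int[leb]_(x in circle) normc (f x) ^+ 2)%R.

Definition testT phi : Prop :=
  periodic phi period /\ forall n x, derivable (derive1n n phi) x 1.

Definition is_wderiv (j : nat) f g : Prop :=
  forall phi, testT phi ->
    intT (fun x => f x * (derive1n j phi x)%:C) =
    (-1) ^+ j * intT (fun x => g x * (phi x)%:C).

(* Some L^2 weak derivative of order j (unique up to [eqT]), 0 if there is
   none. *)
Definition wderiv (j : nat) f : R -> R[i] :=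
  xget (fun=> 0) [set g | inL2 g /\ is_wderiv j f g].

Definition inH (k : nat) f : Prop :=
  inL2 f /\ forall j, (j <= k)%N -> exists g, inL2 g /\ is_wderiv j f g.

(* Only meaningful on [inH k]. *)
Definition normH (k : nat) f : R :=
  Num.sqrt (\sum_(j < k.+1) normL2 (wderiv j f) ^+ 2).

(* Linearity is over the reals: complex linearity of the Frechet derivative is
   a separate assumption of the theorem. *)
Definition linear_on (V : (R -> R[i]) -> Prop) L : Prop :=
  (forall h, V h -> V (L h)) /\
  (forall (c : R) h1 h2, V h1 -> V h2 ->
     eqT (L (c%:C \*o h1 \+ h2)) (c%:C \*o L h1 \+ L h2)).

Definition bounded_linear_on (V : (R -> R[i]) -> Prop) (N : (R -> R[i]) -> R) L
    : Prop :=
  linear_on V L /\ exists C : R, forall h, V h -> N (L h) <= C * N h.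

Definition is_frechet (k : nat) (T : (R -> R[i]) -> R -> R[i]) f L : Prop :=
  bounded_linear_on (inH k) (normH k) L /\
  forall e : R, 0 < e -> exists2 d : R, 0 < d &
    forall h, inH k h -> normH k h < d ->
      inH k (T (f \+ h)) /\
      normH k (T (f \+ h) \- T f \- L h) <= e * normH k h.

(* E is the extension of L from H^k to L^2 by continuity: it is linear, agrees
   with L on the dense subspace H^k and obeys every L^2 bound that L obeys. *)
Definition is_L2_extension (k : nat) L E : Prop :=
  [/\ linear_on inL2 E,
      forall h, inH k h -> eqT (E h) (L h) &
      forall C : R, (forall h, inH k h -> normL2 (L h) <= C * normL2 h) ->
        forall h, inL2 h -> normL2 (E h) <= C * normL2 h].

Definition real_analytic g : Prop :=
  forall x0 : R, exists2 r : R, 0 < r & exists a : nat -> R[i],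
    forall x : R, `|x - x0| < r ->
      (fun N => normc (\sum_(n < N) a n * (x - x0)%:C ^+ n - g x)) @ \oo
        --> (0 : R).

(* The class of f has a real-analytic representative on the torus. *)
Definition real_analyticT f : Prop :=
  exists g, [/\ periodic g period, real_analytic g & eqT f g].

End Torus.

(* Main.v *)
Require Import Defs.
From mathcomp Require Import all_boot all_order all_algebra.
From mathcomp Require Import all_classical all_reals all_analysis.
From mathcomp Require Import measurable_realfun ring lra.

Set Implicit Arguments.
Unset Strict Implicit.
Unset Printing Implicit Defensive.

Import Order.TTheory GRing.Theory Num.Theory.
Import numFieldNormedType.Exports.
Import ComplexField.Normc.

Local Open Scope classical_set_scope.
Local Open Scope complex_scope.
Local Open Scope ring_scope.

(** The equation f0' = T f0 says that T moves f0 in the direction in which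
    translation moves it, and hypothesis (d) says that T commutes with
    translation infinitesimally.  As T is complex differentiable, its flow can be
    run in imaginary time, and this extends f0 holomorphically to a strip.

    More precisely, let sg be 1 or -1 and solve y' = sg i T(y), y(0) = f0 in H^k.
    By (b) and the mean value inequality T is Lipschitz on the ball around f0
    ([frechet_lipschitz]), by (a) it is bounded there, and H^k is complete
    ([hk_complete]), so that Euler's scheme gives a solution on an interval [0, a]
    whose length depends on eps and on the bound in (a) only ([ode_exists]).  The
    defect u = dy/dx - T(y) vanishes at time 0 because of the equation for f0.
    Writing E for the extension of the derivative of T at y to L^2, one finds
        u' = sg i d/dx T(y) - D_y(T(y))[sg i T(y)]
           = sg i E[dy/dx] - sg i E[T(y)] = sg i E[u],
    where (d) is used for the first term and (e) for the second.  By (c) the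
    operator E is bounded on L^2, hence u = 0 by Gronwall's lemma
    ([gronwall_eq0], [flow_defect_eq0]): along the flow y' = sg i dy/dx.

    Tested against exp(i n x), this is a linear equation for each Fourier
    coefficient, whose solutions are multiples of exp(n t) or exp(- n t) according
    to the signs of sg and of the frequency ([flow_coef]).  A coefficient that grows
    like exp(n t) and stays bounded up to time a started with size at most a
    constant times exp(- n a); the two values of sg cover all frequencies, so the Fourier
    coefficients of f0 decay exponentially ([coef_decay]).  The trigonometric series
    with these coefficients is real analytic ([trig_sum_analytic]) and has the same
    Fourier coefficients as f0, hence equals f0 almost everywhere because an
    integrable function is determined by its Fourier coefficients
    ([trig_uniqueness]).  The last fact also makes weak derivatives unique.

    L^2 and H^k are used as seminormed spaces of functions, without passing to a
    quotient: two functions are equal almost everywhere when their difference has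
    seminorm 0.  Functions take values in [Rcomplex R], which is [R[i]] seen as a
    real vector space. *)

(** * Seminorms and the mean value inequality *)

Ltac zmod_bubble b :=
  lazymatch goal with
  | |- _ + b = 0 => idtac
  | _ => rewrite (addrAC _ b); zmod_bubble b
  end.
Ltac zmod_cancel :=
  lazymatch goal with
  | |- 0 = 0 => reflexivity
  | |- _ + - ?b = 0 => zmod_bubble b; rewrite subrK; zmod_cancel
  | |- _ + ?a = 0 => zmod_bubble (- a); rewrite addrK; zmod_cancel
  end.
(** Decides equalities of sums of atoms and opposites of atoms in an abelian
    group, by cancelling the last summand against the rest one at a time. *)
Ltac zmod :=
  apply/eqP; rewrite -subr_eq0; apply/eqP;
  rewrite ?(opprD, opprK); rewrite -[LHS]add0r ?addrA ?(addr0, subr0); zmod_cancel.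

(** Local-to-global principle on an interval (Cousin's lemma): the supremum of
    the points reached from [a] is reached and cannot be smaller than [b].  It
    replaces integration in the mean value inequality and in Gronwall's lemma, where
    only pointwise first order information along a curve is available. *)
Lemma cousin (R : realType) (Q : R -> R -> Prop) (a b : R) : a <= b ->
  (forall x y z, a <= x -> x <= y -> y <= z -> z <= b -> Q x y -> Q y z -> Q x z) ->
  (forall s, a <= s -> s <= b -> exists2 d, 0 < d & forall x y,
     a <= x -> x <= s -> s <= y -> y <= b -> y - x < d -> Q x y) ->
  Q a b.
Proof.
move=> ab Qtrans Qloc.
pose S := [set t | [/\ a <= t, t <= b & Q a t]].
have Sa : S a.
  have [d d0 Hd] := Qloc a (lexx _) ab.
  by split=> //; apply: Hd => //; rewrite subrr.
have hS : has_sup S by split; [exists a | exists b => t []].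
set s := sup S.
have as_ : a <= s by apply: ub_le_sup => //; case: hS.
have sb : s <= b by apply: ge_sup; [exists a | move=> t []].
have [d d0 Hd] := Qloc s as_ sb.
have [t [at_ tb Qt] lt_t] := sup_adherent (divr_gt0 d0 (ltr0n _ 2)) hS.
have ts : t <= s by apply: ub_le_sup; [case: hS | split].
pose y := Num.min b (s + d / 4).
have sy : s <= y by rewrite le_min sb lerDl divr_ge0// ltW.
have yb : y <= b by rewrite ge_min lexx.
have yd : y <= s + d / 4 by rewrite ge_min lexx orbT.
have Qy : Q a y.
  apply: (Qtrans a t y) => //; first exact: le_trans sy.
  apply: Hd => //; rewrite -/s in lt_t; lra.
have : y <= s by apply: ub_le_sup; [case: hS | split=> //; apply: le_trans sy].
rewrite /y; case: (leP b (s + d / 4)) => [h1 h2|h1 h2]; last by lra.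
by have -> : b = y by rewrite /y; apply/esym/min_idPl.
Qed.

Lemma le_of_eps (R : realType) (A B C : R) :
  (forall e, 0 < e -> A <= B + C * e) -> A <= B.
Proof.
move=> H; apply/ler_addgt0Pr => e e0.
have C1 : 0 < `|C| + 1 by rewrite ltr_wpDl.
apply: (le_trans (H _ (divr_gt0 e0 C1))).
rewrite lerD2l mulrCA ler_piMr ?(ltW e0)//.
rewrite ler_pdivrMr// mul1r; apply: (le_trans (ler_norm _)); lra.
Qed.

Lemma pow2_lt (R : realType) (e : R) : 0 < e -> exists n : nat, (2 ^- n : R) < e.
Proof.
move=> e0; have [n Hn] : exists n : nat, e^-1 < n%:R.
  exists (Num.truncn e^-1).+1; rewrite truncnS_gt//.
exists n; rewrite -[e]invrK ltf_pV2 ?posrE ?invr_gt0// ?exprn_gt0//.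
apply: lt_trans Hn _; rewrite -natrX ltr_nat; exact: ltn_expl.
Qed.

Lemma le_of_pow2 (R : realType) (A B C : R) :
  (forall n : nat, A <= B + C * 2 ^- n) -> A <= B.
Proof.
move=> H; apply: (@le_of_eps _ _ _ `|C|) => e e0.
have [n Hn] := pow2_lt e0; apply: (le_trans (H n)).
rewrite lerD2l; apply: (@le_trans _ _ (`|C| * 2 ^- n)).
  by rewrite ler_wpM2r// ?ler_norm// invr_ge0 exprn_ge0.
by rewrite ler_wpM2l// ltW.
Qed.

Section Seminorm.
Context {R : realType} {V : lmodType R}.
Implicit Types (P : V -> Prop) (N : V -> R).

(** A seminorm on a subspace [P], rather than on a subtype: [L^2] and [H^k] are
    predicates on functions. *)
Structure seminorm_on P N : Prop := SeminormOn {
  sn_P0 : P 0;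
  sn_PL : forall c x y, P x -> P y -> P (c *: x + y);
  sn_D : forall x y, P x -> P y -> N (x + y) <= N x + N y;
  sn_Z : forall c x, P x -> N (c *: x) = `|c| * N x }.

Structure semi_inner_on P (B : V -> V -> R) : Prop := SemiInnerOn {
  si_P0 : P 0;
  si_PL : forall c x y, P x -> P y -> P (c *: x + y);
  si_sym : forall x y, P x -> P y -> B x y = B y x;
  si_lin : forall c x y z, P x -> P y -> P z -> B (c *: x + y) z = c * B x z + B y z;
  si_ge0 : forall x, P x -> 0 <= B x x }.

Section FromInner.
Variables (P : V -> Prop) (B : V -> V -> R) (H : semi_inner_on P B).

Lemma si_quad c x y : P x -> P y ->
  B (c *: x + y) (c *: x + y) = c ^+ 2 * B x x + c * B x y *+ 2 + B y y.
Proof.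
move=> Px Py; have Pxy := si_PL H c Px Py.
rewrite (si_lin H)// (si_sym H Px)// (si_sym H Py)// !(si_lin H)//.
rewrite (si_sym H Py Px); ring.
Qed.

(** Cauchy-Schwarz for a form that may be degenerate: where [B x x = 0] the
    quadratic polynomial of [si_quad] is affine, and being nonnegative it is
    constant. *)
Lemma si_CS x y : P x -> P y -> B x y ^+ 2 <= B x x * B y y.
Proof.
move=> Px Py.
have Bx := si_ge0 H Px; have By := si_ge0 H Py.
have Hq c : 0 <= c ^+ 2 * B x x + c * B x y *+ 2 + B y y.
  by rewrite -si_quad//; apply: (si_ge0 H); exact: (si_PL H).
have [x0|x0] := eqVneq (B x x) 0.
  rewrite x0 mul0r; suff -> : B x y = 0 by rewrite expr0n.
  apply/eqP; apply: contraT => xy0.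
  have := Hq (- (B y y + 1) / (B x y *+ 2)).
  rewrite x0 mulr0 add0r -mulrnAr divfK ?mulrn_eq0//; lra.
have := Hq (- B x y / B x x).
have -> : (- B x y / B x x) ^+ 2 * B x x + - B x y / B x x * B x y *+ 2 + B y y =
  B y y - B x y ^+ 2 / B x x by field.
by rewrite subr_ge0 ler_pdivrMr 1?mulrC// lt_def x0.
Qed.

Lemma si_CS_sqrt x y : P x -> P y ->
  `|B x y| <= Num.sqrt (B x x) * Num.sqrt (B y y).
Proof.
move=> Px Py; rewrite -sqrtrM ?(si_ge0 H)// -sqrtr_sqr ler_sqrt ?si_CS//.
by apply: mulr_ge0; exact: (si_ge0 H).
Qed.

Lemma semi_inner_seminorm : seminorm_on P (fun x => Num.sqrt (B x x)).
Proof.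
split; [exact: (si_P0 H) | exact: (si_PL H) | |].
- move=> x y Px Py.
  have Bx := sqrtr_ge0 (B x x); have By := sqrtr_ge0 (B y y).
  rewrite -[leRHS]ger0_norm ?addr_ge0// -sqrtr_sqr ler_sqrt ?sqr_ge0//.
  have := si_quad 1 Px Py; rewrite scale1r => ->.
  rewrite sqrrD !sqr_sqrtr ?(si_ge0 H)// expr1n !mul1r lerD2r lerD2l lerMn2r /=.
  by apply: (le_trans (ler_norm _)); exact: si_CS_sqrt.
- move=> c x Px; have := si_quad c Px (si_P0 H); rewrite addr0 => ->.
  have B0 z : P z -> B 0 z = 0.
    move=> Pz; have := si_lin H (-1) (si_P0 H) (si_P0 H) Pz.
    by rewrite scaler0 addr0 mulN1r addNr.
  rewrite (si_sym H Px (si_P0 H)) (B0 x)// (B0 0) ?mulr0 ?mul0rn ?addr0; last exact: (si_P0 H).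
  by rewrite sqrtrM ?sqr_ge0// sqrtr_sqr.
Qed.

End FromInner.

Section Theory.
Variables (P : V -> Prop) (N : V -> R) (H : seminorm_on P N).

Lemma sn_PD x y : P x -> P y -> P (x + y).
Proof. by move=> Px Py; rewrite -[x]scale1r; exact: (sn_PL H). Qed.
Lemma sn_PZ c x : P x -> P (c *: x).
Proof. by move=> Px; rewrite -[_ *: _]addr0; apply: (sn_PL H) => //; exact: (sn_P0 H). Qed.
Lemma sn_PB x y : P x -> P y -> P (x - y).
Proof. by move=> Px Py; rewrite -scaleN1r; apply: sn_PD => //; exact: sn_PZ. Qed.
Local Hint Resolve sn_PD sn_PZ sn_PB : core.

Lemma sn_0 : N 0 = 0.
Proof. by rewrite -(scale0r 0) (sn_Z H) ?normr0 ?mul0r//; exact: (sn_P0 H). Qed.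
Lemma sn_N x : P x -> N (- x) = N x.
Proof. by move=> Px; rewrite -scaleN1r (sn_Z H)// normrN1 mul1r. Qed.
Lemma sn_sym x y : P x -> P y -> N (x - y) = N (y - x).
Proof. by move=> Px Py; rewrite -opprB sn_N; auto. Qed.
Lemma sn_ge0 x : P x -> 0 <= N x.
Proof.
move=> Px; have := sn_D H Px (sn_PZ (-1) Px).
rewrite scaleN1r subrr sn_0 sn_N// => h; lra.
Qed.
Lemma sn_B x y : P x -> P y -> N (x - y) <= N x + N y.
Proof.
move=> Px Py; rewrite -(sn_N Py); apply: (sn_D H) => //.
by rewrite -scaleN1r; auto.
Qed.
Lemma sn_tri y x z : P x -> P y -> P z -> N (x - z) <= N (x - y) + N (y - z).
Proof.
move=> Px Py Pz; have -> : x - z = (x - y) + (y - z) by rewrite addrA subrK.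
by apply: (sn_D H); auto.
Qed.
Lemma sn_rtri x y : P x -> P y -> N x <= N (x - y) + N y.
Proof. by move=> Px Py; rewrite -{1}(subrK y x); apply: (sn_D H); auto. Qed.
Lemma sn_ext x y : P x -> P y -> N (x - y) = 0 -> N x = N y.
Proof.
move=> Px Py xy; have h1 := sn_rtri Px Py; have h2 := sn_rtri Py Px.
rewrite sn_sym// xy in h2; lra.
Qed.

(** Bounds on increments add up over adjacent intervals, and on an interval around a
    given point they follow by passing through that point, so that [cousin] reduces
    the claim to local Lipschitz constants. *)
Lemma mean_value (g : R -> V) (K a b : R) : a <= b ->
  (forall t, a <= t -> t <= b -> P (g t)) ->
  (forall s, a <= s -> s <= b -> forall e, 0 < e -> exists2 d, 0 < d &
     forall t, a <= t -> t <= b -> `|t - s| < d ->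
       N (g t - g s) <= (K + e) * `|t - s|) ->
  N (g b - g a) <= K * (b - a).
Proof.
move=> ab Pg Hg; apply: (@le_of_eps _ _ _ (b - a)) => e e0.
rewrite [_ * e]mulrC -mulrDl.
pose Q x y := N (g y - g x) <= (K + e) * (y - x).
rewrite -/(Q a b); apply: (@cousin _ Q _ _ ab) => [x y z ax xy yz zb|s as_ sb].
  have [Px Py Pz] : [/\ P (g x), P (g y) & P (g z)] by split; apply: Pg; lra.
  rewrite /Q => h1 h2; apply: (le_trans (sn_tri Pz Py Px)).
  by apply: (le_trans (lerD h2 h1)); rewrite -mulrDr addrA subrK.
have [d d0 Hd] := Hg s as_ sb e e0.
exists d => // x y ax xs sy yb yxd; rewrite /Q.
have xb : x <= b by lra.
have ay : a <= y by lra.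
have [Px Py Ps] : [/\ P (g x), P (g y) & P (g s)] by split; apply: Pg; lra.
apply: (le_trans (sn_tri Py Ps Px)); rewrite (sn_sym Ps Px).
apply: le_trans (lerD (Hd y _ _ _) (Hd x _ _ _)) _ => //.
- by rewrite ger0_norm; lra.
- by rewrite ler0_norm; lra.
by rewrite ger0_norm ?subr_ge0// ler0_norm ?subr_le0// -mulrDr; nra.
Qed.
End Theory.
End Seminorm.

(** * Gronwall's lemma *)
Section SeminormODE.
Context {R : realType} {V : lmodType R}.
Variables (P : V -> Prop) (N : V -> R) (H : seminorm_on P N).
Local Hint Extern 1 (P (_ + _)) => apply: (sn_PD H) : core.
Local Hint Extern 1 (P (_ - _)) => apply: (sn_PB H) : core.
Local Hint Extern 1 (P (_ *: _)) => apply: (sn_PZ H) : core.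

(** The property that [cousin] propagates is
    [N (w y) <= exp (C (y - x)) (N (w x) + e (y - x))].  No uniformity is asked of the
    derivative [v] of [w], because the remainder of a Frechet derivative at a moving
    point provides none. *)
Lemma gronwall_eq0 (w v : R -> V) (C a : R) : 0 <= C ->
  (forall t, 0 <= t <= a -> P (w t) /\ P (v t)) ->
  N (w 0) = 0 ->
  (forall t, 0 <= t <= a -> N (v t) <= C * N (w t)) ->
  (forall s, 0 <= s <= a -> forall e, 0 < e -> exists2 d, 0 < d &
     forall t, 0 <= t <= a -> `|t - s| < d ->
       N (w t - w s - (t - s) *: v s) <= e * `|t - s|) ->
  forall t, 0 <= t <= a -> N (w t) = 0.
Proof.
move=> C0 Pw w0 vw Hd b /andP[b0 ba].
apply/eqP; rewrite eq_le (sn_ge0 H) ?andbT; last by have [|//] := Pw b; rewrite b0.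
apply: (@le_of_eps _ _ _ (expR (C * b) * b)) => e e0; rewrite add0r.
pose Q x y := N (w y) <= expR (C * (y - x)) * (N (w x) + e * (y - x)).
suff : Q 0 b by rewrite /Q w0 add0r subr0 -!mulrA [e * b]mulrC.
apply: (@cousin _ Q _ _ b0) => [x y z x0 xy yz zb|s s0 sb].
  rewrite /Q => h1 h2; apply: (le_trans h2).
  have -> : C * (z - x) = C * (z - y) + C * (y - x) by ring.
  rewrite expRD -mulrA ler_pM2l ?expR_gt0//.
  apply: (@le_trans _ _ (expR (C * (y - x)) * (N (w x) + e * (y - x)) + expR (C * (y - x)) * (e * (z - y)))).
    apply: lerD => //; rewrite ler_peMl ?mulr_ge0 ?(ltW e0) ?subr_ge0//.
    by rewrite -expR0 ler_expR mulr_ge0// subr_ge0.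
  by rewrite -mulrDr -addrA -mulrDr; have -> : y - x + (z - y) = z - x by ring.
have sa : 0 <= s <= a by apply/andP; split; lra.
have [Pws Pvs] := Pw s sa.
have Ns := sn_ge0 H Pvs.
(* [e1] controls the remainder at [s], [d2] below the replacement of [w s] by [w x] in the
   bound on [N (v s)]; each may cost [e / 2]. *)
pose e1 := e / (2 * (C + 1)).
have C1 : 0 < C + 1 by lra.
have e1C : e1 * (C + 1) = e / 2 by rewrite /e1; field; rewrite gt_eqF.
have e10 : 0 < e1 by rewrite /e1 divr_gt0// mulr_gt0.
have [d1 d10 Hd1] := Hd s sa e1 e10.
pose d2 := e / (2 * (C * N (v s) + 1)).
have CN : 0 <= C * N (v s) by rewrite mulr_ge0.
have d20 : 0 < d2 by rewrite /d2 divr_gt0// mulr_gt0//; lra.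
have d2E : d2 * (C * N (v s) + 1) = e / 2 by rewrite /d2; field; apply: lt0r_neq0; lra.
exists (Num.min 1 (Num.min d1 d2)); first by rewrite !lt_min ltr01 d10 d20.
move=> x y x0 xs sy yb; rewrite !lt_min => /and3P[yx1 yxd1 yxd2].
have xa : 0 <= x <= a by apply/andP; split; lra.
have ya : 0 <= y <= a by apply/andP; split; lra.
have [Pwx _] := Pw x xa; have [Pwy _] := Pw y ya.
have hx : N (w x - w s - (x - s) *: v s) <= e1 * (s - x).
  have := Hd1 x xa; rewrite distrC ger0_norm ?subr_ge0//; apply; lra.
have hy : N (w y - w s - (y - s) *: v s) <= e1 * (y - s).
  have := Hd1 y ya; rewrite ger0_norm ?subr_ge0//; apply; lra.
set rx := w x - _ - _ in hx; set ry := w y - _ - _ in hy.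
have Prx : P rx by rewrite /rx; auto.
have Pry : P ry by rewrite /ry; auto.
have Ey : w y = w x + (y - x) *: v s + (ry - rx).
  rewrite /ry /rx.
  have -> : (y - x) *: v s = (y - s) *: v s - (x - s) *: v s.
    by rewrite -scalerBl; congr (_ *: _); ring.
  move: ((y - s) *: v s) ((x - s) *: v s) (w x) (w y) (w s) => A B c D E.
  zmod.
have Nry : N (ry - rx) <= e1 * (y - x).
  apply: (le_trans (sn_B H Pry Prx)); apply: (le_trans (lerD hy hx)).
  by rewrite -mulrDr le_eqVlt; apply/orP; left; apply/eqP; ring.
have Es : N (w s) <= N (w x) + (s - x) * N (v s) + e1 * (s - x).
  have -> : w s = w x + (s - x) *: v s - rx.
    rewrite /rx; have -> : (s - x) *: v s = - ((x - s) *: v s) by rewrite -scaleNr opprB.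
    move: ((x - s) *: v s) (w x) (w s) => A c D.
    zmod.
  apply: (le_trans (sn_B H _ Prx)); first by auto.
  apply: lerD => //; apply: (le_trans (sn_D H Pwx _)); first by auto.
  by rewrite (sn_Z H)// ger0_norm// subr_ge0.
have Hvs := vw s sa.
have h1 : N (w y) <= N (w x) + (y - x) * N (v s) + e1 * (y - x).
  rewrite Ey; apply: (le_trans (sn_D H _ _)); [by auto|by auto|].
  apply: lerD => //; apply: (le_trans (sn_D H Pwx _)); first by auto.
  by rewrite (sn_Z H)// ger0_norm//; lra.
have Nx := sn_ge0 H Pwx.
have h2 : N (v s) <= C * (N (w x) + (y - x) * N (v s) + e1 * (y - x)).
  apply: (le_trans Hvs); apply: ler_wpM2l => //; apply: (le_trans Es).
  apply: lerD; first by rewrite lerD2l ler_wpM2r//; lra.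
  by rewrite ler_wpM2l ?(ltW e10)//; lra.
have yx0 : 0 <= y - x by lra.
have h3 : C * N (v s) * (y - x) <= e / 2.
  rewrite -d2E; apply: (@le_trans _ _ (C * N (v s) * d2)); first by rewrite ler_wpM2l// ltW.
  by rewrite [leRHS]mulrC ler_wpM2r ?(ltW d20)//; lra.
have h4 : e1 * (C * (y - x) + 1) <= e / 2.
  rewrite -e1C ler_wpM2l ?(ltW e10)// lerD2r ler_piMr//; lra.
have h5 : N (w y) <= (1 + C * (y - x)) * N (w x) + e * (y - x).
  apply: (le_trans h1).
  apply: (@le_trans _ _ (N (w x) + (y - x) * (C * (N (w x) + (y - x) * N (v s) + e1 * (y - x))) + e1 * (y - x))).
    by rewrite lerD2r lerD2l ler_wpM2l.
  have : (y - x) * (C * N (v s) * (y - x) + e1 * (C * (y - x) + 1)) <= (y - x) * e.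
    by rewrite ler_wpM2l//; lra.
  lra.
rewrite /Q; apply: (le_trans h5).
rewrite [leRHS]mulrDr; apply: lerD.
  by rewrite ler_wpM2r// expR_ge1Dx.
rewrite ler_peMl ?mulr_ge0 ?(ltW e0)//.
by rewrite -expR0 ler_expR mulr_ge0.
Qed.
End SeminormODE.

(** * Euler's scheme in a complete seminormed space *)
Lemma expR_pow_le (R : realType) (x y : R) (n : nat) :
  0 <= x -> x *+ n <= y -> (1 + x) ^+ n <= expR y.
Proof.
move=> x0 xy; apply: (@le_trans _ _ (expR x ^+ n)).
  by rewrite lerXn2r ?nnegrE ?expR_ge0 ?expR_ge1Dx// addr_ge0.
by rewrite -expRM_natl ler_expR mulr_natl.
Qed.

Section Euler.
Context {R : realType} {V : lmodType R}.
Variables (P : V -> Prop) (N : V -> R) (H : seminorm_on P N).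
Local Hint Extern 1 (P (_ + _)) => apply: (sn_PD H) : core.
Local Hint Extern 1 (P (_ - _)) => apply: (sn_PB H) : core.
Local Hint Extern 1 (P (_ *: _)) => apply: (sn_PZ H) : core.

(** Completeness restricted to sequences whose steps decay like [2 ^- n], with an
    explicit rate.  Euler's scheme with step halving produces such sequences, and
    this is the form in which the Riesz-Fischer theorem is proved. *)
Definition rapidly_complete : Prop :=
  forall (x : nat -> V) (C : R), (forall n, P (x n)) ->
    (forall n, N (x n.+1 - x n) <= C * 2 ^- n) ->
    exists y, P y /\ forall n, N (x n - y) <= 2 * C * 2 ^- n.

Variables (F : V -> V) (x0 : V) (r M L a : R).
Hypothesis Hcomplete : rapidly_complete.
Hypothesis Px0 : P x0.
Hypothesis FP : forall x, P x -> N (x - x0) < r -> P (F x) /\ N (F x) <= M.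
Hypothesis FL : forall x y, P x -> N (x - x0) < r -> P y -> N (y - x0) < r ->
  N (F x - F y) <= L * N (x - y).
Hypotheses (M0 : 0 <= M) (L0 : 0 <= L) (a0 : 0 < a) (Mar : M * a < r).

Let h (n : nat) : R := a * 2 ^- n.
Let E (n j : nat) : V := iter j (fun x => x + h n *: F x) x0.

Let h_gt0 n : 0 < h n.
Proof. by rewrite mulr_gt0// invr_gt0 exprn_gt0. Qed.

Let h_ge0 n : 0 <= h n.
Proof. exact: ltW. Qed.

Let hS n : h n = 2 * h n.+1.
Proof. by rewrite /h exprS invfM; field; rewrite expf_neq0. Qed.

Let h_le n : h n <= a.
Proof.
by rewrite /h ler_piMr ?(ltW a0)// invf_le1 ?exprn_gt0// exprn_ege1// ler1n.
Qed.

Let hE n : h n * (2 ^ n)%:R = a.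
Proof. by rewrite /h natrX divfK// expf_neq0. Qed.

Let hj n j : (j <= 2 ^ n)%N -> j%:R * h n <= a.
Proof. by move=> jn; rewrite -(hE n) mulrC ler_pM2l// ler_nat. Qed.

Let E_in n j : (j <= 2 ^ n)%N -> P (E n j) /\ N (E n j - x0) <= M * (j%:R * h n).
Proof.
elim: j => [|j IH] jn; first by rewrite /E /= subrr (sn_0 H) mul0r mulr0.
have [PE NE] := IH (ltnW jn).
have lt_r : N (E n j - x0) < r.
  apply: (le_lt_trans NE); apply: le_lt_trans Mar.
  by rewrite ler_wpM2l// hj// ltnW.
have [PF NF] := FP PE lt_r.
have -> : E n j.+1 = E n j + h n *: F (E n j) by [].
split; first by auto.
have -> : E n j + h n *: F (E n j) - x0 = (E n j - x0) + h n *: F (E n j) by zmod.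
apply: (le_trans (sn_D H _ _)); [by auto|by auto|].
rewrite (sn_Z H)// ger0_norm// -natr1 mulrDl mul1r mulrDr.
by apply: lerD => //; rewrite mulrC ler_wpM2r.
Qed.

Let E_P n j : (j <= 2 ^ n)%N -> P (E n j).
Proof. by move=> /E_in[]. Qed.

Let E_r n j : (j <= 2 ^ n)%N -> N (E n j - x0) < r.
Proof.
move=> jn; have [_ NE] := E_in jn.
by apply: (le_lt_trans NE); apply: le_lt_trans Mar; rewrite ler_wpM2l// hj.
Qed.

Let EF_P n j : (j <= 2 ^ n)%N -> P (F (E n j)).
Proof. by move=> jn; have [] := FP (E_P jn) (E_r jn). Qed.

Let EF_M n j : (j <= 2 ^ n)%N -> N (F (E n j)) <= M.
Proof. by move=> jn; have [] := FP (E_P jn) (E_r jn). Qed.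

Let E_step n i m : (i + m <= 2 ^ n)%N ->
  N (E n (i + m) - E n i) <= M * (m%:R * h n).
Proof.
elim: m => [|m IH] jn; first by rewrite addn0 subrr (sn_0 H) mul0r mulr0.
rewrite addnS in jn *.
have jn1 := ltnW jn.
have PE := E_P jn1; have PF := EF_P jn1.
have Pi : P (E n i) by apply: E_P; apply: leq_trans jn1; exact: leq_addr.
have -> : E n (i + m).+1 = E n (i + m) + h n *: F (E n (i + m)) by [].
have -> : E n (i + m) + h n *: F (E n (i + m)) - E n i =
  (E n (i + m) - E n i) + h n *: F (E n (i + m)) by zmod.
apply: (le_trans (sn_D H _ _)); [by auto|by auto|].
rewrite (sn_Z H)// ger0_norm// -natr1 mulrDl mul1r mulrDr.
by apply: lerD; [exact: IH | rewrite mulrC ler_wpM2r// EF_M].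
Qed.

(** [F] changes by at most [L M m h] over [m] steps, so that the scheme follows its
    tangent up to a quadratic error, uniformly in the step size.  In the limit this
    estimate says that the limit curve solves the equation. *)
Let E_quad n i m : (i + m <= 2 ^ n)%N ->
  N (E n (i + m) - E n i - (m%:R * h n) *: F (E n i)) <= L * M * (m%:R * h n) ^+ 2.
Proof.
elim: m => [|m IH] jn.
  by rewrite addn0 subrr sub0r mul0r scale0r oppr0 (sn_0 H) expr0n mulr0.
rewrite addnS in jn *.
have jn1 := ltnW jn.
have PE := E_P jn1; have PF := EF_P jn1.
have ij : (i <= 2 ^ n)%N by apply: leq_trans jn1; exact: leq_addr.
have Pi := E_P ij; have PFi := EF_P ij.
have -> : E n (i + m).+1 = E n (i + m) + h n *: F (E n (i + m)) by [].
have -> : (m.+1%:R * h n) *: F (E n i) = (m%:R * h n) *: F (E n i) + h n *: F (E n i).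
  by rewrite -scalerDl -natr1 mulrDl mul1r.
have -> : E n (i + m) + h n *: F (E n (i + m)) - E n i -
   ((m%:R * h n) *: F (E n i) + h n *: F (E n i)) =
  (E n (i + m) - E n i - (m%:R * h n) *: F (E n i)) + h n *: (F (E n (i + m)) - F (E n i)).
  by rewrite scalerBr; zmod.
apply: (le_trans (sn_D H _ _)); [by auto|by auto|].
rewrite (sn_Z H); last by auto.
rewrite ger0_norm//.
have h1 := IH jn1.
have h2 : h n * N (F (E n (i + m)) - F (E n i)) <= h n * (L * (M * (m%:R * h n))).
  rewrite ler_wpM2l//; apply: (le_trans (FL PE (E_r jn1) Pi (E_r ij))).
  by rewrite ler_wpM2l// E_step.
apply: (le_trans (lerD h1 h2)); rewrite -natr1.
have m0 : 0 <= m%:R + 1 :> R by rewrite natr1 ler0n.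
have := mulr_ge0 (mulr_ge0 (mulr_ge0 L0 M0) (sqr_ge0 (h n))) m0; lra.
Qed.

(** Two half steps differ from one full step by [O(h^2)]; these errors accumulate
    as in the discrete Gronwall lemma. *)
Let E_compare n j : (j <= 2 ^ n)%N ->
  N (E n.+1 j.*2 - E n j) <= (1 + h n * L) ^+ j * (j%:R * (h n ^+ 2 * L * M)).
Proof.
elim: j => [|j IH] jn; first by rewrite /E /= subrr (sn_0 H) mul0r mulr0.
have jn1 := ltnW jn.
have d0 : (j.*2 <= 2 ^ n.+1)%N by rewrite expnS mul2n leq_double.
have d1 : (j.*2.+1 <= 2 ^ n.+1)%N.
  by rewrite (@leq_trans j.+1.*2)// ?doubleS// expnS mul2n -doubleS leq_double.
have PE := E_P jn1; have PF := EF_P jn1.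
have P0 := E_P d0; have PF0 := EF_P d0.
have P1 := E_P d1; have PF1 := EF_P d1.
rewrite doubleS.
have -> : E n.+1 j.*2.+2 = E n.+1 j.*2 + h n.+1 *: F (E n.+1 j.*2) + h n.+1 *: F (E n.+1 j.*2.+1) by [].
have -> : E n j.+1 = E n j + h n *: F (E n j) by [].
have -> : h n *: F (E n j) = h n.+1 *: F (E n j) + h n.+1 *: F (E n j).
  by rewrite -scalerDl hS mulr_natl.
have -> : E n.+1 j.*2 + h n.+1 *: F (E n.+1 j.*2) + h n.+1 *: F (E n.+1 j.*2.+1) -
  (E n j + (h n.+1 *: F (E n j) + h n.+1 *: F (E n j))) =
  (E n.+1 j.*2 - E n j) + h n.+1 *: (F (E n.+1 j.*2) - F (E n j)) +
   h n.+1 *: (F (E n.+1 j.*2.+1) - F (E n j)).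
  by rewrite !scalerBr; zmod.
apply: (le_trans (sn_D H _ _)); [by auto|by auto|].
apply: (le_trans (lerD (sn_D H _ _) (lexx _))); [by auto|by auto|].
rewrite !(sn_Z H); [|by auto|by auto].
rewrite ger0_norm//.
set e := N (E n.+1 j.*2 - E n j) in IH *.
have s1 := E_step (m := 1) (i := j.*2) (n := n.+1).
rewrite addn1 mul1r in s1; have {}s1 := s1 d1.
have l0 : N (F (E n.+1 j.*2) - F (E n j)) <= L * e.
  by apply: FL => //; exact: E_r.
have l1 : N (F (E n.+1 j.*2.+1) - F (E n j)) <= L * (M * h n.+1 + e).
  apply: (le_trans (FL P1 (E_r d1) PE (E_r jn1))); rewrite ler_wpM2l//.
  by apply: (le_trans (sn_tri H P1 P0 PE)); rewrite lerD2r.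
have e0 : 0 <= e by apply: (sn_ge0 H); auto.
have hh := h_ge0 n.+1.
apply: (@le_trans _ _ (e + h n.+1 * (L * e) + h n.+1 * (L * (M * h n.+1 + e)))).
  by rewrite !lerD// ler_wpM2l.
apply: (@le_trans _ _ ((1 + h n * L) * e + h n ^+ 2 * L * M)).
  have := mulr_ge0 (mulr_ge0 (sqr_ge0 (h n.+1)) L0) M0.
  rewrite (hS n); lra.
have X1 : 1 <= 1 + h n * L by rewrite lerDl mulr_ge0.
have K0 : 0 <= h n ^+ 2 * L * M by exact: mulr_ge0 (mulr_ge0 (sqr_ge0 (h n)) L0) M0.
rewrite -natr1 [(j%:R + 1) * _]mulrDl mul1r [leRHS]mulrDr.
apply: lerD.
  rewrite exprS.
  by rewrite -mulrA; apply: ler_wpM2l (IH jn1); lra.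
by rewrite ler_peMl// exprn_ege1.
Qed.

(** The index of the last grid point before [t].  The approximate solutions are
    piecewise constant in time, which is enough since grid steps have length
    [O(h)]. *)
Let q n (t : R) : nat := Num.truncn (t / h n).

Let qP n t : 0 <= t -> (q n t)%:R * h n <= t /\ t < (q n t)%:R * h n + h n.
Proof.
move=> t0; have th : 0 <= t / h n by rewrite divr_ge0.
have /andP[h1 h2] := truncn_itv th.
move: h1 h2; rewrite -/(q n t) ler_pdivlMr// ltr_pdivrMr// -natr1 mulrDl mul1r.
by move=> *; split.
Qed.

Let q_le n t : 0 <= t -> t <= a -> (q n t <= 2 ^ n)%N.
Proof.
move=> t0 ta; have [h1 _] := qP n t0.
by rewrite -(ler_nat R) -(ler_pM2r (h_gt0 n)) [leRHS]mulrC hE; lra.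
Qed.

Let qS n t : 0 <= t -> ((q n t).*2 <= q n.+1 t <= (q n t).*2.+1)%N.
Proof.
move=> t0; have [h1 h2] := qP n t0; have [h3 h4] := qP n.+1 t0.
have hp := h_gt0 n.+1; rewrite (hS n) in h1 h2.
apply/andP; split.
  rewrite -ltnS -(ltr_nat R) -(ltr_pM2r hp) -natr1 -muln2 natrM; lra.
rewrite -ltnS -doubleS -(ltr_nat R) -(ltr_pM2r hp) -muln2 natrM -natr1; lra.
Qed.

Let q_mono n s t : 0 <= s -> s <= t -> (q n s <= q n t)%N.
Proof.
move=> s0 st; have [h1 _] := qP n s0; have [_ h2] := qP n (le_trans s0 st).
rewrite -ltnS -(ltr_nat R) -(ltr_pM2r (h_gt0 n)) -[(q n t).+1%:R]natr1; lra.
Qed.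

Let C : R := a * M + expR (a * L) * (a ^+ 2 * L * M).

Let E_cauchy t n : 0 <= t -> t <= a ->
  N (E n.+1 (q n.+1 t) - E n (q n t)) <= C * 2 ^- n.
Proof.
move=> t0 ta; have qn := q_le n t0 ta; have qn1 := q_le n.+1 t0 ta.
have d0 : ((q n t).*2 <= 2 ^ n.+1)%N by rewrite expnS mul2n leq_double.
have Pn := E_P qn; have Pn1 := E_P qn1; have Pd := E_P d0.
apply: (le_trans (sn_tri H Pn1 Pd Pn)); rewrite mulrDl; apply: lerD.
  have /andP[q1 q2] := qS n t0.
  have [m mE m1] : exists2 m, q n.+1 t = ((q n t).*2 + m)%N & (m <= 1)%N.
    exists (q n.+1 t - (q n t).*2)%N; first by rewrite subnKC.
    by rewrite leq_subLR addn1.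
  rewrite mE; apply: (le_trans (E_step _)); first by rewrite -mE.
  apply: (@le_trans _ _ (M * (1 * h n.+1))).
    by rewrite ler_wpM2l// ler_wpM2r// lern1.
  have : 0 <= M * h n.+1 by rewrite mulr_ge0.
  rewrite mulrAC -/(h n) (hS n); lra.
apply: (le_trans (E_compare qn)); rewrite -[leRHS]mulrA.
have K0 : 0 <= h n ^+ 2 * L * M by exact: mulr_ge0 (mulr_ge0 (sqr_ge0 (h n)) L0) M0.
apply: ler_pM; [|exact: mulr_ge0| |].
- by rewrite exprn_ge0// addr_ge0// mulr_ge0.
- apply: expR_pow_le; first by rewrite mulr_ge0.
  by rewrite -mulrnAl ler_wpM2r// -mulr_natl hj.
have -> : a ^+ 2 * L * M * 2 ^- n = a * h n * (L * M) by rewrite /h; ring.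
have -> : (q n t)%:R * (h n ^+ 2 * L * M) = ((q n t)%:R * h n) * h n * (L * M) by ring.
by apply: ler_wpM2r; [exact: mulr_ge0 | apply: ler_wpM2r; [exact: h_ge0 | exact: hj]].
Qed.

(** The solution comes with a quadratic remainder that is uniform over all pairs of
    times in both orders; no further regularity of the curve is needed.  The initial
    value is attained up to seminorm 0. *)
Theorem ode_exists : exists (y : R -> V) (K : R),
  [/\ N (y 0 - x0) = 0,
      forall t, 0 <= t <= a -> P (y t) /\ N (y t - x0) < r &
      forall s t, 0 <= s <= a -> 0 <= t <= a ->
        N (y t - y s - (t - s) *: F (y s)) <= K * (t - s) ^+ 2].
Proof.
have /choice[y Hy] : forall t, exists y, 0 <= t <= a ->
    P y /\ forall n, N (E n (q n t) - y) <= 2 * C * 2 ^- n.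
  move=> t; have [/andP[t0 ta]|] := pselect (0 <= t <= a); last by exists 0.
  have [y [Py Hy]] := Hcomplete (x := fun n => E n (q n t)) (C := C)
    (fun n => E_P (q_le n t0 ta)) (fun n => E_cauchy n t0 ta).
  by exists y.
have yr t : 0 <= t <= a -> N (y t - x0) < r.
  move=> ta; have [Py Hn] := Hy t ta; have /andP[t0 t1] := ta.
  apply: le_lt_trans Mar; apply: (@le_of_pow2 _ _ _ (2 * C)) => n.
  have qn := q_le n t0 t1; have Pn := E_P qn.
  apply: (le_trans (sn_tri H Py Pn Px0)); rewrite addrC lerD//.
    have [_ NE] := E_in qn; apply: (le_trans NE).
    by rewrite ler_wpM2l// hj.
  by rewrite (sn_sym H).
have Hle s t : 0 <= s -> s <= t -> t <= a ->
    N (y t - y s - (t - s) *: F (y s)) <= L * M * (t - s) ^+ 2.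
  move=> s0 st ta; have t0 := le_trans s0 st; have sa := le_trans st ta.
  have ia : 0 <= s <= a by rewrite s0.
  have ta' : 0 <= t <= a by rewrite t0.
  have [Pys Hs] := Hy s ia; have [Pyt Ht] := Hy t ta'.
  have [PF MF] := FP Pys (yr s ia).
  pose D := 4 * C + a * M + a * L * (2 * C) + L * M * (3 * a ^+ 2).
  apply: (@le_of_pow2 _ _ _ D) => n.
  have qs := q_le n s0 sa; have qt := q_le n t0 ta.
  have := q_mono n s0 st; move=> /subnKC; set m := (_ - _)%N => Em.
  have Pns := E_P qs; have Pnt := E_P qt; have PFn := EF_P qs.
  have Hquad : N (E n (q n t) - E n (q n s) - (m%:R * h n) *: F (E n (q n s))) <=
      L * M * (m%:R * h n) ^+ 2.
    by rewrite -Em; apply: E_quad; rewrite Em.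
  have -> : y t - y s - (t - s) *: F (y s) =
     (E n (q n s) - y s) - (E n (q n t) - y t) +
     (E n (q n t) - E n (q n s) - (m%:R * h n) *: F (E n (q n s))) +
     ((m%:R * h n - (t - s)) *: F (E n (q n s)) + (t - s) *: (F (E n (q n s)) - F (y s))).
    by rewrite [(m%:R * h n - (t - s)) *: _]scalerBl scalerBr; zmod.
  apply: (le_trans (sn_D H _ _)); [by auto 6|by auto|].
  apply: (le_trans (lerD (sn_D H _ _) (sn_D H _ _))); [by auto..|].
  rewrite !(sn_Z H); [|by auto|by auto].
  have b1 : N ((E n (q n s) - y s) - (E n (q n t) - y t)) <= 4 * C * 2 ^- n.
    apply: (le_trans (sn_B H _ _)); [by auto|by auto|].
    by have := Hs n; have := Ht n; lra.
  have [m1 m2] : m%:R * h n <= (t - s) + h n /\ `|m%:R * h n - (t - s)| <= h n.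
    have [t1 t2] := qP n t0; have [s1 s2] := qP n s0.
    rewrite -Em natrD mulrDl in t1 t2.
    by split; [lra | rewrite ler_norml; apply/andP; split; lra].
  have b2 : N (F (E n (q n s)) - F (y s)) <= L * (2 * C * 2 ^- n).
    by apply: (le_trans (FL Pns (E_r qs) Pys (yr s ia))); rewrite ler_wpM2l.
  have b3 : `|m%:R * h n - (t - s)| * N (F (E n (q n s))) <= h n * M.
    by apply: ler_pM => //; [exact: (sn_ge0 H) | exact: EF_M].
  have b4 : `|t - s| * N (F (E n (q n s)) - F (y s)) <= a * (L * (2 * C * 2 ^- n)).
    apply: ler_pM => //; first by apply: (sn_ge0 H); auto.
    by rewrite ger0_norm; lra.
  have b5 : L * M * (m%:R * h n) ^+ 2 <= L * M * ((t - s) ^+ 2 + 3 * a * h n).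
    rewrite ler_wpM2l ?mulr_ge0//.
    apply: (@le_trans _ _ ((t - s + h n) ^+ 2)).
      by rewrite lerXn2r ?nnegrE ?mulr_ge0//; have := h_ge0 n; lra.
    have -> : (t - s + h n) ^+ 2 = (t - s) ^+ 2 + (2 * (t - s) + h n) * h n by ring.
    by rewrite lerD2l ler_wpM2r//; have := h_le n; lra.
  apply: (le_trans (lerD (lerD b1 (le_trans Hquad b5)) (lerD b3 b4))).
  by rewrite /D /h le_eqVlt; apply/orP; left; apply/eqP; ring.
have Pt t : 0 <= t <= a -> P (y t) by move=> /Hy[].
exists y, (L * M + L * (M + L * M * a)); split => [|t ta|s t sa ta].
- have z : 0 <= (0 : R) <= a by rewrite lexx ltW.
  have [Py Hn] := Hy 0 z.
  apply/eqP; rewrite eq_le (sn_ge0 H) ?andbT; last by auto.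
  apply: (@le_of_pow2 _ _ _ (2 * C)) => n; rewrite add0r.
  have := Hn n; rewrite /q mul0r truncn0 /E /= (sn_sym H)//.
- by split; [exact: Pt | exact: yr].
have [st|ts] := leP s t.
  apply: (le_trans (Hle s t _ st _)); [by case/andP: sa|by case/andP: ta|].
  rewrite ler_wpM2r ?sqr_ge0// lerDl !mulr_ge0// !addr_ge0 ?mulr_ge0// ltW//.
have [t0 sa2] : 0 <= t /\ s <= a by case/andP: sa; case/andP: ta.
have h1 := Hle t s t0 (ltW ts) sa2.
have Ps := Pt s sa; have Ptt := Pt t ta.
have [PFs MFs] := FP Ps (yr s sa); have [PFt MFt] := FP Ptt (yr t ta).
have -> : y t - y s - (t - s) *: F (y s) =
   - ((y s - y t - (s - t) *: F (y t)) - (s - t) *: (F (y s) - F (y t))).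
  have -> : (t - s) *: F (y s) = - ((s - t) *: F (y s)) by rewrite -scaleNr opprB.
  by rewrite scalerBr; zmod.
rewrite (sn_N H); last by auto.
apply: (le_trans (sn_B H _ _)); [by auto|by auto|].
rewrite (sn_Z H); last by auto.
have st0 : 0 <= s - t by lra.
rewrite (ger0_norm st0) [leRHS]mulrDl.
have -> : (t - s) ^+ 2 = (s - t) ^+ 2 by ring.
apply: lerD => //.
have -> : L * (M + L * M * a) * (s - t) ^+ 2 = (s - t) * (L * ((M + L * M * a) * (s - t))) by ring.
rewrite ler_wpM2l//; apply: (le_trans (FL Ps (yr s sa) Ptt (yr t ta))); rewrite ler_wpM2l//.
have := sn_rtri H (x := y s - y t) (y := (s - t) *: F (y t)).
move=> /(_ _ _)/le_trans; apply; [by auto|by auto|].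
rewrite (sn_Z H)// (ger0_norm st0).
have : (s - t) * N (F (y t)) <= (s - t) * M by rewrite ler_wpM2l.
have : L * M * (s - t) * (s - t) <= L * M * (s - t) * a.
  by rewrite ler_wpM2l ?mulr_ge0//; lra.
lra.
Qed.
End Euler.

(** * Frechet differentiable maps with bounded derivative are Lipschitz *)
Section MeanValueFrechet.
Context {R : realType} {V : lmodType R}.
Variables (P : V -> Prop) (N : V -> R) (H : seminorm_on P N).
Local Hint Extern 1 (P (_ + _)) => apply: (sn_PD H) : core.
Local Hint Extern 1 (P (_ - _)) => apply: (sn_PB H) : core.
Local Hint Extern 1 (P (_ *: _)) => apply: (sn_PZ H) : core.

Definition inBall (x0 : V) (r : R) (x : V) : Prop := P x /\ N (x - x0) < r.

(** [mean_value] along the segment from [g] to [f], which stays in the ball. *)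
Lemma frechet_lipschitz (T : V -> V) (D : V -> V -> V) (x0 : V) (r L : R) : P x0 ->
  (forall x, inBall x0 r x -> P (T x)) ->
  (forall x, inBall x0 r x -> forall h, P h -> P (D x h) /\ N (D x h) <= L * N h) ->
  (forall x, inBall x0 r x -> forall e, 0 < e -> exists2 d, 0 < d &
     forall h, P h -> N h < d -> N (T (x + h) - T x - D x h) <= e * N h) ->
  forall f g, inBall x0 r f -> inBall x0 r g -> N (T f - T g) <= L * N (f - g).
Proof.
move=> Px0 TP DP TD f g [fP fB] [gP gB].
pose p (s : R) : V := g + s *: (f - g).
have fgP : P (f - g) by auto.
have pB s : 0 <= s -> s <= 1 -> inBall x0 r (p s).
  move=> s0 s1; split; first by rewrite /p; auto.
  have -> : p s - x0 = (1 - s) *: (g - x0) + s *: (f - x0).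
    rewrite /p scalerBl scale1r !scalerBr; zmod.
  apply: (le_lt_trans (sn_D H _ _)); [by auto|by auto|].
  rewrite !(sn_Z H); [|by auto|by auto].
  rewrite (ger0_norm s0) ger0_norm ?subr_ge0//.
  have [s00|s00] := eqVneq s 0; first by rewrite s00 mul0r addr0 subr0 mul1r.
  have sp : 0 < s by rewrite lt_def s00.
  have h1 : s * N (f - x0) < s * r by rewrite ltr_pM2l.
  have h2 : (1 - s) * N (g - x0) <= (1 - s) * r by rewrite ler_wpM2l ?subr_ge0// ltW.
  lra.
have E1 : p 1 = f by rewrite /p scale1r; zmod.
have E0 : p 0 = g by rewrite /p scale0r addr0.
have Nfg := sn_ge0 H fgP.
have := mean_value H (g := fun s => T (p s)) (K := L * N (f - g)) ler01.
rewrite E1 E0 subr0 mulr1; apply => [t t0 t1|s s0 s1 e e0].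
  exact: TP (pB t t0 t1).
have Bs := pB s s0 s1.
pose e' := e / (N (f - g) + 1).
have N1 : 0 < N (f - g) + 1 by lra.
have e'0 : 0 < e' by rewrite divr_gt0.
have e'N : e' * N (f - g) <= e.
  by rewrite /e' mulrAC ler_pdivrMr// ler_wpM2l ?(ltW e0)//; lra.
have [d d0 Hd] := TD _ Bs e' e'0.
exists (d / (N (f - g) + 1)); first by rewrite divr_gt0.
move=> t t0 t1 ts.
have hP : P ((t - s) *: (f - g)) by auto.
have Nh : N ((t - s) *: (f - g)) = `|t - s| * N (f - g) by rewrite (sn_Z H).
have hd : N ((t - s) *: (f - g)) < d.
  rewrite Nh; apply: (@le_lt_trans _ _ (`|t - s| * (N (f - g) + 1))).
    by rewrite ler_wpM2l//; lra.
  by rewrite -ltr_pdivlMr.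
have Ept : p s + (t - s) *: (f - g) = p t.
  by rewrite /p -addrA -scalerDl; congr (_ + _ *: _); ring.
have hr := Hd _ hP hd; rewrite Ept in hr.
have Pt := TP _ (pB t t0 t1); have Ps := TP _ Bs; have [PD DN] := DP _ Bs _ hP.
apply: (le_trans (sn_rtri H (y := D (p s) ((t - s) *: (f - g))) _ _)); [by auto|by auto|].
apply: (le_trans (lerD hr DN)); rewrite -mulrDl Nh.
have := ler_wpM2r (normr_ge0 (t - s)) e'N; lra.
Qed.
End MeanValueFrechet.

(** * Integration over the circle and uniqueness of Fourier coefficients *)
Section CircleIntegral.
Context {R : realType}.
Local Notation leb := (@lebesgue_measure R).
Local Notation circle := (@circle R).

Definition integrableC (f : R -> R) : Prop := leb.-integrable circle (EFin \o f).
Definition intC (f : R -> R) : R := (\int[leb]_(x in circle) f x)%R.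

Definition bounded_measurable (p : R -> R) : Prop :=
  measurable_fun [set: R] p /\ exists M, forall x, `|p x| <= M.

Lemma period_gt0 : 0 < period :> R.
Proof. by rewrite /period mulrn_wgt0// pi_gt0. Qed.

Lemma mcircle : measurable (circle : set (measurableTypeR R)).
Proof. exact: measurable_itv. Qed.
Hint Resolve mcircle : core.

Lemma lebesgue_circle : leb circle = period%:E.
Proof. by rewrite lebesgue_measure_itv/= lte_fin period_gt0/= sube0. Qed.

Lemma circle_fin : (leb circle < +oo)%E.
Proof. by rewrite lebesgue_circle ltry. Qed.

Lemma intC_cst (c : R) : intC (fun=> c) = c * period.
Proof. exact: etrans (Rintegral_cst leb mcircle c) (congr1 (fun t => c * fine t) lebesgue_circle). Qed.

Lemma integrableC_bounded (p : R -> R) : bounded_measurable p -> integrableC p.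
Proof.
move=> [mp [M pM]].
apply: measurable_bounded_integrable; [exact: mcircle|exact: circle_fin|exact: measurable_funTS|].
exists M; split; first exact: num_real.
by move=> B MB x _; apply: le_trans (pM x) _; exact: ltW.
Qed.

Lemma integrableC_meas f : integrableC f -> measurable_fun circle f.
Proof. by move=> /measurable_int /measurable_EFinP. Qed.

Lemma integrableCD f g : integrableC f -> integrableC g -> integrableC (fun x => f x + g x).
Proof. by move=> If Ig; have := integrableD mcircle If Ig; exact. Qed.

Lemma integrableCZ c f : integrableC f -> integrableC (fun x => c * f x).
Proof. by move=> If; have := integrableZl mcircle c If; exact. Qed.

Lemma integrableCM f p : integrableC f -> bounded_measurable p ->
  integrableC (fun x => f x * p x).
Proof.
move=> If [mp [M pM]].
apply: (@le_integrable _ _ _ _ _ mcircle _ (EFin \o (fun x => M * f x))).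
- apply/measurable_EFinP; apply: measurable_funM; first exact: integrableC_meas.
  exact: measurable_funTS.
- move=> x _ /=; rewrite lee_fin !normrM mulrC ler_wpM2r//.
  by apply: le_trans (pM x) _; exact: ler_norm.
- exact: integrableCZ.
Qed.

Lemma integrableC_le (f g : R -> R) : measurable_fun circle f -> integrableC g ->
  (forall x, `|f x| <= g x) -> integrableC f.
Proof.
move=> mf Ig fg; apply: (@le_integrable _ _ _ _ _ mcircle _ (EFin \o g)) => //.
- exact/measurable_EFinP.
- by move=> x _ /=; rewrite lee_fin (le_trans (fg x))// ler_norm.
Qed.

Lemma intCD f g : integrableC f -> integrableC g ->
  intC (fun x => f x + g x) = intC f + intC g.
Proof. by move=> If Ig; exact: RintegralD. Qed.

Lemma intCZ c f : integrableC f -> intC (fun x => c * f x) = c * intC f.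
Proof. by move=> If; exact: RintegralZl. Qed.

Lemma bm_cst c : bounded_measurable (fun=> c).
Proof. by split; [exact: measurable_cst | exists `|c|]. Qed.

Lemma bmM p q : bounded_measurable p -> bounded_measurable q ->
  bounded_measurable (fun x => p x * q x).
Proof.
move=> [mp [M pM]] [mq [M' qM]]; split; first exact: measurable_funM.
by exists (M * M') => x; rewrite normrM ler_pM.
Qed.

Lemma bmD p q : bounded_measurable p -> bounded_measurable q ->
  bounded_measurable (fun x => p x + q x).
Proof.
move=> [mp [M pM]] [mq [M' qM]]; split; first exact: measurable_funD.
by exists (M + M') => x; apply: (le_trans (ler_normD _ _)); rewrite lerD.
Qed.

Lemma bm_cos k : bounded_measurable (fun x => cos (k * x)).
Proof.
split; last by exists 1 => x; exact: cos_max.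
apply: continuous_measurable_fun => x; apply: continuous_comp; last exact: continuous_cos.
exact: mulrl_continuous.
Qed.

Lemma bm_sin k : bounded_measurable (fun x => sin (k * x)).
Proof.
split; last by exists 1 => x; exact: sin_max.
apply: continuous_measurable_fun => x; apply: continuous_comp; last exact: continuous_sin.
exact: mulrl_continuous.
Qed.

(** The next four lemmas are the classical step functions of the Stone-Weierstrass
    theorem: on [0, 1] the polynomials [(1 - u ^ n) ^ (2 ^ n)] tend to 1 below 1/2
    and to 0 above, by Bernoulli's inequality. *)
Lemma bernoulli_le (x : R) (k : nat) : 0 <= x <= 1 -> 1 - k%:R * x <= (1 - x) ^+ k.
Proof.
move=> /andP[x0 x1]; elim: k => [|k IH]; first by rewrite mul0r subr0.
rewrite exprS; apply: (@le_trans _ _ ((1 - x) * (1 - k%:R * x))).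
  have : 0 <= k%:R * x * x by rewrite !mulr_ge0.
  rewrite -natr1; lra.
by rewrite ler_wpM2l// subr_ge0.
Qed.

Lemma bernoulli_ge (x : R) (k : nat) : 0 <= x <= 1 -> (1 - x) ^+ k * (1 + k%:R * x) <= 1.
Proof.
move=> /andP[x0 x1]; elim: k => [|k IH]; first by rewrite mul0r addr0 mul1r.
rewrite exprS; apply: le_trans IH.
rewrite [_ * (1 - x) ^+ k]mulrC -mulrA ler_wpM2l ?exprn_ge0 ?subr_ge0//.
have : 0 <= (1 + k%:R) * x * x by rewrite !mulr_ge0// addr_ge0.
rewrite -natr1; lra.
Qed.

Lemma step_cvg1 (u : R) : 0 <= u -> u < 2^-1 ->
  (fun n => (1 - u ^+ n) ^+ (2 ^ n)) @ \oo --> (1 : R).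
Proof.
move=> u0 u2.
have un n : 0 <= u ^+ n <= 1 by rewrite exprn_ge0//= exprn_ile1//; lra.
apply: (@squeeze_cvgr _ _ _ _ (fun n => 1 - (2 * u) ^+ n) (fun=> 1)); last exact: cvg_cst.
  near=> n; apply/andP; split.
    by rewrite exprMn -natrX; exact: bernoulli_le.
  by have /andP[a b] := un n; rewrite exprn_ile1//; lra.
rewrite -[X in _ --> X]subr0; apply: cvgB; first exact: cvg_cst.
by apply: cvg_expr; rewrite ger0_norm ?mulr_ge0//; lra.
Unshelve. all: by end_near. Qed.

Lemma step_cvg0 (u : R) : 2^-1 < u -> u <= 1 ->
  (fun n => (1 - u ^+ n) ^+ (2 ^ n)) @ \oo --> (0 : R).
Proof.
move=> u2 u1; have u0 : 0 < u by lra.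
have un n : 0 <= u ^+ n <= 1 by rewrite exprn_ge0 ?(ltW u0)//= exprn_ile1// ltW.
apply: (@squeeze_cvgr _ _ _ _ (fun=> 0) (fun n => ((2 * u)^-1) ^+ n)).
- near=> n; have /andP[a b] := un n; apply/andP; split.
    by rewrite exprn_ge0// subr_ge0.
  rewrite exprVn -[leRHS]mul1r ler_pdivlMr ?exprn_gt0 ?mulr_gt0//.
  apply: le_trans (bernoulli_ge (2 ^ n) (un n)).
  rewrite ler_wpM2l ?exprn_ge0 ?subr_ge0// natrX -exprMn; lra.
- exact: cvg_cst.
- apply: cvg_expr; rewrite ger0_norm ?invr_ge0 ?mulr_ge0 ?(ltW u0)//.
  by rewrite invf_lt1 ?mulr_gt0//; lra.
Unshelve. all: by end_near. Qed.

Lemma ae_neq (c : R) : \forall x \ae leb, x != c.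
Proof.
exists [set c]; split => //; first exact: lebesgue_measure_set1.
by move=> x /= /negP; rewrite negbK => /eqP.
Qed.

Section Uniqueness.
Variable w : R -> R.
Hypothesis Iw : integrableC w.

(** [Z p]: the function [w p] has zero Fourier coefficients.  Integer frequencies,
    because multiplying [p] by a trigonometric function shifts the frequency in both
    directions. *)
Let Z (p : R -> R) : Prop := bounded_measurable p /\ forall k : int,
  intC (fun x => w x * p x * cos (k%:~R * x)) = 0 /\
  intC (fun x => w x * p x * sin (k%:~R * x)) = 0.

Let Iwc p k : Z p -> integrableC (fun x => w x * p x * cos (k%:~R * x)).
Proof. by move=> [bp _]; apply: integrableCM (bm_cos _); exact: integrableCM. Qed.

Let Iws p k : Z p -> integrableC (fun x => w x * p x * sin (k%:~R * x)).
Proof. by move=> [bp _]; apply: integrableCM (bm_sin _); exact: integrableCM. Qed.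

Let Z_lin c p q : Z p -> Z q -> Z (fun x => c * p x + q x).
Proof.
move=> Zp Zq; have [bp zp] := Zp; have [bq zq] := Zq.
split; first by apply: bmD => //; apply: bmM => //; exact: bm_cst.
move=> k; have [zpc zps] := zp k; have [zqc zqs] := zq k; split.
- transitivity (intC (fun x => c * (w x * p x * cos (k%:~R * x)) + w x * q x * cos (k%:~R * x))).
    by congr intC; apply/funext => x; ring.
  rewrite intCD; [|by apply: integrableCZ; exact: Iwc|exact: Iwc].
  by rewrite intCZ ?zpc ?zqc ?mulr0 ?addr0//; exact: Iwc.
- transitivity (intC (fun x => c * (w x * p x * sin (k%:~R * x)) + w x * q x * sin (k%:~R * x))).
    by congr intC; apply/funext => x; ring.
  rewrite intCD; [|by apply: integrableCZ; exact: Iws|exact: Iws].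
  by rewrite intCZ ?zps ?zqs ?mulr0 ?addr0//; exact: Iws.
Qed.

Let half_sum (c : R) (f g : R -> R) : integrableC f -> integrableC g -> intC f = 0 ->
  intC g = 0 -> intC (fun x => 2^-1 * (f x + c * g x)) = 0.
Proof.
move=> If Ig f0 g0; rewrite intCZ; last by apply: integrableCD => //; exact: integrableCZ.
by rewrite intCD ?intCZ ?f0 ?g0 ?mulr0 ?addr0 ?mulr0//; exact: integrableCZ.
Qed.

Let kD (k : int) (x : R) : (k + 1)%:~R * x = k%:~R * x + x.
Proof. by rewrite intrD mulrDl mul1r. Qed.
Let kB (k : int) (x : R) : (k - 1)%:~R * x = k%:~R * x - x.
Proof. by rewrite intrB mulrBl mul1r. Qed.

Let Z_cos p : Z p -> Z (fun x => p x * cos x).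
Proof.
move=> Zp; have [bp zp] := Zp; split.
  by apply: bmM => //; have := bm_cos 1; under eq_fun do rewrite mul1r.
move=> k; have [c1 s1] := zp (k + 1); have [c2 s2] := zp (k - 1); split.
- rewrite -(half_sum 1 (Iwc _ Zp) (Iwc _ Zp) c1 c2); congr intC; apply/funext => x.
  by rewrite kD kB cosB cosD; field.
- rewrite -(half_sum 1 (Iws _ Zp) (Iws _ Zp) s1 s2); congr intC; apply/funext => x.
  by rewrite kD kB sinB sinD; field.
Qed.

Let Z_sin p : Z p -> Z (fun x => p x * sin x).
Proof.
move=> Zp; have [bp zp] := Zp; split.
  by apply: bmM => //; have := bm_sin 1; under eq_fun do rewrite mul1r.
move=> k; have [c1 s1] := zp (k + 1); have [c2 s2] := zp (k - 1); split.
- rewrite -(half_sum (-1) (Iws _ Zp) (Iws _ Zp) s1 s2); congr intC; apply/funext => x.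
  by rewrite kD kB sinB sinD; field.
- rewrite -(half_sum (-1) (Iwc _ Zp) (Iwc _ Zp) c2 c1); congr intC; apply/funext => x.
  by rewrite kD kB cosB cosD; field.
Qed.

Let Z_affine c0 c1 c2 p : Z p -> Z (fun x => (c0 + c1 * cos x + c2 * sin x) * p x).
Proof.
move=> Zp.
have Z0 : Z (fun=> 0).
  split; [exact: bm_cst|move=> k; split].
  - transitivity (intC (fun x => 0 * w x)); last by rewrite intCZ ?mul0r.
    by congr intC; apply/funext => x; rewrite mulr0 !mul0r.
  - transitivity (intC (fun x => 0 * w x)); last by rewrite intCZ ?mul0r.
    by congr intC; apply/funext => x; rewrite mulr0 !mul0r.
have := Z_lin c0 Zp (Z_lin c1 (Z_cos Zp) (Z_lin c2 (Z_sin Zp) Z0)).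
by congr Z; apply/funext => x; ring.
Qed.

Hypothesis w_cos : forall n : nat, intC (fun x => w x * cos (n%:R * x)) = 0.
Hypothesis w_sin : forall n : nat, intC (fun x => w x * sin (n%:R * x)) = 0.

Let Z_1 : Z (fun=> 1).
Proof.
split; first exact: bm_cst.
move=> [n|n].
  split; [rewrite -(w_cos n)|rewrite -(w_sin n)]; congr intC; apply/funext => x;
  by rewrite mulr1.
rewrite NegzE; split.
  rewrite -(w_cos n.+1); congr intC; apply/funext => x.
  by rewrite mulr1 mulrNz mulNr cosN.
rewrite -(mulr0 (-1)) -(w_sin n.+1) -intCZ.
  congr intC; apply/funext => x.
  by rewrite mulr1 mulrNz mulNr sinN mulrN mulN1r.
by apply: integrableCM => //; exact: bm_sin.
Qed.

(** For [u] an affine combination of [cos] and [sin] these are trigonometric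
    polynomials, so that they are orthogonal to [w]. *)
Let approx (u : R -> R) n x : R := (1 - u x ^+ n) ^+ (2 ^ n).

Let int_approx c0 c1 c2 n :
  intC (fun x => w x * approx (fun x => c0 + c1 * cos x + c2 * sin x) n x) = 0.
Proof.
pose u x : R := c0 + c1 * cos x + c2 * sin x.
have Zu m p : Z p -> Z (fun x => u x ^+ m * p x).
  elim: m p => [|m IH] p Zp.
    by move: Zp; congr Z; apply/funext => x; rewrite expr0 mul1r.
  have := Z_affine c0 c1 c2 (IH _ Zp); congr Z; apply/funext => x.
  by rewrite exprS -mulrA.
have Z1u p : Z p -> Z (fun x => (1 - u x ^+ n) * p x).
  move=> Zp; have := Z_lin (-1) (Zu n _ Zp) Zp; congr Z; apply/funext => x; ring.
have ZQ m : Z (fun x => (1 - u x ^+ n) ^+ m).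
  elim: m => [|m IH]; first by move: Z_1; congr Z; apply/funext => x; rewrite expr0.
  by have := Z1u _ IH; congr Z; apply/funext => x; rewrite exprS.
have [_ /(_ 0)[+ _]] := ZQ (2 ^ n)%N.
by move=> <-; congr intC; apply/funext => x; rewrite mul0r cos0 mulr1.
Qed.

(** With [u = 1/2 - sin (x / 2) sin ((b - x) / 2) / 2], which is an affine
    combination of [cos] and [sin], one has [u < 1/2] exactly on [0 < x < b] and
    [u > 1/2] on [b < x < period].  Hence [approx u n] converges boundedly to the
    indicator function of [[0, b]], and dominated convergence applies. *)
Let int_prefix b : 0 < b -> b <= period -> (\int[leb]_(x in `[0, b]) w x)%R = 0.
Proof.
move=> b0 bp.
pose u x : R := (2^-1 + cos (b / 2) / 4) + (- cos (b / 2) / 4) * cos x + (- sin (b / 2) / 4) * sin x.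
have uE x : u x = 2^-1 - sin (x / 2) * sin ((b - x) / 2) / 2.
  have -> : (b - x) / 2 = b / 2 - x / 2 by field.
  have {1}-> : x = x / 2 + x / 2 by field.
  rewrite /u sinB; have -> : x = x / 2 + x / 2 by field.
  rewrite cosD sinD; have -> : (x / 2 + x / 2) / 2 = x / 2 by field.
  have := cos2Dsin2 (x / 2); set c := cos (x / 2); set s := sin (x / 2) => cs.
  have -> : c * c = 1 - s * s by rewrite -!expr2 -cs addrK.
  by field.
have u01 x : 0 <= u x <= 1.
  rewrite uE.
  have : `|sin (x / 2) * sin ((b - x) / 2)| <= 1.
    by rewrite normrM mulr_ile1 ?normr_ge0 ?sin_max.
  rewrite ler_norml => /andP[h1 h2]; apply/andP; split; lra.
have Q01 n x : 0 <= approx u n x <= 1.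
  have /andP[u0 u1] := u01 x.
  have h0 : 0 <= 1 - u x ^+ n by rewrite subr_ge0 exprn_ile1.
  rewrite /approx exprn_ge0//= exprn_ile1//.
  by rewrite lerBlDr lerDl exprn_ge0.
have mw := integrableC_meas Iw.
have bu n : bounded_measurable (approx u n).
  split; last first.
    by exists 1 => x; have /andP[h0 h1] := Q01 n x; rewrite ger0_norm.
  apply: measurable_funX; apply: measurable_funB; first exact: measurable_cst.
  apply: measurable_funX.
  have bm1 : bounded_measurable (@cos R) by have := bm_cos 1; under eq_fun do rewrite mul1r.
  have bm2 : bounded_measurable (@sin R) by have := bm_sin 1; under eq_fun do rewrite mul1r.
  by have [] := bmD (bmD (bm_cst (2^-1 + cos (b / 2) / 4)) (bmM (bm_cst (- cos (b / 2) / 4)) bm1))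
     (bmM (bm_cst (- sin (b / 2) / 4)) bm2).
have mb : measurable (`[0, b]%classic : set (measurableTypeR R)) by exact: measurable_itv.
have pi0 : 0 < pi :> R := pi_gt0 R.
have pE : period = 2 * pi :> R by rewrite /period mulr_natl.
have [] := @dominated_convergence _ _ _ leb _ mcircle
  (fun n x => (w x * approx u n x)%:E) (EFin \o (w \_ `[0, b])) (EFin \o (fun x => `|w x|)).
- move=> n; apply/measurable_EFinP; apply: measurable_funM => //.
  by apply: measurable_funTS; case: (bu n).
- apply/measurable_EFinP; apply/measurable_restrict => //.
  by apply: measurable_funS mw => // x [].
- have := ae_neq 0; have := ae_neq b; have := ae_neq period.
  apply: (@filterS3 _ _ (ae_filter_ringOfSetsType leb)) => x xp xb x0 /=; rewrite /circle/= in_itv/= => /andP[x0' xp'].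
  apply: cvg_EFin; first by near=> n.
  have {}x0' : 0 < x by rewrite lt_def x0.
  have {}xp' : x < period by rewrite lt_def eq_sym xp.
  have sx : 0 < sin (x / 2) by apply: sin_gt0_pi; apply/andP; split; lra.
  have /andP[u0 u1] := u01 x.
  rewrite patchE mem_setE in_itv/= (ltW x0')/=.
  have [xb'|bx] := leP x b.
    rewrite -[X in _ --> X]mulr1; apply: cvgM; first exact: cvg_cst.
    have {}xb' : x < b by rewrite lt_def eq_sym xb.
    apply: step_cvg1 => //; rewrite uE.
    have : 0 < sin ((b - x) / 2) by apply: sin_gt0_pi; apply/andP; split; lra.
    by move=> /(mulr_gt0 sx); lra.
  rewrite -[X in _ --> X](mulr0 (w x)); apply: cvgM; first exact: cvg_cst.
  apply: step_cvg0 => //; rewrite uE.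
  have : 0 < sin ((x - b) / 2) by apply: sin_gt0_pi; apply/andP; split; lra.
  have -> : (b - x) / 2 = - ((x - b) / 2) by field.
  by rewrite sinN => /(mulr_gt0 sx); lra.
- exact: (integrable_abse Iw).
- apply: aeW => x n _ /=; rewrite lee_fin normrM ler_piMr//.
  by have /andP[h0 h1] := Q01 n x; rewrite ger0_norm.
move=> Iw0 _ lim0.
have : (fun n => (\int[leb]_(x in circle) (w x * approx u n x)%:E)%E) @ \oo --> 0%:E.
  rewrite (_ : (fun _ => _) = fun=> 0%E); first exact: cvg_cst.
  apply/funext => n; rewrite -[RHS]/(0%:E) -(int_approx (2^-1 + cos (b / 2) / 4) (- cos (b / 2) / 4) (- sin (b / 2) / 4) n).
  by rewrite /intC /Rintegral fineK//; apply: integrable_fin_num => //; exact: integrableCM.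
move=> /(cvg_unique _ lim0)/(congr1 fine) /= lim_eq.
have -> : `[0, b]%classic = circle `&` `[0, b]%classic :> set R.
    apply/seteqP; split=> x /=; rewrite /circle/= !in_itv/=; last by case.
    by move=> /andP[h1 h2]; rewrite h1 h2 (le_trans h2).
rewrite Rintegral_mkcondr /Rintegral. exact: lim_eq.
Unshelve. all: by end_near. Qed.

(** All primitives [int_0^x w] vanish, hence so does their derivative, which is [w]
    almost everywhere by Lebesgue's differentiation theorem. *)
Theorem trig_uniqueness : ae_eq leb circle w (cst 0).
Proof.
pose w0 := w \_ circle.
have Iw0 : leb.-integrable [set: R] (EFin \o w0).
  by move/(integrable_mkcond _ mcircle) : Iw; rewrite /w0 restrict_EFin.
have lw0 : locally_integrable [set: R] w0 by exact: integrable_locally_restrict Iw.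
have H1 (y : R) : leb.-integrable [set` Interval (BLeft 0) (BRight y)] (EFin \o w0).
  by apply: integrableS Iw0.
have F0 x : 0 < x -> (\int[leb]_(t in [set` Interval (BLeft 0) (BRight x)]) w0 t)%R = 0.
  move=> x0; rewrite /w0 -Rintegral_mkcondl.
  have m0 : 0 < Num.min x period by rewrite lt_min x0 period_gt0.
  rewrite -[RHS](int_prefix m0) ?ge_min ?lexx ?orbT//.
  congr Rintegral; apply/seteqP; split=> t /=; rewrite /circle/= !in_itv/=.
    by move=> [/andP[h1 h2] /andP[h3 h4]]; rewrite le_min h1 h2 h4.
  by rewrite le_min => /and3P[h1 h2 h3]; rewrite h1 h2 h3.
have := FTC1 H1 lw0; have := ae_neq 0.
apply: (@filterS2 _ _ (ae_filter_ringOfSetsType leb)) => x x0 /= + cx.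
have [cx1 cx2] : 0 <= x /\ x <= period by move: cx; rewrite /circle/= in_itv/= => /andP[].
have xgt0 : 0 < x by rewrite lt_def x0.
move=> /(_ _)[]; first by rewrite ?bnd_simp ?lte_fin /= ?lteBSide.
move=> _; rewrite {2}/w0 patchE mem_set// => <-.
rewrite derive1E (near_eq_derive (g := cst 0)) ?derive_cst//.
near=> t; apply: F0; near: t; exact: lt_nbhsr.
Unshelve. all: by end_near. Qed.

End Uniqueness.
End CircleIntegral.

(** * The space L^2 and its completeness *)
Section L2.
Context {R : realType}.
Local Notation leb := (@lebesgue_measure R).
Local Notation circle := (@circle R).
Local Notation re := (@complex.Re R).
Local Notation im := (@complex.Im R).
Local Notation VF := (R -> Rcomplex R).
Implicit Types f g h : VF.

(** The real inner product of complex functions, that is, the real part of the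
    Hermitian one.  The imaginary part is recovered by pairing with [mulI g]. *)
Definition l2ip f g : R := intC (fun x => re (f x) * re (g x) + im (f x) * im (g x)).

Lemma normc_sqr (z : R[i]) : normc z ^+ 2 = re z ^+ 2 + im z ^+ 2.
Proof. by case: z => a b /=; rewrite sqr_sqrtr// addr_ge0 ?sqr_ge0. Qed.

Lemma ReZ (c : R) (z : Rcomplex R) : re (c *: z) = c * re z.
Proof. by case: z. Qed.
Lemma ImZ (c : R) (z : Rcomplex R) : im (c *: z) = c * im z.
Proof. by case: z. Qed.
Lemma ReD (z t : R[i]) : re (z + t) = re z + re t.
Proof. by case: z; case: t. Qed.
Lemma ImD (z t : R[i]) : im (z + t) = im z + im t.
Proof. by case: z; case: t. Qed.
Lemma ReN (z : R[i]) : re (- z) = - re z.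
Proof. by case: z. Qed.
Lemma ImN (z : R[i]) : im (- z) = - im z.
Proof. by case: z. Qed.
Lemma complex_eq (z t : R[i]) : re z = re t -> im z = im t -> z = t.
Proof. by case: z => a b; case: t => c d /= -> ->. Qed.

Lemma scalerE (c : R) f : c *: f = (c%:C \*o f : R -> R[i]).
Proof.
apply/funext => x; apply: complex_eq; case E : (f x) => [a b];
by rewrite /GRing.scale /= E /= ?mul0r ?subr0 ?addr0.
Qed.

Lemma normL2E f : normL2 f = Num.sqrt (l2ip f f).
Proof.
by congr Num.sqrt; congr intC; apply/funext => x; rewrite normc_sqr !expr2.
Qed.

(** Real and imaginary parts of elements of L^2, without periodicity. *)
Definition sq_integrable (a : R -> R) : Prop :=
  measurable_fun [set: R] a /\ integrableC (fun x => a x ^+ 2).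

Lemma inL2P f : inL2 f <-> periodic f period /\
  sq_integrable (fun x => re (f x)) /\ sq_integrable (fun x => im (f x)).
Proof.
split=> [[pf mr mi If]|[pf [[mr Ir] [mi Ii]]]].
  split=> //; split; split=> //.
  - apply: integrableC_le If _; first by apply: measurable_funTS; exact: measurable_funX.
    by move=> x; rewrite normc_sqr ger0_norm ?sqr_ge0// lerDl sqr_ge0.
  - apply: integrableC_le If _; first by apply: measurable_funTS; exact: measurable_funX.
    by move=> x; rewrite normc_sqr ger0_norm ?sqr_ge0// lerDr sqr_ge0.
split=> //; have := integrableCD Ir Ii.
by congr (lebesgue_measure.-integrable _ _); apply/funext => x /=; rewrite normc_sqr.
Qed.

Lemma sq_integrableM a b : sq_integrable a -> sq_integrable b ->
  integrableC (fun x => a x * b x).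
Proof.
move=> [ma Ia] [mb Ib]; apply: integrableC_le (integrableCD Ia Ib) _.
  by apply: measurable_funTS; exact: measurable_funM.
move=> x; rewrite ler_norml; apply/andP; split.
  by have := sqr_ge0 (a x + b x); have := sqr_ge0 (a x); have := sqr_ge0 (b x); nra.
by have := sqr_ge0 (a x - b x); have := sqr_ge0 (a x); have := sqr_ge0 (b x); nra.
Qed.

Lemma sq_integrable_bounded p : bounded_measurable p -> sq_integrable p.
Proof.
move=> bp; split; first by case: bp.
by have := integrableC_bounded (bmM bp bp); congr integrableC; apply/funext => x; rewrite expr2.
Qed.

Lemma sq_integrableW a : sq_integrable a -> integrableC a.
Proof.
move=> sa; have := sq_integrableM sa (sq_integrable_bounded (bm_cst 1)).
by congr integrableC; apply/funext => x; rewrite mulr1.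
Qed.

Lemma sq_integrable_lin c a b : sq_integrable a -> sq_integrable b ->
  sq_integrable (fun x => c * a x + b x).
Proof.
move=> [ma Ia] [mb Ib]; split.
  by apply: measurable_funD => //; apply: measurable_funM => //; exact: measurable_cst.
have I1 := integrableCZ (c ^+ 2) Ia.
have I2 := integrableCZ (2 * c) (sq_integrableM (conj ma Ia) (conj mb Ib)).
have := integrableCD (integrableCD I1 I2) Ib.
by congr integrableC; apply/funext => x; ring.
Qed.

Lemma l2ip_integrable f g : inL2 f -> inL2 g ->
  integrableC (fun x => re (f x) * re (g x) + im (f x) * im (g x)).
Proof.
move=> /inL2P[_ [rf mf]] /inL2P[_ [rg mg]].
by apply: integrableCD; exact: sq_integrableM.
Qed.

Lemma inL2_lin (c : R) f g : inL2 f -> inL2 g -> inL2 (c *: f + g : VF).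
Proof.
move=> /inL2P[pf [rf mf]] /inL2P[pg [rg mg]]; apply/inL2P; split.
  by move=> x; rewrite /GRing.scale/= /GRing.add/= pf pg.
split.
  have := sq_integrable_lin c rf rg.
  by congr sq_integrable; apply/funext => x; rewrite ReD ReZ.
have := sq_integrable_lin c mf mg.
by congr sq_integrable; apply/funext => x; rewrite ImD ImZ.
Qed.

Lemma inL2_0 : inL2 (0 : VF).
Proof.
have s0 : sq_integrable (fun=> 0).
  split; first exact: measurable_cst.
  by under eq_fun do rewrite expr0n /=; exact: (integrable0 leb circle).
by apply/inL2P; split => //; split.
Qed.

Lemma l2_semi_inner : semi_inner_on (inL2 : VF -> Prop) l2ip.
Proof.
split; [exact: inL2_0 | exact: inL2_lin | | |].
- by move=> f g _ _; congr intC; apply/funext => x; ring.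
- move=> c f g h Hf Hg Hh.
  rewrite /l2ip -intCZ; last exact: l2ip_integrable.
  rewrite -intCD; [|by apply: integrableCZ; exact: l2ip_integrable|exact: l2ip_integrable].
  by congr intC; apply/funext => x; rewrite ReD ImD ReZ ImZ; ring.
- move=> f Hf; apply: Rintegral_ge0 => x _.
  by rewrite -!expr2 addr_ge0 ?sqr_ge0.
Qed.

Lemma l2_seminorm : seminorm_on (inL2 : VF -> Prop) (@normL2 R).
Proof.
have -> : @normL2 R = fun f : VF => Num.sqrt (l2ip f f) by apply/funext => f; exact: normL2E.
exact: semi_inner_seminorm l2_semi_inner.
Qed.

Lemma l2_CS f g : inL2 f -> inL2 g -> `|l2ip f g| <= normL2 f * normL2 g.
Proof. by move=> Hf Hg; rewrite !normL2E; exact: si_CS_sqrt l2_semi_inner _ _ _ _. Qed.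

Lemma intC_ae0 (a : R -> R) : measurable_fun circle a -> (forall x, 0 <= a x) ->
  integrableC a -> intC a = 0 -> ae_eq leb circle a (fun=> 0).
Proof.
move=> ma a0 Ia Ia0.
have mea : measurable_fun circle (EFin \o a) by exact/measurable_EFinP.
have E0 : (\int[leb]_(x in circle) `|(EFin \o a) x| = 0)%E.
  transitivity (\int[leb]_(x in circle) (a x)%:E)%E.
    by apply: eq_integral => x _ /=; rewrite ger0_norm.
  rewrite -[LHS]fineK; first by congr EFin.
  by apply: integrable_fin_num => //; exact: mcircle.
have [N [mN N0 sN]] := (ae_eq_integral_abs leb mcircle mea).1 E0.
exists N; split=> // x /= H; apply: sN => /= H1.
by apply: H => /H1 /= [].
Qed.

Lemma eqT_refl f : eqT f f.
Proof. exact: ae_eq_refl. Qed.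
Lemma eqT_sym f g : eqT f g -> eqT g f.
Proof. exact: ae_eq_sym. Qed.
Lemma eqT_trans f g h : eqT f g -> eqT g h -> eqT f h.
Proof. exact: ae_eq_trans. Qed.

Lemma eqTP f g : inL2 f -> inL2 g -> eqT f g <-> normL2 (f \- g) = 0.
Proof.
move=> Hf Hg; have Hd := sn_PB l2_seminorm Hf Hg.
pose a x := re (f x - g x) ^+ 2 + im (f x - g x) ^+ 2.
have aE : normL2 (f \- g) = Num.sqrt (intC a).
  by rewrite normL2E; congr Num.sqrt; congr intC; apply/funext => x; rewrite /a !expr2.
have a0 x : 0 <= a x by rewrite addr_ge0 ?sqr_ge0.
have ma : measurable_fun circle a.
  have /inL2P[_ [[mr _] [mi _]]] := Hd.
  by apply: measurable_funD; apply: measurable_funTS; exact: measurable_funX.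
have Ia : integrableC a.
  by have := l2ip_integrable Hd Hd; congr integrableC; apply/funext => x; rewrite /a !expr2.
rewrite aE; split=> [fg|n0].
  suff -> : intC a = 0 by rewrite sqrtr0.
  rewrite /intC /Rintegral (@ae_eq_integral _ _ _ _ _ (cst 0%E)) ?integral0//.
  - exact: mcircle.
  - exact/measurable_EFinP.
  - case: fg => N [mN N0 sN]; exists N; split=> // x /= H; apply: sN => /= H1.
    by apply: H => /H1; rewrite /a => ->; rewrite subrr /= expr0n addr0.
have [N [mN N0 sN]] : ae_eq leb circle a (fun=> 0).
  apply: intC_ae0 => //; apply/eqP; rewrite eq_le.
  by rewrite -sqrtr_eq0 n0 eqxx/=; apply: Rintegral_ge0 => x _.
exists N; split=> // x /= H; apply: sN => /= H1; apply: H => /H1 /eqP.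
rewrite /a paddr_eq0 ?sqr_ge0// !sqrf_eq0 => /andP[/eqP h1 /eqP h2].
by apply/eqP; rewrite -subr_eq0; apply/eqP; exact: complex_eq.
Qed.

Lemma normL2_eqT f g : inL2 f -> inL2 g -> eqT f g -> normL2 f = normL2 g.
Proof. by move=> Hf Hg /eqTP => /(_ Hf Hg); exact: (sn_ext l2_seminorm). Qed.

Lemma l2ip_eqT f f' g : inL2 f -> inL2 f' -> inL2 g -> eqT f f' -> l2ip f g = l2ip f' g.
Proof.
move=> Hf Hf' Hg /eqTP => /(_ Hf Hf') fg.
have H1 := l2_CS (sn_PB l2_seminorm Hf Hf') Hg.
rewrite fg mul0r normr_le0 in H1.
have E : f = 1 *: (f - f') + f' by rewrite scale1r subrK.
rewrite {1}E (si_lin l2_semi_inner)//; last exact: (sn_PB l2_seminorm).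
by rewrite (eqP H1) mulr0 add0r.
Qed.

Definition mulI f : VF := ('i%C \*o f : R -> R[i]).

Lemma re_mulI f x : re (mulI f x) = - im (f x).
Proof. by rewrite /mulI /=; case: (f x) => a b /=; rewrite mul0r mul1r sub0r. Qed.
Lemma im_mulI f x : im (mulI f x) = re (f x).
Proof. by rewrite /mulI /=; case: (f x) => a b /=; rewrite mul0r mul1r add0r. Qed.
Lemma mulI_lin (c : R) f g : mulI (c *: f + g) = c *: mulI f + mulI g.
Proof.
apply/funext => x; apply: complex_eq.
  by rewrite ReD ReZ !re_mulI ImD ImZ; ring.
by rewrite ImD ImZ !im_mulI ReD ReZ.
Qed.
Lemma mulI_inL2 f : inL2 f -> inL2 (mulI f).
Proof.
move=> /inL2P[pf [rf mf]]; apply/inL2P; split; first by move=> x; rewrite /mulI /= pf.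
split; last by move: rf; congr sq_integrable; apply/funext => x; rewrite im_mulI.
have := sq_integrable_lin (-1) mf (sq_integrable_lin (-1) mf mf).
congr sq_integrable; apply/funext => x; rewrite re_mulI; ring.
Qed.
Lemma mulI_norm f : normL2 (mulI f) = normL2 f.
Proof.
rewrite !normL2E; congr Num.sqrt; congr intC; apply/funext => x.
by rewrite re_mulI im_mulI; ring.
Qed.
End L2.

Section RieszFischer.
Context {R : realType}.
Local Notation leb := (@lebesgue_measure R).
Local Notation circle := (@circle R).
Local Notation re := (@complex.Re R).
Local Notation im := (@complex.Im R).
Local Notation VF := (R -> Rcomplex R).
Implicit Types f g h : VF.

Lemma sn_telescope (V : lmodType R) (P : V -> Prop) (N : V -> R) (H : seminorm_on P N)
    (x : nat -> V) (C : R) : (forall n, P (x n)) ->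
  (forall n, N (x n.+1 - x n) <= C * 2 ^- n) ->
  forall n m, N (x (n + m)%N - x n) <= 2 * C * 2 ^- n * (1 - 2 ^- m).
Proof.
move=> Px Hx n; elim=> [|m IH].
  by rewrite addn0 subrr (sn_0 H) expr0 invr1 subrr mulr0.
rewrite addnS; apply: (le_trans (sn_tri H (Px _) (Px (n + m)%N) (Px n))).
apply: (le_trans (lerD (Hx _) IH)).
rewrite exprD exprS !invfM le_eqVlt; apply/orP; left; apply/eqP.
by field; rewrite !expf_neq0.
Qed.

Lemma normc_ge_re (z : R[i]) : `|re z| <= normc z.
Proof.
case: z => a b /=; rewrite -[leLHS]sqrtr_sqr ler_sqrt ?addr_ge0 ?sqr_ge0//.
by rewrite lerDl sqr_ge0.
Qed.
Lemma normc_ge_im (z : R[i]) : `|im z| <= normc z.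
Proof.
case: z => a b /=; rewrite -[leLHS]sqrtr_sqr ler_sqrt ?addr_ge0 ?sqr_ge0//.
by rewrite lerDr sqr_ge0.
Qed.
Lemma normc_nonneg (z : R[i]) : 0 <= normc z.
Proof. by case: z => a b; exact: sqrtr_ge0. Qed.

Lemma cvg_of_summable_steps (a d : nat -> R) : (forall k, `|a k.+1 - a k| <= d k) ->
  cvgn (series d) -> cvgn a.
Proof.
move=> ad cd.
have : cvgn (series (fun k => a k.+1 - a k : R^o)).
  apply: normed_cvg; apply: series_le_cvg cd => [n|n|n] /=.
  - exact: normr_ge0.
  - by apply: le_trans (ad n).
  - exact: ad.
move=> /cvg_ex[l Hl]; apply/cvg_ex; exists (l + a 0%N).
rewrite [X in X @ _](_ : a = fun n => series (fun k => a k.+1 - a k) n + a 0%N).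
  by apply: cvgD; [exact: Hl | exact: cvg_cst].
by apply/funext => n; rewrite /series /= telescope_sumr// subrK.
Qed.

Lemma normc_measurable f : inL2 f -> measurable_fun [set: R] (fun x => normc (f x)).
Proof.
move=> /inL2P[_ [[mr _] [mi _]]].
rewrite (_ : (fun _ => _) = fun x => Num.sqrt (re (f x) ^+ 2 + im (f x) ^+ 2)).
  apply: (measurableT_comp (f := @Num.sqrt R)); first exact: continuous_measurable_fun (@sqrt_continuous R).
  by apply: measurable_funD; exact: measurable_funX.
by apply/funext => x; case: (f x).
Qed.

(** The steps are summable in L^2, hence in L^1 because the circle has finite
    measure, hence almost everywhere. *)
Lemma ae_summable (f : nat -> VF) (C : R) : (forall n, inL2 (f n)) ->
  (forall n, normL2 (f n.+1 - f n) <= C * 2 ^- n) ->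
  \forall x \ae leb, circle x -> cvgn (series (fun n => normc ((f n.+1 - f n) x))).
Proof.
move=> Hf Hn.
pose d n x : R := normc ((f n.+1 - f n) x).
have Hd n : inL2 (f n.+1 - f n : VF) by apply: (sn_PB l2_seminorm).
have d0 n x : 0 <= d n x by exact: normc_nonneg.
have md n : measurable_fun circle (fun x => (d n x)%:E).
  by apply/measurable_EFinP; apply: measurable_funTS; exact: normc_measurable.
pose one : VF := fun=> 1%:C.
have Hone : inL2 one.
  have s1 c : sq_integrable (fun=> c : R) by apply: sq_integrable_bounded; exact: bm_cst.
  by apply/inL2P; split => //; split; [exact: (s1 1) | exact: (s1 0)].
pose dc n : VF := fun x => (d n x)%:C.
have Hdc n : inL2 (dc n).
  have [pd mr mi Id] := Hd n.
  apply/inL2P; split; first by move=> x; rewrite /dc /d pd.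
  split; first by split; [exact: normc_measurable | exact: Id].
  by have /inL2P[_ [_ s0]] := inL2_0 (R := R); exact: s0.
have Ndc n : normL2 (dc n) = normL2 (f n.+1 - f n).
  congr Num.sqrt; congr intC; apply/funext => x.
  by rewrite normc_sqr /= expr0n addr0.
have Id n : integrableC (d n).
  by have := l2ip_integrable (Hdc n) Hone; congr integrableC; apply/funext => x; rewrite /= mulr1 mulr0 addr0.
pose K : R := Num.max 0 (C * normL2 one).
have bd n : intC (d n) <= (2 * K) / (2 ^ n.+1)%:R.
  have -> : intC (d n) = l2ip (dc n) one.
    by congr intC; apply/funext => x; rewrite /= mulr1 mulr0 addr0.
  apply: (le_trans (ler_norm _)); apply: (le_trans (l2_CS (Hdc n) Hone)).
  rewrite Ndc natrX exprS.
  apply: (@le_trans _ _ (C * normL2 one * 2 ^- n)).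
    by rewrite mulrAC ler_wpM2r ?(sn_ge0 l2_seminorm Hone).
  have -> : 2 * K / (2 * 2 ^+ n) = K * 2 ^- n by field; rewrite expf_neq0.
  by rewrite ler_wpM2r ?invr_ge0 ?exprn_ge0// le_max lexx orbT.
have K0 : 0 <= K by rewrite le_max lexx.
have Sfin : (\int[leb]_(x in circle) (\sum_(0 <= n <oo) (d n x)%:E) < +oo)%E.
  rewrite integral_nneseries//; [|exact: mcircle|by move=> n x _; rewrite lee_fin].
  apply: (@le_lt_trans _ _ (\sum_(0 <= n <oo) ((2 * K) / (2 ^ n.+1)%:R)%:E)%E).
    apply: lee_nneseries => [n _ _|n _].
      by apply: integral_ge0 => x _; rewrite lee_fin.
    rewrite -[X in (X <= _)%E]fineK; first by rewrite lee_fin; exact: bd.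
    by apply: integrable_fin_num => //; [exact: mcircle | exact: Id].
  apply: le_lt_trans (epsilon_trick0 xpredT _) (ltry _).
  by rewrite mulr_ge0.
have mS : measurable_fun circle (fun x => \sum_(0 <= n <oo) (d n x)%:E)%E.
  by apply: ge0_emeasurable_sum => // n x _ _; rewrite lee_fin.
have IS : leb.-integrable circle (fun x => \sum_(0 <= n <oo) (d n x)%:E)%E.
  apply/integrableP; split=> //; apply: le_lt_trans Sfin.
  apply: ge0_le_integral => //; first exact: mcircle.
  - by apply: measurableT_comp.
  - by move=> x _; rewrite gee0_abs//; apply: nneseries_ge0 => n _ _; rewrite lee_fin.
have := integrable_ae mcircle IS.
apply: (@filterS _ _ (ae_filter_ringOfSetsType leb)) => x H cx.
apply: nnseries_is_cvg => // [i|]; first exact: d0.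
by have := H cx; rewrite ge0_fin_numE//; apply: nneseries_ge0 => n _ _; rewrite lee_fin.
Qed.

(** The limit is defined everywhere by upper limits, so that it is periodic and
    measurable without any choice on the null set where the sequence diverges. *)
Theorem riesz_fischer : rapidly_complete (inL2 : VF -> Prop) (@normL2 R).
Proof.
move=> f C Hf Hn.
pose g : VF := fun x => fine (limn_esup (fun n => (re (f n x))%:E)) +i*
                        fine (limn_esup (fun n => (im (f n x))%:E)).
have pg : periodic g period.
  move=> x; rewrite /g; congr (fine (limn_esup _) +i* fine (limn_esup _));
  by apply/funext => n; have [-> _ _ _] := Hf n.
have mre : measurable_fun [set: R] (fun x => re (g x)).
  rewrite /g /=; apply: (measurableT_comp (f := @fine R)); first by [].
  apply: measurable_fun_limn_esup => n; apply/measurable_EFinP; by have [] := Hf n.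
have mim : measurable_fun [set: R] (fun x => im (g x)).
  rewrite /g /=; apply: (measurableT_comp (f := @fine R)); first by [].
  apply: measurable_fun_limn_esup => n; apply/measurable_EFinP; by have [] := Hf n.
have gE : \forall x \ae leb, circle x ->
    (fun n => re (f n x)) @ \oo --> re (g x) /\ (fun n => im (f n x)) @ \oo --> im (g x).
  have := ae_summable Hf Hn.
  apply: (@filterS _ _ (ae_filter_ringOfSetsType leb)) => x H cx; have {}H := H cx.
  have Hc (a : nat -> R) : (forall k, `|a k.+1 - a k| <= normc ((f k.+1 - f k) x)) ->
      a @ \oo --> fine (limn_esup (fun n => (a n)%:E)).
    move=> /cvg_of_summable_steps /(_ H) ca.
    have /cvg_limn_einf_sup[_ ->] : (fun n => (a n)%:E) @ \oo --> (limn a)%:E.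
      by apply: cvg_EFin => //; near=> n.
    exact: ca.
  split; apply: Hc => k.
    by rewrite -ReN -ReD; exact: normc_ge_re.
  by rewrite -ImN -ImD; exact: normc_ge_im.
(* The bound for the limit comes from Fatou applied to m |-> |f n - f (n + m)|^2. *)
have fat n : (\int[leb]_(x in circle) (normc (f n x - g x) ^+ 2)%:E <= ((2 * C * 2 ^- n) ^+ 2)%:E)%E.
  pose q m x : R := normc (f n x - f (n + m)%N x) ^+ 2.
  have Hd m : inL2 (f n - f (n + m)%N : VF) by apply: (sn_PB l2_seminorm).
  have mq m : measurable_fun circle (fun x => (q m x)%:E).
    apply/measurable_EFinP; apply: measurable_funTS; apply: measurable_funX.
    exact: normc_measurable (Hd m).
  have mg : measurable_fun circle (fun x => (normc (f n x - g x) ^+ 2)%:E).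
    apply/measurable_EFinP; apply: measurable_funTS.
    have [_ m1 m2 _] := Hf n.
    rewrite (_ : (fun _ => _) = fun x => (re (f n x) - re (g x)) ^+ 2 + (im (f n x) - im (g x)) ^+ 2).
      by apply: measurable_funD; apply: measurable_funX; exact: measurable_funB.
    by apply/funext => x; rewrite normc_sqr ReD ImD ReN ImN.
  have -> : (\int[leb]_(x in circle) (normc (f n x - g x) ^+ 2)%:E =
             \int[leb]_(x in circle) limn_einf (fun m => (q m x)%:E))%E.
    apply: ae_eq_integral => //; first exact: mcircle.
      apply: (measurableT_comp (f := @oppe R)) => //.
      apply: measurable_fun_limn_esup => m.
      by apply: (measurableT_comp (f := @oppe R)) (mq m).
    move: gE; apply: (@filterS _ _ (ae_filter_ringOfSetsType leb)) => x H cx.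
    have [c1 c2] := H cx; apply/esym.
    have Hq : (fun m => q m x) @ \oo --> normc (f n x - g x) ^+ 2.
      rewrite normc_sqr ReD ImD ReN ImN.
      rewrite (_ : (fun _ => _) = fun m => (re (f n x) - re (f (n + m)%N x)) ^+ 2 + (im (f n x) - im (f (n + m)%N x)) ^+ 2); last first.
        by apply/funext => m; rewrite /q /= normc_sqr ReD ImD ReN ImN.
      have shift (a : nat -> R) (l : R) : a @ \oo --> l -> (fun m => a (n + m)%N) @ \oo --> l.
        by rewrite -(cvg_shiftn n); under [X in X @ _ --> _ -> _]eq_fun do rewrite addnC.
      have s1 := shift _ _ c1; have s2 := shift _ _ c2.
      by rewrite !expr2; apply: cvgD; apply: cvgM; apply: cvgB => //; exact: cvg_cst.
    have : (fun m => (q m x)%:E) @ \oo --> (normc (f n x - g x) ^+ 2)%:E.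
      by apply: cvg_EFin; [near=> m | exact: Hq].
    by move=> /cvg_limn_einf_sup[-> _].
  apply: (le_trans (fatou leb mcircle mq _)); first by move=> m x _; rewrite lee_fin sqr_ge0.
  rewrite limn_einf_lim; apply: lime_le.
    exact: is_cvg_einfs.
  near=> m; apply: ge_ereal_inf; exists (\int[leb]_(x in circle) (q m x)%:E)%E.
    by exists m => //=.
  rewrite -[X in (X <= _)%E]fineK; last first.
    apply: integrable_fin_num => //; first exact: mcircle.
    by case: (Hd m).
  rewrite lee_fin.
  have N0 : 0 <= 2 * C * 2 ^- n.
    have := le_trans (sn_ge0 l2_seminorm (sn_PB l2_seminorm (Hf n.+1) (Hf n))) (Hn n).
    by rewrite -mulrA => h; rewrite mulr_ge0.
  have Nq : normL2 (f n - f (n + m)%N : VF) <= 2 * C * 2 ^- n.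
    rewrite (sn_sym l2_seminorm)//; apply: (le_trans (sn_telescope l2_seminorm Hf Hn n m)).
    by rewrite ler_piMr// lerBlDr lerDl invr_ge0 exprn_ge0.
  have : normL2 (f n - f (n + m)%N : VF) ^+ 2 <= (2 * C * 2 ^- n) ^+ 2.
    by rewrite lerXn2r// nnegrE (sn_ge0 l2_seminorm (Hd m)).
  by rewrite sqr_sqrtr//; apply: Rintegral_ge0 => x _; rewrite sqr_ge0.
have Hfg n : inL2 (f n - g : VF).
  have [pf m1 m2 _] := Hf n; split.
  - move=> x; change (f n (x + period) - g (x + period) = f n x - g x).
    by rewrite pf pg.
  - rewrite (_ : (fun _ => _) = fun x => re (f n x) - re (g x)); first exact: measurable_funB.
    by apply/funext => x; rewrite ReD ReN.
  - rewrite (_ : (fun _ => _) = fun x => im (f n x) - im (g x)); first exact: measurable_funB.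
    by apply/funext => x; rewrite ImD ImN.
  apply/integrableP; split.
    apply/measurable_EFinP; apply: measurable_funTS.
    rewrite (_ : (fun _ => _) = fun x => (re (f n x) - re (g x)) ^+ 2 + (im (f n x) - im (g x)) ^+ 2).
      by apply: measurable_funD; apply: measurable_funX; exact: measurable_funB.
    by apply/funext => x; rewrite normc_sqr ReD ImD ReN ImN.
  apply: (@le_lt_trans _ _ (\int[leb]_(x in circle) (normc (f n x - g x) ^+ 2)%:E)%E).
    rewrite le_eqVlt; apply/orP; left; apply/eqP; apply: eq_integral => x _.
    by rewrite gee0_abs// lee_fin sqr_ge0.
  exact: le_lt_trans (fat n) (ltry _).
exists g; split.
  have -> : g = f 0%N - (f 0%N - g) by zmod.
  exact: (sn_PB l2_seminorm).
move=> n.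
have N0 : 0 <= 2 * C * 2 ^- n.
  have := le_trans (sn_ge0 l2_seminorm (sn_PB l2_seminorm (Hf n.+1) (Hf n))) (Hn n).
  by rewrite -mulrA => h; rewrite mulr_ge0.
rewrite -[leRHS]ger0_norm// -sqrtr_sqr ler_sqrt ?sqr_ge0// -lee_fin.
rewrite /Rintegral fineK; first exact: fat.
by apply: integrable_fin_num => //; [exact: mcircle | case: (Hfg n)].
Unshelve. all: by end_near. Qed.
End RieszFischer.

(** * Weak derivatives and the spaces H^k *)
Section WeakDerivatives.
Context {R : realType}.
Local Notation leb := (@lebesgue_measure R).
Local Notation circle := (@circle R).
Local Notation re := (@complex.Re R).
Local Notation im := (@complex.Im R).
Local Notation VF := (R -> Rcomplex R).
Implicit Types (f g h : VF) (phi : R -> R).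

Definition toC phi : VF := fun x => (phi x)%:C.

Lemma testT_derive1 phi : testT phi -> testT (derive1 phi).
Proof.
move=> [pphi dphi]; split.
  move=> x; rewrite /derive1.
  rewrite (_ : (fun e : R => e^-1 *: _) = fun e : R => e^-1 *: (phi (e + x) - phi x))//.
  by apply/funext => e; rewrite addrA !pphi.
by move=> n x; have := dphi n.+1 x; rewrite /derive1n iterSr.
Qed.

Lemma testT_derive1n j phi : testT phi -> testT (derive1n j phi).
Proof.
by move=> tphi; elim: j => [//|j IH]; rewrite derive1nS; exact: testT_derive1.
Qed.

Lemma testT_continuous phi : testT phi -> continuous phi.
Proof.
by move=> [_ /(_ 0%N) d] x; exact/differentiable_continuous/derivable1_diffP/d.
Qed.

Lemma testT_inL2 phi : testT phi -> inL2 (toC phi).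
Proof.
move=> tphi; have [pphi _] := tphi; have cphi := testT_continuous tphi.
have mphi : measurable_fun [set: R] phi by exact: continuous_measurable_fun.
apply/inL2P; split; first by move=> x; rewrite /toC pphi.
split; last by have /inL2P[_ [_ s0]] := inL2_0 (R := R); exact: s0.
split=> //; apply: continuous_compact_integrable; first exact: segment_compact.
apply: continuous_subspaceT => x.
rewrite (_ : (fun _ => _) = fun x => phi x * phi x); last by apply/funext => y; rewrite expr2.
by apply: cvgM; exact: cphi.
Qed.

Lemma l2ip_toC f phi : l2ip f (toC phi) = intC (fun x => re (f x) * phi x).
Proof. by congr intC; apply/funext => x /=; rewrite mulr0 addr0. Qed.
Lemma l2ip_mulI_toC f phi : l2ip f (mulI (toC phi)) = intC (fun x => im (f x) * phi x).
Proof.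
by congr intC; apply/funext => x; rewrite re_mulI im_mulI /= oppr0 mulr0 add0r.
Qed.

Lemma intT_toC f phi :
  intT (fun x => f x * (phi x)%:C) = l2ip f (toC phi) +i* l2ip f (mulI (toC phi)).
Proof.
rewrite l2ip_toC l2ip_mulI_toC; congr (intC _ +i* intC _); apply/funext => x;
by case: (f x) => a b /=; rewrite mulr0 ?subr0 ?add0r.
Qed.

(** The defining identity of weak derivatives, split into real and imaginary parts
    so that it is expressed by the real inner product of L^2. *)
Definition wderiv_ip j f g : Prop := forall phi, testT phi ->
  l2ip f (toC (derive1n j phi)) = (-1) ^+ j * l2ip g (toC phi) /\
  l2ip f (mulI (toC (derive1n j phi))) = (-1) ^+ j * l2ip g (mulI (toC phi)).

Lemma signC j (z : R[i]) : (-1) ^+ j * z = ((-1) ^+ j * re z) +i* ((-1) ^+ j * im z).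
Proof.
have -> : (-1) ^+ j = ((-1) ^+ j)%:C :> R[i] by rewrite rmorphXn rmorphN1.
by case: z => a b; apply: complex_eq => /=; rewrite mul0r ?subr0 ?addr0.
Qed.

Lemma is_wderivP j f g : is_wderiv j f g <-> wderiv_ip j f g.
Proof.
split=> H phi tphi; have := H phi tphi.
  by rewrite (intT_toC f (derive1n j phi)) (intT_toC g phi) signC /= => -[].
by move=> [h1 h2]; rewrite (intT_toC f (derive1n j phi)) (intT_toC g phi) signC h1 h2.
Qed.

Lemma is_derive_trig (a b k x : R) :
  is_derive x 1 (fun x => a * cos (k * x) + b * sin (k * x))
    (b * k * cos (k * x) + (- (a * k)) * sin (k * x)).
Proof.
by apply: is_derive_eq; rewrite /GRing.scale /=; ring.
Qed.

Lemma derive1_trig (a b k : R) :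
  derive1 (fun x => a * cos (k * x) + b * sin (k * x)) =
  (fun x => b * k * cos (k * x) + (- (a * k)) * sin (k * x)).
Proof.
by apply/funext => x; rewrite derive1E; have [_ ->] := is_derive_trig a b k x.
Qed.

(** Combinations of [cos (n x)] and [sin (n x)] are closed under differentiation,
    which gives all derivatives at once. *)
Lemma testT_trig (a b : R) (n : nat) :
  testT (fun x => a * cos (n%:R * x) + b * sin (n%:R * x)).
Proof.
split.
  move=> x; rewrite mulrDr /period (mulr_natl (pi *+ 2)).
  by rewrite (periodicn (@cosD2pi R)) (periodicn (@sinD2pi R)).
move=> j; elim: j a b => [|j IH] a b x; first by have [] := is_derive_trig a b n%:R x.
by rewrite /derive1n iterSr derive1_trig; exact: IH.
Qed.

Lemma testT_cos (n : nat) : testT (fun x : R => cos (n%:R * x)).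
Proof.
by have := testT_trig 1 0 n; under eq_fun do rewrite mul1r mul0r addr0.
Qed.
Lemma testT_sin (n : nat) : testT (fun x : R => sin (n%:R * x)).
Proof.
by have := testT_trig 0 1 n; under eq_fun do rewrite mul1r mul0r add0r.
Qed.

Lemma wderiv_ip_lin j (c : R) f f' g g' : inL2 f -> inL2 f' -> inL2 g -> inL2 g' ->
  wderiv_ip j f g -> wderiv_ip j f' g' -> wderiv_ip j (c *: f + f') (c *: g + g').
Proof.
move=> Hf Hf' Hg Hg' w w' phi tphi; have [a b] := w phi tphi; have [a' b'] := w' phi tphi.
have H1 := testT_inL2 tphi; have H2 := testT_inL2 (testT_derive1n j tphi).
have H3 := mulI_inL2 H1; have H4 := mulI_inL2 H2.
by rewrite !(si_lin l2_semi_inner)// a a' b b'; split; ring.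
Qed.

Lemma wderiv_ip_eqT j f f' g g' : inL2 f -> inL2 f' -> inL2 g -> inL2 g' ->
  eqT f f' -> eqT g g' -> wderiv_ip j f g -> wderiv_ip j f' g'.
Proof.
move=> Hf Hf' Hg Hg' ff' gg' w phi tphi; have [a b] := w phi tphi.
have H1 := testT_inL2 tphi; have H2 := testT_inL2 (testT_derive1n j tphi).
have H3 := mulI_inL2 H1; have H4 := mulI_inL2 H2.
rewrite -(l2ip_eqT Hf Hf' H2 ff') -(l2ip_eqT Hf Hf' H4 ff').
by rewrite -(l2ip_eqT Hg Hg' H1 gg') -(l2ip_eqT Hg Hg' H3 gg').
Qed.

Lemma l2ip_mulI f g : l2ip (mulI f) (mulI g) = l2ip f g.
Proof. by congr intC; apply/funext => x; rewrite !re_mulI !im_mulI; ring. Qed.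

Lemma l2ip_mulI_l f phi : inL2 f -> testT phi ->
  l2ip (mulI f) (toC phi) = - l2ip f (mulI (toC phi)).
Proof.
move=> Hf tphi; rewrite -mulN1r l2ip_mulI_toC l2ip_toC -intCZ.
  by congr intC; apply/funext => x; rewrite re_mulI; ring.
have := l2ip_integrable Hf (mulI_inL2 (testT_inL2 tphi)).
by congr integrableC; apply/funext => x; rewrite re_mulI im_mulI /= oppr0 mulr0 add0r.
Qed.

Lemma wderiv_ip_mulI j f g : inL2 f -> inL2 g -> wderiv_ip j f g -> wderiv_ip j (mulI f) (mulI g).
Proof.
move=> Hf Hg w phi tphi; have [a b] := w phi tphi.
rewrite !l2ip_mulI !l2ip_mulI_l//; last exact: testT_derive1n.
by split=> //; rewrite b mulrN.
Qed.

(** [cos (n x)] and [sin (n x)] are test functions, so this is uniqueness of Fourier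
    coefficients for the real and imaginary parts. *)
Lemma eqT_of_trig f g : inL2 f -> inL2 g ->
  (forall phi, testT phi -> l2ip f (toC phi) = l2ip g (toC phi) /\
     l2ip f (mulI (toC phi)) = l2ip g (mulI (toC phi))) -> eqT f g.
Proof.
move=> Hf Hg H.
have Hd : inL2 (f - g : VF) by exact: (sn_PB l2_seminorm).
have Hz phi : testT phi -> l2ip (f - g) (toC phi) = 0 /\ l2ip (f - g) (mulI (toC phi)) = 0.
  move=> tphi; have H1 := testT_inL2 tphi; have H2 := mulI_inL2 H1.
  have -> : f - g = -1 *: g + f by rewrite scaleN1r addrC.
  have [a b] := H phi tphi.
  by rewrite !(si_lin l2_semi_inner)// a b mulN1r addNr; split; rewrite ?mulN1r ?addNr.
have /inL2P[_ [/sq_integrableW Ir /sq_integrableW Ii]] := Hd.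
have er := trig_uniqueness Ir _ _.
have ei := trig_uniqueness Ii _ _.
have {}er := er (fun n => etrans (esym (l2ip_toC _ _)) (Hz _ (testT_cos n)).1)
  (fun n => etrans (esym (l2ip_toC _ _)) (Hz _ (testT_sin n)).1).
have {}ei := ei (fun n => etrans (esym (l2ip_mulI_toC _ _)) (Hz _ (testT_cos n)).2)
  (fun n => etrans (esym (l2ip_mulI_toC _ _)) (Hz _ (testT_sin n)).2).
move: er ei; apply: (@filterS2 _ _ (ae_filter_ringOfSetsType leb)) => x hr hi cx.
have {hr} := hr cx; have {hi} := hi cx => /= h2 h1.
by apply/eqP; rewrite -subr_eq0; apply/eqP; exact: complex_eq.
Qed.

Lemma wderiv_ip_unique j f g g' : inL2 g -> inL2 g' -> wderiv_ip j f g -> wderiv_ip j f g' -> eqT g g'.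
Proof.
move=> Hg Hg' w w'; apply: eqT_of_trig => // phi tphi.
have [a b] := w phi tphi; have [a' b'] := w' phi tphi.
have s0 : (-1) ^+ j != 0 :> R by rewrite signr_eq0.
by split; apply: (mulfI s0); rewrite -?a -?b -?a' -?b'.
Qed.

Lemma inHP k f : inH k f <-> inL2 f /\ forall j, (j <= k)%N -> exists g, inL2 g /\ wderiv_ip j f g.
Proof.
by split=> -[Hf H]; split=> // j jk; have [g [Hg w]] := H j jk; exists g; split => //; apply/is_wderivP.
Qed.

Lemma wderivP k f j : inH k f -> (j <= k)%N -> inL2 (wderiv j f) /\ wderiv_ip j f (wderiv j f).
Proof.
move=> [_ H] jk; have [g Hg] := H j jk.
have [Hw /is_wderivP w] : [set g | inL2 g /\ is_wderiv j f g] (wderiv j f).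
  by apply: xgetPex; exists g.
by split.
Qed.

Lemma wderiv_eqT k f j g : inH k f -> (j <= k)%N -> inL2 g -> wderiv_ip j f g -> eqT (wderiv j f) g.
Proof. by move=> Hf jk Hg w; have [Hw w'] := wderivP Hf jk; exact: wderiv_ip_unique w' w. Qed.

Lemma inH_L2 k f : inH k f -> inL2 f.
Proof. by case. Qed.

Lemma inH_lin k (c : R) f g : inH k f -> inH k g -> inH k (c *: f + g : VF).
Proof.
move=> Hf Hg; apply/inHP; split; first by apply: inL2_lin; [exact: inH_L2 Hf | exact: inH_L2 Hg].
move=> j jk; have [a b] := wderivP Hf jk; have [a' b'] := wderivP Hg jk.
exists (c *: (wderiv j f : VF) + wderiv j g); split; first exact: inL2_lin.
by apply: wderiv_ip_lin => //; [exact: inH_L2 Hf | exact: inH_L2 Hg].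
Qed.

Lemma wderiv_lin k (c : R) f g j : inH k f -> inH k g -> (j <= k)%N ->
  eqT (wderiv j (c *: f + g : VF)) (c *: (wderiv j f : VF) + wderiv j g : VF).
Proof.
move=> Hf Hg jk; have [a b] := wderivP Hf jk; have [a' b'] := wderivP Hg jk.
apply: wderiv_eqT (inH_lin c Hf Hg) jk (inL2_lin c a a') _.
by apply: wderiv_ip_lin => //; [exact: inH_L2 Hf | exact: inH_L2 Hg].
Qed.

Lemma wderiv_mulI k f j : inH k f -> (j <= k)%N -> inH k (mulI f) ->
  eqT (wderiv j (mulI f)) (mulI (wderiv j f)).
Proof.
move=> Hf jk Hi; have [a b] := wderivP Hf jk.
by apply: wderiv_eqT Hi jk (mulI_inL2 a) _; apply: wderiv_ip_mulI => //; exact: inH_L2 Hf.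
Qed.

Lemma mulI_inH k f : inH k f -> inH k (mulI f).
Proof.
move=> Hf; apply/inHP; split; first by apply: mulI_inL2; exact: inH_L2 Hf.
move=> j jk; have [a b] := wderivP Hf jk.
exists (mulI (wderiv j f)); split; first exact: mulI_inL2.
by apply: wderiv_ip_mulI => //; exact: inH_L2 Hf.
Qed.

Lemma normH_eqT k f g : (forall j, (j <= k)%N -> normL2 (wderiv j f) = normL2 (wderiv j g)) ->
  normH k f = normH k g.
Proof.
move=> H; rewrite /normH; apply: (congr1 Num.sqrt); apply: eq_bigr => j _.
have jk : (j <= k)%N by rewrite -ltnS.
exact: (congr1 (fun t => t ^+ 2) (H j jk)).
Qed.

Lemma mulI_normH k f : inH k f -> normH k (mulI f) = normH k f.
Proof.
move=> Hf; apply: normH_eqT => j jk; have Hi := mulI_inH Hf.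
have [a _] := wderivP Hf jk; have [b _] := wderivP Hi jk.
by rewrite (normL2_eqT b (mulI_inL2 a) (wderiv_mulI Hf jk Hi)) mulI_norm.
Qed.

Definition hk_ip k f g : R := \sum_(j < k.+1) l2ip (wderiv j f) (wderiv j g).

Lemma inH0 k : inH k (0 : VF).
Proof.
apply/inHP; split; first exact: inL2_0.
move=> j _; exists 0; split; first exact: inL2_0.
move=> phi tphi.
have H1 := testT_inL2 tphi; have H2 := testT_inL2 (testT_derive1n j tphi).
have z h : inL2 h -> l2ip 0 h = 0.
  move=> Hh; have := si_lin l2_semi_inner (-1) inL2_0 inL2_0 Hh.
  by rewrite scaler0 addr0 mulN1r addNr.
by rewrite !z ?mulr0//; exact: mulI_inL2.
Qed.

Lemma normHE k f : normH k f = Num.sqrt (hk_ip k f f).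
Proof.
rewrite /normH /hk_ip; apply: (congr1 Num.sqrt); apply: eq_bigr => j _.
rewrite normL2E sqr_sqrtr//.
by apply: Rintegral_ge0 => x _; rewrite -!expr2 addr_ge0 ?sqr_ge0.
Qed.

Lemma hk_semi_inner k : semi_inner_on (inH k : VF -> Prop) (hk_ip k).
Proof.
split; [exact: inH0 | exact: inH_lin | | |].
- move=> f g Hf Hg; apply: eq_bigr => j _; have jk : (j <= k)%N by rewrite -ltnS.
  by apply: (si_sym l2_semi_inner); [case: (wderivP Hf jk) | case: (wderivP Hg jk)].
- move=> c f g h Hf Hg Hh; rewrite /hk_ip big_distrr -big_split; apply: eq_bigr => j _ /=.
  have jk : (j <= k)%N by rewrite -ltnS.
  have [a _] := wderivP Hf jk; have [b _] := wderivP Hg jk; have [d _] := wderivP Hh jk.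
  have [e _] := wderivP (inH_lin c Hf Hg) jk.
  rewrite (l2ip_eqT e (inL2_lin c a b) d (wderiv_lin c Hf Hg jk)).
  by rewrite (si_lin l2_semi_inner).
- move=> f Hf; apply: sumr_ge0 => j _; have jk : (j <= k)%N by rewrite -ltnS.
  by apply: (si_ge0 l2_semi_inner); case: (wderivP Hf jk).
Qed.

Lemma hk_seminorm k : seminorm_on (inH k : VF -> Prop) (@normH R k).
Proof.
have -> : @normH R k = fun f : VF => Num.sqrt (hk_ip k f f) by apply/funext => f; exact: normHE.
exact: semi_inner_seminorm (hk_semi_inner k).
Qed.

Lemma wderiv_normL2_le k f j : (j <= k)%N -> normL2 (wderiv j f) <= normH k f.
Proof.
move=> jk; have n0 : 0 <= normL2 (wderiv j f) by exact: sqrtr_ge0.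
rewrite -[leLHS]ger0_norm// -sqrtr_sqr ler_sqrt; last by apply: sumr_ge0 => i _; rewrite sqr_ge0.
rewrite -ltnS in jk; rewrite (bigD1 (Ordinal jk))//= lerDl.
by apply: sumr_ge0 => i _; rewrite sqr_ge0.
Qed.

Lemma wderiv0 k f : inH k f -> eqT (wderiv 0 f) f.
Proof.
move=> Hf; apply: wderiv_eqT Hf (leq0n k) (inH_L2 Hf) _ => phi tphi.
by rewrite expr0 !mul1r.
Qed.

Lemma normL2_le_normH k f : inH k f -> normL2 f <= normH k f.
Proof.
move=> Hf; have [a _] := wderivP Hf (leq0n k).
by rewrite -(normL2_eqT a (inH_L2 Hf) (wderiv0 Hf)) wderiv_normL2_le.
Qed.

Lemma normH_le k f (A : R) : 0 <= A ->
  (forall j, (j <= k)%N -> normL2 (wderiv j f) <= A) -> normH k f <= k.+1%:R * A.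
Proof.
move=> A0 H; have kA : 0 <= k.+1%:R * A by rewrite mulr_ge0.
rewrite -[leRHS]ger0_norm// -sqrtr_sqr ler_sqrt ?sqr_ge0//.
apply: (@le_trans _ _ (\sum_(j < k.+1) A ^+ 2)).
  apply: ler_sum => j _; rewrite lerXn2r ?nnegrE ?sqrtr_ge0//.
  by apply: H; rewrite -ltnS.
rewrite sumr_const card_ord -[A ^+ 2 *+ _]mulr_natl exprMn.
apply: ler_wpM2r; first exact: sqr_ge0.
by rewrite -[leLHS]expr1 ler_weXn2l// ler1n.
Qed.
End WeakDerivatives.

Section HkComplete.
Context {R : realType}.
Local Notation VF := (R -> Rcomplex R).
Implicit Types (f g h : VF) (phi : R -> R).

Lemma l2ipB f g h : inL2 f -> inL2 g -> inL2 h -> l2ip (f - g) h = l2ip f h - l2ip g h.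
Proof.
move=> Hf Hg Hh; have -> : f - g = -1 *: g + f by rewrite scaleN1r addrC.
by rewrite (si_lin l2_semi_inner)// mulN1r addrC.
Qed.

Lemma wderivB k f g j : inH k f -> inH k g -> (j <= k)%N ->
  eqT (wderiv j (f - g : VF)) ((wderiv j f : VF) - (wderiv j g : VF)).
Proof.
move=> Hf Hg jk; have := wderiv_lin (-1) Hg Hf jk.
by rewrite !scaleN1r ![- _ + _]addrC.
Qed.

Lemma normL2_wderivB k f g j : inH k f -> inH k g -> (j <= k)%N ->
  normL2 ((wderiv j f : VF) - (wderiv j g : VF)) <= normH k (f - g).
Proof.
move=> Hf Hg jk; have [a _] := wderivP Hf jk; have [b _] := wderivP Hg jk.
have [c _] := wderivP (sn_PB (hk_seminorm k) Hf Hg) jk.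
rewrite -(normL2_eqT c (sn_PB l2_seminorm a b) (wderivB Hf Hg jk)).
exact: wderiv_normL2_le.
Qed.

(** For a fixed test function both sides of the defining identity are continuous in
    L^2. *)
Lemma wderiv_ip_limit j (f f' : nat -> VF) g g' (C : R) :
  (forall n, inL2 (f n)) -> (forall n, inL2 (f' n)) -> inL2 g -> inL2 g' ->
  (forall n, normL2 (f n - g) <= C * 2 ^- n) ->
  (forall n, normL2 (f' n - g') <= C * 2 ^- n) ->
  (forall n, wderiv_ip j (f n) (f' n)) -> wderiv_ip j g g'.
Proof.
move=> Hf Hf' Hg Hg' c c' w phi tphi.
have H1 := testT_inL2 tphi; have H2 := testT_inL2 (testT_derive1n j tphi).
have key (a b : VF) : inL2 a -> inL2 b ->
    (forall n, l2ip (f n) a = (-1) ^+ j * l2ip (f' n) b) ->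
    l2ip g a = (-1) ^+ j * l2ip g' b.
  move=> Ha Hb E; apply/eqP; rewrite -subr_eq0 -normr_eq0 eq_le normr_ge0 andbT.
  apply: (@le_of_pow2 _ _ _ (C * normL2 a + C * normL2 b)) => n; rewrite add0r.
  have -> : l2ip g a - (-1) ^+ j * l2ip g' b =
      (-1) ^+ j * l2ip (f' n - g') b - l2ip (f n - g) a.
    by rewrite !l2ipB// E; ring.
  apply: (le_trans (ler_normB _ _)); rewrite normrM normrX normrN1 expr1n mul1r.
  rewrite addrC mulrDl; apply: lerD.
    apply: (le_trans (l2_CS (sn_PB l2_seminorm (Hf n) Hg) Ha)).
    by rewrite mulrAC ler_wpM2r// (sn_ge0 l2_seminorm Ha).
  apply: (le_trans (l2_CS (sn_PB l2_seminorm (Hf' n) Hg') Hb)).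
  by rewrite mulrAC ler_wpM2r// (sn_ge0 l2_seminorm Hb).
split; apply: key => //; try exact: mulI_inL2.
  by move=> n; case: (w n _ tphi).
by move=> n; case: (w n _ tphi).
Qed.

(** The weak derivatives of all orders up to [k] converge in L^2 by [riesz_fischer]
    and their limits are the weak derivatives of the limit.  Summing the rates over
    the orders loses the constant [k.+1]; the exact rate is recovered by comparing
    [f n] with [f (n + m)] for large [m]. *)
Theorem hk_complete k : rapidly_complete (inH k : VF -> Prop) (@normH R k).
Proof.
move=> f C Hf Hn.
have Hl n : inL2 (f n) := inH_L2 (Hf n).
have [g [Hg gn]] : exists g, inL2 g /\ forall n, normL2 (f n - g) <= 2 * C * 2 ^- n.
  apply: riesz_fischer => // n; apply: le_trans (Hn n).
  exact: normL2_le_normH (sn_PB (hk_seminorm k) (Hf _) (Hf _)).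
have Hj j : (j <= k)%N -> exists gj : VF, [/\ inL2 gj, wderiv_ip j g gj &
    forall n, normL2 ((wderiv j (f n) : VF) - gj) <= 2 * C * 2 ^- n].
  move=> jk; have Hw n : inL2 (wderiv j (f n)) by have [] := wderivP (Hf n) jk.
  have [gj [Hgj gjn]] : exists gj, inL2 gj /\
      forall n, normL2 ((wderiv j (f n) : VF) - gj) <= 2 * C * 2 ^- n.
    apply: (riesz_fischer (x := fun n => wderiv j (f n))) => // n; apply: le_trans (Hn n).
    exact: normL2_wderivB.
  exists gj; split=> //.
  by apply: wderiv_ip_limit Hl Hw Hg Hgj gn gjn _ => n; have [] := wderivP (Hf n) jk.
have HgH : inH k g.
  by apply/inHP; split=> // j jk; have [gj [a b _]] := Hj j jk; exists gj.
exists g; split=> // n.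
have C0 m : 0 <= 2 * C * 2 ^- m by apply: le_trans (gn m); apply: sqrtr_ge0.
have rough m : normH k (f m - g) <= k.+1%:R * (2 * C * 2 ^- m).
  apply: normH_le => // j jk; have [gj [a b c]] := Hj j jk.
  have Hd := sn_PB (hk_seminorm k) (Hf m) HgH.
  have [d _] := wderivP Hd jk; have [w1 _] := wderivP (Hf m) jk; have [w2 _] := wderivP HgH jk.
  rewrite (normL2_eqT d (sn_PB l2_seminorm w1 w2) (wderivB (Hf m) HgH jk)).
  apply: le_trans (c m); rewrite le_eqVlt; apply/orP; left; apply/eqP.
  apply: normL2_eqT; [exact: (sn_PB l2_seminorm)|exact: (sn_PB l2_seminorm)|].
  have := wderiv_eqT HgH jk a b.
  apply: (@filterS _ _ (ae_filter_ringOfSetsType (@lebesgue_measure R))) => x E cx.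
  by rewrite /= /GRing.add /= /GRing.opp /= (E cx).
apply: (@le_of_pow2 _ _ _ (k.+1%:R * (2 * C) * 2 ^- n)) => m.
have Hnm := Hf (n + m)%N.
apply: (le_trans (sn_tri (hk_seminorm k) (Hf n) Hnm HgH)); apply: lerD.
  rewrite (sn_sym (hk_seminorm k))//.
  apply: (le_trans (sn_telescope (hk_seminorm k) Hf Hn n m)).
  by rewrite ler_piMr// lerBlDr lerDl invr_ge0 exprn_ge0.
apply: (le_trans (rough _)); rewrite exprD invfM le_eqVlt; apply/orP; left; apply/eqP.
ring.
Qed.
End HkComplete.

(** * Fourier coefficients along y' = sg i dy/dx *)
Section LinearODE.
Context {R : realType}.

Lemma expR_taylor1 (x : R) : `|x| <= 2^-1 -> `|expR x - 1 - x| <= 2 * x ^+ 2.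
Proof.
rewrite ler_norml => /andP[x1 x2].
have h1 := expR_ge1Dx x; have h2 := expR_ge1Dx (- x).
have e0 := expR_gt0 x.
rewrite ger0_norm; last by lra.
have h3 : expR x * (1 - x) <= 1.
  apply: (@le_trans _ _ (expR x * expR (- x))); first by rewrite ler_pM2l.
  by rewrite -expRD subrr expR0.
have h4 : (expR x - 1 - x) * (1 - x) <= x ^+ 2 by lra.
have h5 : 0 <= (expR x - 1 - x) * (2^-1 - x) by rewrite mulr_ge0//; lra.
lra.
Qed.

Lemma norm_seminorm : seminorm_on (fun _ : R^o => True) (fun x : R^o => `|x|).
Proof. by split=> // [x y _ _|c x _]; [exact: ler_normD | exact: normrM]. Qed.

(** [gronwall_eq0] on the real line, applied to the difference between [z] and the
    exponential solution with the same initial value. *)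
Lemma linear_ode (n a K : R) (z : R -> R) : 0 <= n -> 0 <= a ->
  (forall s t, 0 <= s <= a -> 0 <= t <= a ->
     `|z t - z s - (t - s) * (n * z s)| <= K * (t - s) ^+ 2) ->
  z a = expR (n * a) * z 0.
Proof.
move=> n0 a0 Hz.
pose w t : R^o := z t - expR (n * t) * z 0.
apply/eqP; rewrite -subr_eq0 -normr_eq0; apply/eqP.
have aa : 0 <= a <= a by rewrite a0 lexx.
apply: (gronwall_eq0 norm_seminorm (w := w) (v := fun t => n * w t : R^o) n0 _ _ _ _ aa) => //.
- by rewrite /w mulr0 expR0 mul1r subrr normr0.
- by move=> t _; rewrite normrM (ger0_norm n0).
move=> s sa e e0.
have [K' [K'0 KK']] : exists K' : R, 0 <= K' /\ K <= K'.
  by exists `|K|; rewrite normr_ge0 ler_norm.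
pose c := K' + expR (n * s) * `|z 0| * (2 * n ^+ 2).
have c0 : 0 <= c by rewrite addr_ge0// !mulr_ge0// ?expR_ge0// sqr_ge0.
exists (Num.min (2^-1 / (n + 1)) (e / (c + 1))).
  by rewrite lt_min !divr_gt0// ?ltr_wpDl.
move=> t ta; rewrite lt_min => /andP[ts1 ts2].
have x0 := normr_ge0 (t - s).
have h1 : `|n * (t - s)| <= 2^-1.
  rewrite normrM (ger0_norm n0).
  apply: (@le_trans _ _ ((n + 1) * `|t - s|)); first by rewrite ler_wpM2r//; lra.
  by rewrite mulrC -ler_pdivlMr ?ltr_wpDl// ltW.
have h2 := expR_taylor1 h1; have h3 := Hz _ _ sa ta.
have -> : w t - w s - (t - s) *: (n * w s : R^o) = (z t - z s - (t - s) * (n * z s)) -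
    expR (n * s) * z 0 * (expR (n * (t - s)) - 1 - n * (t - s)).
  have -> : expR (n * (t - s)) = expR (n * t) / expR (n * s).
    by rewrite -expRN -expRD; congr expR; ring.
  by rewrite /w /GRing.scale /=; field; rewrite gt_eqF// expR_gt0.
apply: (le_trans (ler_normB _ _)).
rewrite !normrM (ger0_norm (expR_ge0 _)).
apply: (@le_trans _ _ (c * `|t - s| * `|t - s|)).
  have -> : c * `|t - s| * `|t - s| = K' * `|t - s| ^+ 2 +
      expR (n * s) * `|z 0| * (2 * (n ^+ 2 * `|t - s| ^+ 2)) by rewrite /c; ring.
  have sq : (t - s) ^+ 2 = `|t - s| ^+ 2 by rewrite real_normK ?num_real.
  apply: lerD.
    by apply: (le_trans h3); rewrite sq ler_wpM2r// sqr_ge0.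
  apply: ler_wpM2l; first by rewrite mulr_ge0// expR_ge0.
  by apply: (le_trans h2); rewrite exprMn sq.
rewrite ler_wpM2r//.
apply: (@le_trans _ _ (`|t - s| * (c + 1))); first by lra.
by rewrite -ler_pdivlMr ?ltr_wpDl// ltW.
Qed.
End LinearODE.

Section Coefficients.
Context {R : realType}.
Local Notation VF := (R -> Rcomplex R).
Variables (k : nat) (k_ge1 : (1 <= k)%N) (y g : R -> VF) (sg a K : R).
Hypotheses (a0 : 0 <= a) (sg2 : sg * sg = 1).
Hypothesis yH : forall t, 0 <= t <= a -> inH k (y t).
Hypothesis gL : forall t, 0 <= t <= a -> inL2 (g t).
Hypothesis yg : forall t, 0 <= t <= a -> eqT (wderiv 1 (y t)) (g t).
Hypothesis est : forall s t, 0 <= s <= a -> 0 <= t <= a ->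
  normL2 (y t - y s - (t - s) *: (sg *: mulI (g s))) <= K * (t - s) ^+ 2.

(** Pairing with a fixed [h] turns the equation into a scalar one, with a remainder
    that is controlled by Cauchy-Schwarz. *)
Lemma l2ip_flow (h : VF) s t : inL2 h -> 0 <= s <= a -> 0 <= t <= a ->
  `|l2ip (y t) h - l2ip (y s) h - (t - s) * (sg * l2ip (mulI (g s)) h)|
    <= K * normL2 h * (t - s) ^+ 2.
Proof.
move=> Hh sa ta.
have Lt := inH_L2 (yH ta); have Ls := inH_L2 (yH sa).
have Lg := mulI_inL2 (gL sa).
have LF := sn_PZ l2_seminorm sg Lg.
have LF' := sn_PZ l2_seminorm (t - s) LF.
have Z c (f : VF) : inL2 f -> l2ip (c *: f) h = c * l2ip f h.
  move=> Hf; have := si_lin l2_semi_inner c Hf inL2_0 Hh; rewrite addr0 => ->.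
  have := si_lin l2_semi_inner (-1) inL2_0 inL2_0 Hh.
  by rewrite scaler0 addr0 mulN1r addNr => ->; rewrite addr0.
have LD := sn_PB l2_seminorm Lt Ls.
have -> : l2ip (y t) h - l2ip (y s) h - (t - s) * (sg * l2ip (mulI (g s)) h) =
    l2ip (y t - y s - (t - s) *: (sg *: mulI (g s))) h.
  by rewrite !l2ipB// !Z.
apply: (le_trans (l2_CS (sn_PB l2_seminorm LD LF') Hh)).
by rewrite mulrAC ler_wpM2r ?est//; exact: (sn_ge0 l2_seminorm).
Qed.

(** [g] is the weak derivative of [y], so that the derivative moves to the test
    function; multiplication by [i] exchanges real and imaginary parts. *)
Lemma l2ip_g (phi : R -> R) s : testT phi -> 0 <= s <= a ->
  l2ip (mulI (g s)) (toC phi) = l2ip (y s) (mulI (toC (derive1 phi))) /\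
  l2ip (mulI (g s)) (mulI (toC phi)) = - l2ip (y s) (toC (derive1 phi)).
Proof.
move=> tphi sa; have tphi' := testT_derive1 tphi.
have H1 := testT_inL2 tphi.
have [W w] := wderivP (yH sa) k_ge1; have [w1 w2] := w _ tphi.
rewrite l2ip_mulI (l2ip_mulI_l (gL sa) tphi).
rewrite -(l2ip_eqT W (gL sa) H1 (yg sa)) -(l2ip_eqT W (gL sa) (mulI_inL2 H1) (yg sa)).
by rewrite w1 w2 expr1 !mulN1r opprK.
Qed.

Lemma l2ip_toCZ (f : VF) (c : R) phi : inL2 f -> testT phi ->
  l2ip f (toC (fun x => c * phi x)) = c * l2ip f (toC phi) /\
  l2ip f (mulI (toC (fun x => c * phi x))) = c * l2ip f (mulI (toC phi)).
Proof.
move=> Hf tphi; rewrite !l2ip_toC !l2ip_mulI_toC.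
have I1 := l2ip_integrable Hf (testT_inL2 tphi).
have I2 := l2ip_integrable Hf (mulI_inL2 (testT_inL2 tphi)).
split; rewrite -intCZ.
- by congr intC; apply/funext => x; ring.
- by move: I1; congr integrableC; apply/funext => x /=; rewrite mulr0 addr0.
- by congr intC; apply/funext => x; ring.
by move: I2; congr integrableC; apply/funext => x; rewrite re_mulI im_mulI /= oppr0 mulr0 add0r.
Qed.

Let cosn (n : nat) : R -> R := fun x => cos (n%:R * x).
Let sinn (n : nat) : R -> R := fun x => sin (n%:R * x).

Lemma derive1_cosn n : derive1 (cosn n) = fun x => - n%:R * sinn n x.
Proof.
have := derive1_trig 1 0 (n%:R : R).
under eq_fun do rewrite mul1r mul0r addr0.
by move=> ->; apply/funext => x; rewrite /sinn; ring.
Qed.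
Lemma derive1_sinn n : derive1 (sinn n) = fun x => n%:R * cosn n x.
Proof.
have := derive1_trig 0 1 (n%:R : R).
under eq_fun do rewrite mul1r mul0r add0r.
by move=> ->; apply/funext => x; rewrite /cosn; ring.
Qed.

(** Write P and Q for the integrals of the real and imaginary part of [y] against
    [cos (n x)] and P*, Q* for those against [sin (n x)].  The equation gives
    P' = - sg n Q*, Q*' = - sg n P, Q' = sg n P*, P*' = sg n Q, so that
    P - sg Q* and Q + sg P* are the combinations that grow like [exp (n t)].  They
    are the real and imaginary part of the coefficient at frequency [- sg n]. *)
Lemma flow_coef n :
  let p f := l2ip f (toC (cosn n)) - sg * l2ip f (mulI (toC (sinn n))) in
  let q f := l2ip f (mulI (toC (cosn n))) + sg * l2ip f (toC (sinn n)) in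
  p (y a) = expR (n%:R * a) * p (y 0) /\ q (y a) = expR (n%:R * a) * q (y 0).
Proof.
move=> p q.
have tc := testT_cos (R := R) n; have ts := testT_sin (R := R) n.
have Hc := testT_inL2 tc; have Hs := testT_inL2 ts.
have Hic := mulI_inL2 Hc; have His := mulI_inL2 Hs.
pose K' := K * normL2 (toC (cosn n)) + `|sg| * (K * normL2 (toC (sinn n))).
split; [apply: (linear_ode (K := K') (z := fun t => p (y t)))|
        apply: (linear_ode (K := K') (z := fun t => q (y t)))] => // s t sa ta.
- have e1 := l2ip_flow Hc sa ta; have e2 := l2ip_flow His sa ta.
  have [g1 _] := l2ip_g tc sa; have [_ g2] := l2ip_g ts sa.
  rewrite -/(cosn n) in g1 e1; rewrite -/(sinn n) in g2 e2.
  rewrite derive1_cosn in g1; rewrite derive1_sinn in g2.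
  have [_ r1] := l2ip_toCZ (- n%:R) (inH_L2 (yH sa)) ts.
  have [r2 _] := l2ip_toCZ n%:R (inH_L2 (yH sa)) tc.
  rewrite -/(sinn n) in r1; rewrite -/(cosn n) in r2.
  rewrite r1 in g1; rewrite r2 in g2; rewrite g1 in e1; rewrite g2 mulI_norm in e2.
  have -> : p (y t) - p (y s) - (t - s) * (n%:R * p (y s)) =
    (l2ip (y t) (toC (cosn n)) - l2ip (y s) (toC (cosn n)) - (t - s) * (sg * (- n%:R * l2ip (y s) (mulI (toC (sinn n)))))) -
    sg * (l2ip (y t) (mulI (toC (sinn n))) - l2ip (y s) (mulI (toC (sinn n))) - (t - s) * (sg * (- (n%:R * l2ip (y s) (toC (cosn n)))))).
    rewrite /p; move: (l2ip _ _) (l2ip _ _) (l2ip _ _) (l2ip _ _) => A1 A2 A3 A4.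
    have s2 := sg2; ring: s2.
  apply: (le_trans (ler_normB _ _)); rewrite normrM /K' [leRHS]mulrDl; apply: lerD => //.
  by rewrite -[leRHS]mulrA ler_wpM2l.
have e1 := l2ip_flow Hic sa ta; have e2 := l2ip_flow Hs sa ta.
have [_ g1] := l2ip_g tc sa; have [g2 _] := l2ip_g ts sa.
rewrite -/(cosn n) in g1 e1; rewrite -/(sinn n) in g2 e2.
rewrite derive1_cosn in g1; rewrite derive1_sinn in g2.
have [r1 _] := l2ip_toCZ (- n%:R) (inH_L2 (yH sa)) ts.
have [_ r2] := l2ip_toCZ n%:R (inH_L2 (yH sa)) tc.
rewrite -/(sinn n) in r1; rewrite -/(cosn n) in r2.
rewrite r1 in g1; rewrite r2 in g2; rewrite g1 mulI_norm in e1; rewrite g2 in e2.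
have -> : q (y t) - q (y s) - (t - s) * (n%:R * q (y s)) =
  (l2ip (y t) (mulI (toC (cosn n))) - l2ip (y s) (mulI (toC (cosn n))) - (t - s) * (sg * - (- n%:R * l2ip (y s) (toC (sinn n))))) +
  sg * (l2ip (y t) (toC (sinn n)) - l2ip (y s) (toC (sinn n)) - (t - s) * (sg * (n%:R * l2ip (y s) (mulI (toC (cosn n)))))).
  rewrite /q; move: (l2ip _ _) (l2ip _ _) (l2ip _ _) (l2ip _ _) => A1 A2 A3 A4.
  have s2 := sg2; ring: s2.
apply: (le_trans (ler_normD _ _)); rewrite normrM /K' [leRHS]mulrDl; apply: lerD => //.
by rewrite -[leRHS]mulrA ler_wpM2l.
Qed.

Lemma normL2_trig_le (phi : R -> R) : testT phi -> (forall x, `|phi x| <= 1) ->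
  normL2 (toC phi) <= Num.sqrt period.
Proof.
move=> tphi p1; have [_ _ _ I] := testT_inL2 tphi.
rewrite /normL2 ler_sqrt ?(ltW period_gt0)//.
rewrite -[leRHS]mul1r -intC_cst.
apply: le_Rintegral => //; first exact: mcircle.
  by apply: integrableC_bounded; exact: bm_cst.
move=> x _; rewrite normc_sqr /= expr0n addr0 -[phi x ^+ 2]real_normK ?num_real//.
by rewrite exprn_ile1.
Qed.
End Coefficients.

(** * The evolution in imaginary time *)
Section EqT.
Context {R : realType}.
Local Notation VF := (R -> Rcomplex R).
Implicit Types (f g h : VF).

Lemma eqT_lin (c : R) f f' g g' : eqT f f' -> eqT g g' ->
  eqT (c *: f + g : VF) (c *: f' + g' : VF).
Proof.
apply: (@filterS2 _ _ (ae_filter_ringOfSetsType (@lebesgue_measure R))) => x H1 H2 cx.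
by rewrite /GRing.add /= /GRing.scale /= (H1 cx) (H2 cx).
Qed.

Lemma eqT_B f f' g g' : eqT f f' -> eqT g g' -> eqT (f - g : VF) (f' - g' : VF).
Proof.
move=> H1 H2; have := eqT_lin (-1) H2 H1.
by rewrite !scaleN1r ![- _ + _]addrC.
Qed.

Lemma eqT_D f f' g g' : eqT f f' -> eqT g g' -> eqT (f + g : VF) (f' + g' : VF).
Proof. by move=> H1 H2; have := eqT_lin 1 H1 H2; rewrite !scale1r. Qed.

Lemma eqT_Z (c : R) f f' : eqT f f' -> eqT (c *: f : VF) (c *: f' : VF).
Proof. by move=> H1; have := eqT_lin c H1 (eqT_refl (0 : VF)); rewrite !addr0. Qed.

Lemma eqT_mulI f f' : eqT f f' -> eqT (mulI f) (mulI f').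
Proof.
apply: (@filterS _ _ (ae_filter_ringOfSetsType (@lebesgue_measure R))) => x H1 cx.
by rewrite /mulI /= (H1 cx).
Qed.

Lemma mulIB f g : mulI (f - g) = mulI f - mulI g.
Proof.
have -> : f - g = -1 *: g + f by rewrite scaleN1r addrC.
by rewrite mulI_lin scaleN1r addrC.
Qed.
End EqT.

Section Evolution.
Context {R : realType}.
Local Notation VF := (R -> Rcomplex R).
(* The two norms are variables with defining equations, so that arithmetic on their
   values never unfolds them. *)
Variables (k : nat) (Nk N2 : VF -> R).
Hypotheses (NkE : Nk = @normH R k) (N2E : N2 = @normL2 R).
Variables (T : VF -> VF) (D : VF -> VF -> VF) (eps : R) (f0 : VF).
Hypotheses (k_ge1 : (1 <= k)%N) (f0H : inH k f0).
Variables (M L C : R).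
Hypotheses (M0 : 0 <= M) (C0 : 0 <= C).
Local Notation ball := (inBall (inH k : VF -> Prop) Nk f0 eps).
Hypothesis f0B : ball f0.
Hypothesis Ta : forall f, ball f -> inH k (T f) /\ Nk (T f) <= M.
Hypothesis T_lip : forall f g, ball f -> ball g -> Nk (T f - T g) <= L * Nk (f - g).
Hypothesis frechet_in : forall f, ball f -> forall h : VF, inH k h -> inH k (D f h).
Hypothesis frechet_lin : forall f, ball f -> forall (c : R) (h1 h2 : VF), inH k h1 -> inH k h2 ->
  eqT (D f (c *: h1 + h2)) (c *: D f h1 + D f h2 : VF).
Hypothesis Tb : forall f, ball f -> forall e, 0 < e -> exists2 d, 0 < d &
  forall h : VF, inH k h -> Nk h < d -> Nk (T (f + h) - T f - D f h) <= e * Nk h.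
Hypothesis Tc : forall f, ball f -> forall h : VF, inH k h -> N2 (D f h) <= C * N2 h.
Hypothesis Td : forall f, ball f -> exists E : VF -> VF,
  [/\ forall h : VF, inL2 h -> inL2 (E h) /\ N2 (E h) <= C * N2 h,
      forall h1 h2 : VF, inL2 h1 -> inL2 h2 -> eqT (E (h1 - h2)) (E h1 - E h2 : VF),
      forall h : VF, inH k h -> eqT (E h) (D f h) &
      eqT (wderiv 1 (T f)) (E (wderiv 1 f))].
Hypothesis Te : forall f, ball f -> forall h : VF, inH k h -> eqT (mulI (D f h)) (D f (mulI h)).
Hypothesis f0_eq : eqT (wderiv 1 f0) (T f0).

Let Hk : seminorm_on (inH k : VF -> Prop) Nk. Proof. by rewrite NkE; exact: hk_seminorm. Qed.
Let H2 : seminorm_on (inL2 : VF -> Prop) N2. Proof. by rewrite N2E; exact: l2_seminorm. Qed.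
Let NkI (f : VF) : inH k f -> Nk (mulI f) = Nk f. Proof. by rewrite NkE; exact: mulI_normH. Qed.
Let N2I (f : VF) : N2 (mulI f) = N2 f. Proof. by rewrite N2E; exact: mulI_norm. Qed.
Let N2_le_Nk (f : VF) : inH k f -> N2 f <= Nk f.
Proof. by rewrite N2E NkE; exact: normL2_le_normH. Qed.
Let wd1_in (f : VF) : inH k f -> inL2 (wderiv 1 f).
Proof. by move=> Hf; have [] := wderivP Hf k_ge1. Qed.
Let wd1_le (f : VF) : inH k f -> N2 (wderiv 1 f) <= Nk f.
Proof. by rewrite N2E NkE => _; exact: wderiv_normL2_le. Qed.
Let wd1B_le (f g : VF) : inH k f -> inH k g ->
  N2 ((wderiv 1 f : VF) - (wderiv 1 g : VF)) <= Nk (f - g).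
Proof. by rewrite N2E NkE => Hf Hg; exact: normL2_wderivB. Qed.
Let N2_eqT (f g : VF) : inL2 f -> inL2 g -> eqT f g -> N2 f = N2 g.
Proof. by rewrite N2E; exact: normL2_eqT. Qed.
Let eqT_N2 (f g : VF) : inL2 f -> inL2 g -> eqT f g <-> N2 (f - g) = 0.
Proof. by rewrite N2E; exact: eqTP. Qed.

Local Hint Extern 1 (inH k (_ + _)) => apply: (sn_PD Hk) : core.
Local Hint Extern 1 (inH k (_ - _)) => apply: (sn_PB Hk) : core.
Local Hint Extern 1 (inH k (_ *: _)) => apply: (sn_PZ Hk) : core.
Local Hint Extern 1 (inL2 (_ + _)) => apply: (sn_PD H2) : core.
Local Hint Extern 1 (inL2 (_ - _)) => apply: (sn_PB H2) : core.
Local Hint Extern 1 (inL2 (_ *: _)) => apply: (sn_PZ H2) : core.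

Section Flow.
Variables (sg : R) (a : R) (y : R -> VF) (K : R).
Hypotheses (sg1 : `|sg| = 1) (a0 : 0 < a).
Let F f : VF := sg *: mulI (T f).
Hypothesis y0 : Nk (y 0 - f0) = 0.
Hypothesis yB : forall t, 0 <= t <= a -> ball (y t).
Hypothesis yF : forall s t, 0 <= s <= a -> 0 <= t <= a ->
  Nk (y t - y s - (t - s) *: F (y s)) <= K * (t - s) ^+ 2.

Let FH f : ball f -> inH k (F f) /\ Nk (F f) <= M.
Proof.
move=> Bf; have [TH TM] := Ta Bf; have iH := mulI_inH TH.
by split; [rewrite /F; auto | rewrite /F (sn_Z Hk)// sg1 mul1r NkI].
Qed.

(** The defect [u = dy/dx - T y] satisfies [u' = sg i E u] in L^2.  With [q] the
    second order remainder of [y] and [r] the remainder of the Frechet derivative, the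
    increment of [u] minus its linear part equals [dq/dx - D q - r] almost everywhere:
    the [E]-terms cancel by (d), (e) and the linearity of [E].  The three leftovers
    are small in L^2 by [yF], (c) and (b). *)
Lemma flow_defect_eq0 t : 0 <= t <= a -> eqT (wderiv 1 (y t)) (T (y t)).
Proof.
move=> ta.
have /choice[E HE] : forall t, exists E : VF -> VF, 0 <= t <= a ->
    [/\ forall h : VF, inL2 h -> inL2 (E h) /\ N2 (E h) <= C * N2 h,
      forall h1 h2 : VF, inL2 h1 -> inL2 h2 -> eqT (E (h1 - h2)) (E h1 - E h2 : VF),
      forall h : VF, inH k h -> eqT (E h) (D (y t) h) &
      eqT (wderiv 1 (T (y t))) (E (wderiv 1 (y t)))].
  move=> s; have [sa|] := pselect (0 <= s <= a); last by exists id.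
  by have [E HE] := Td (yB sa); exists E.
pose u t : VF := (wderiv 1 (y t) : VF) - T (y t).
pose v t : VF := sg *: mulI (E t (u t)).
have uL t' : 0 <= t' <= a -> inL2 (u t').
  by move=> ta'; have [yH _] := yB ta'; have [TH _] := Ta (yB ta'); apply: (sn_PB H2); [exact: wd1_in | exact: inH_L2 TH].
have EL s : 0 <= s <= a -> forall h : VF, inL2 h -> inL2 (E s h) /\ N2 (E s h) <= C * N2 h.
  by move=> sa h hL; have [El _ _ _] := HE s sa; exact: El.
have [yH _] := yB ta; have [TH _] := Ta (yB ta).
apply/eqT_N2; [exact: wd1_in|exact: inH_L2 TH|].
apply: (gronwall_eq0 H2 (w := u) (v := v) C0 _ _ _ _ ta).
- move=> s sa; split; first exact: uL.
  by apply: (sn_PZ H2); apply: mulI_inL2; have [] := EL s sa _ (uL s sa).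
- have a00 : 0 <= (0:R) <= a by rewrite lexx ltW.
  have [y0H _] := yB a00; have [Ty0H _] := Ta (yB a00); have [Tf0H _] := Ta f0B.
  have w1 := wd1_in y0H; have w2 := wd1_in f0H.
  have t1 := inH_L2 Ty0H; have t2 := inH_L2 Tf0H.
  have E1 : u 0 = ((wderiv 1 (y 0) : VF) - wderiv 1 f0) + ((wderiv 1 f0 : VF) - T f0) - (T (y 0) - T f0).
    by rewrite /u; zmod.
  apply/eqP; rewrite eq_le (sn_ge0 H2) ?andbT; last exact: uL.
  rewrite E1; apply: (le_trans (sn_B H2 _ _)); [by auto|by auto|].
  apply: (le_trans (lerD (sn_D H2 _ _) (lexx _))); [by auto|by auto|].
  have b1 : N2 ((wderiv 1 (y 0) : VF) - wderiv 1 f0) <= 0.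
    by have := wd1B_le y0H f0H; rewrite y0.
  have b2 : N2 ((wderiv 1 f0 : VF) - T f0) = 0 by apply/eqT_N2.
  have b3 : N2 (T (y 0) - T f0) <= 0.
    apply: (le_trans (N2_le_Nk (sn_PB Hk Ty0H Tf0H))).
    by apply: (le_trans (T_lip (yB a00) f0B)); rewrite y0 mulr0.
  by rewrite b2; lra.
- move=> s sa; have [EuL EuN] := EL s sa _ (uL s sa).
  by rewrite /v (sn_Z H2); [rewrite sg1 mul1r N2I|exact: mulI_inL2].
move=> s sa e e0.
have Bs := yB sa; have [ysH _] := Bs; have [TsH _] := Ta Bs; have [FsH FsM] := FH Bs.
have [El Elin Eag Ewd] := HE s sa.
have [K' [K'0 KK']] : exists K' : R, 0 <= K' /\ K <= K'.
  by exists `|K|; rewrite normr_ge0 ler_norm.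
pose e' := e / (2 * (M + K' + 1)).
have MK : 0 < M + K' + 1 by rewrite ltr_wpDl// addr_ge0.
have e'0 : 0 < e' by rewrite divr_gt0// mulr_gt0.
have e'E : e' * (M + K' + 1) = e / 2 by rewrite /e'; field; rewrite gt_eqF.
have [d d0 Hd] := Tb Bs e'0.
pose d2 := e / (2 * (K' * (1 + C) + 1)).
have KC : 0 <= K' * (1 + C) by rewrite mulr_ge0// addr_ge0.
have KC1 : 0 < K' * (1 + C) + 1 by rewrite ltr_wpDl.
have d20 : 0 < d2 by rewrite divr_gt0// mulr_gt0.
have d2E : d2 * (K' * (1 + C) + 1) = e / 2 by rewrite /d2; field; rewrite gt_eqF.
exists (Num.min 1 (Num.min (d / (M + K' + 1)) d2)).
  by rewrite !lt_min ltr01 d20 divr_gt0.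
move=> t' ta'; rewrite !lt_min => /and3P[ts1 tsd tsd2].
have Bt := yB ta'; have [ytH _] := Bt; have [TtH _] := Ta Bt.
pose q : VF := y t' - y s - (t' - s) *: F (y s).
have qH : inH k q by rewrite /q; auto.
have dlt : y t' - y s = (t' - s) *: F (y s) + q by rewrite /q; zmod.
have dH : inH k (y t' - y s) by auto.
have x0 := normr_ge0 (t' - s).
have Nq : Nk q <= K' * `|t' - s| ^+ 2.
  apply: (le_trans (yF sa ta')); rewrite real_normK ?num_real//.
  by rewrite ler_wpM2r ?sqr_ge0.
have Nq' : Nk q <= K' * `|t' - s|.
  apply: (le_trans Nq); rewrite ler_wpM2l// expr2 ler_piMl// ltW//.
have Nd : Nk (y t' - y s) <= (M + K') * `|t' - s|.
  rewrite dlt; apply: (le_trans (sn_D Hk _ _)); [by auto|by auto|].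
  rewrite (sn_Z Hk)// mulrDl lerD// mulrC ler_wpM2r//.
have Ndd : Nk (y t' - y s) < d.
  apply: (le_lt_trans Nd); apply: (@le_lt_trans _ _ (`|t' - s| * (M + K' + 1))).
    by rewrite mulrC ler_wpM2l//; lra.
  by rewrite -ltr_pdivlMr.
pose r : VF := T (y t') - T (y s) - D (y s) (y t' - y s).
have Ddl := frechet_in Bs dH.
have rH : inH k r by rewrite /r; auto.
have Nr : Nk r <= e' * ((M + K') * `|t' - s|).
  have h2 : Nk r <= e' * Nk (y t' - y s).
    have := Hd _ dH Ndd; rewrite /r.
    by have -> : y s + (y t' - y s) = y t' by zmod.
  by apply: (le_trans h2); rewrite ler_wpM2l// ltW.
have DqH := frechet_in Bs qH.
have [X _] := El _ (wd1_in ysH).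
have [Z _] := El _ (inH_L2 TsH).
have iTH := mulI_inH TsH.
have A1 : eqT (wderiv 1 (y t' - y s)) ((t' - s) *: (sg *: mulI (E s (wderiv 1 (y s)))) + (wderiv 1 q : VF) : VF).
  rewrite dlt; apply: eqT_trans (wderiv_lin (t' - s) FsH qH k_ge1) _.
  apply: eqT_lin; last exact: eqT_refl.
  have := wderiv_lin sg iTH (inH0 k) k_ge1; rewrite addr0 => h1.
  apply: (eqT_trans h1).
  have h2 : eqT (wderiv 1 (0 : VF)) (0 : VF).
    apply: wderiv_eqT (inH0 k) k_ge1 inL2_0 _.
    have := wderiv_ip_lin (-1) inL2_0 inL2_0 (wd1_in (inH0 k)) (wd1_in (inH0 k))
      (proj2 (wderivP (inH0 k) k_ge1)) (proj2 (wderivP (inH0 k) k_ge1)).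
    by rewrite !scaleN1r !addNr.
  rewrite -[X in eqT _ X]addr0; apply: eqT_lin h2.
  apply: (eqT_trans (wderiv_mulI TsH k_ge1 iTH)); exact: eqT_mulI.
have A2 : eqT ((wderiv 1 (y t') : VF) - wderiv 1 (y s)) ((t' - s) *: (sg *: mulI (E s (wderiv 1 (y s)))) + (wderiv 1 q : VF) : VF).
  by apply: eqT_trans A1; apply: eqT_sym; exact: (wderivB ytH ysH k_ge1).
have A3 : eqT (D (y s) (y t' - y s)) ((t' - s) *: (sg *: mulI (E s (T (y s)))) + D (y s) q : VF).
  rewrite dlt; apply: (eqT_trans (frechet_lin Bs _ FsH qH)).
  apply: eqT_lin; last exact: eqT_refl.
  have := frechet_lin Bs sg iTH (inH0 k); rewrite addr0 => h1.
  apply: (eqT_trans h1).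
  have h2 : eqT (D (y s) 0) (0 : VF).
    have := frechet_lin Bs (-1) (inH0 k) (inH0 k).
    by rewrite !scaleN1r !addNr.
  rewrite -[X in eqT _ X]addr0; apply: eqT_lin h2.
  apply: (eqT_trans (eqT_sym (Te Bs TsH))); apply: eqT_mulI.
  exact: eqT_sym (Eag _ TsH).
have A4 : eqT (E s (u s)) (E s (wderiv 1 (y s)) - E s (T (y s)) : VF).
  exact: (Elin _ _ (wd1_in ysH) (inH_L2 TsH)).
have A5 : eqT (v s) (sg *: mulI (E s (wderiv 1 (y s))) - sg *: mulI (E s (T (y s))) : VF).
  rewrite -scalerBr -mulIB; apply: eqT_Z; exact: eqT_mulI.
have main : eqT (u t' - u s - (t' - s) *: v s : VF) ((wderiv 1 q : VF) - D (y s) q - r : VF).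
  have -> : u t' - u s - (t' - s) *: v s =
    ((wderiv 1 (y t') : VF) - wderiv 1 (y s)) - (D (y s) (y t' - y s) + r) - (t' - s) *: v s.
    have -> : D (y s) (y t' - y s) + r = T (y t') - T (y s) by rewrite /r; zmod.
    have zm (V : zmodType) (a1 a2 a3 a4 a5 : V) :
      a1 - a2 - (a3 - a4) - a5 = a1 - a3 - (a2 - a4) - a5 by zmod.
    exact: zm.
  apply: (eqT_trans (eqT_B (eqT_B A2 (eqT_D A3 (eqT_refl r))) (eqT_Z (t' - s) A5))).
  rewrite scalerBr.
  set p1 := (t' - s) *: (sg *: mulI (E s (wderiv 1 (y s)))).
  set p2 := (t' - s) *: (sg *: mulI (E s (T (y s)))).
  have -> : p1 + wderiv 1 q - (p2 + D (y s) q + r) - (p1 - p2) = (wderiv 1 q : VF) - D (y s) q - r.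
    have zm (V : zmodType) (a1 a2 a3 a4 a5 : V) :
      a1 + a3 - (a2 + a4 + a5) - (a1 - a2) = a3 - a4 - a5 by zmod.
    exact: zm.
  exact: eqT_refl.
have wq := wd1_in qH; have Dq2 := inH_L2 DqH; have r2 := inH_L2 rH.
have ut := uL _ ta'; have us := uL _ sa.
have vs : inL2 (v s) by apply: (sn_PZ H2); apply: mulI_inL2; have [] := El _ us.
have -> : N2 (u t' - u s - (t' - s) *: v s) = N2 ((wderiv 1 q : VF) - D (y s) q - r).
  by apply: N2_eqT main; auto.
apply: (le_trans (sn_B H2 _ r2)); first by auto.
apply: (le_trans (lerD (sn_B H2 wq Dq2) (lexx _))).
have b1 : N2 (wderiv 1 q) <= Nk q by exact: wd1_le.
have b2 : N2 (D (y s) q) <= C * Nk q.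
  apply: (le_trans (Tc Bs qH)); by rewrite ler_wpM2l// N2_le_Nk.
have b3 : N2 r <= Nk r by exact: N2_le_Nk.
have Nq0 := sn_ge0 Hk qH.
have c1 : (1 + C) * Nk q <= `|t' - s| * (e / 2).
  apply: (@le_trans _ _ ((1 + C) * (K' * `|t' - s| ^+ 2))).
    by rewrite ler_wpM2l// addr_ge0.
  have -> : (1 + C) * (K' * `|t' - s| ^+ 2) = `|t' - s| * (`|t' - s| * (K' * (1 + C))) by ring.
  rewrite ler_wpM2l// -d2E; apply: ler_pM => //; [exact: ltW|lra].
have c2 : e' * ((M + K') * `|t' - s|) <= `|t' - s| * (e / 2).
  rewrite -e'E.
  have -> : e' * ((M + K') * `|t' - s|) = `|t' - s| * (e' * (M + K')) by ring.
  by rewrite ler_wpM2l// ler_wpM2l ?(ltW e'0)//; lra.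
lra.
Qed.
End Flow.

(** The solution moves with speed at most [M], so that it stays within [eps / 2] of
    [f0] up to this time. *)
Definition lifespan : R := eps / (2 * (M + 1)).
Hypothesis eps_gt0 : 0 < eps.

Lemma lifespan_gt0 : 0 < lifespan.
Proof. by rewrite divr_gt0// mulr_gt0// ltr_wpDl. Qed.

(** A combination that grows like [exp (n t)] but is bounded by [B] at the final time
    was at most [B exp (- n a)] at the start. *)
Lemma coef_decay (sg : R) (n : nat) : `|sg| = 1 ->
  let B := (N2 f0 + eps) * Num.sqrt period * 2 in
  let c := toC (fun x => cos (n%:R * x)) in let s := toC (fun x => sin (n%:R * x)) in
  `|l2ip f0 c - sg * l2ip f0 (mulI s)| <= B * expR (- (n%:R * lifespan)) /\
  `|l2ip f0 (mulI c) + sg * l2ip f0 s| <= B * expR (- (n%:R * lifespan)).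
Proof.
move=> sg1 B c s.
have sg2 : sg * sg = 1 by rewrite -expr2 -real_normK ?num_real// sg1 expr1n.
have Mar : M * lifespan < eps.
  rewrite /lifespan mulrCA -[ltRHS]mulr1 ltr_pM2l// ltr_pdivrMr ?mulr_gt0 ?ltr_wpDl// mul1r.
  by have := M0; lra.
pose F (f : VF) : VF := sg *: mulI (T f).
have FP (f : VF) : inH k f -> Nk (f - f0) < eps -> inH k (F f) /\ Nk (F f) <= M.
  move=> fH fB; have [TH TM] := Ta (conj fH fB); have iH := mulI_inH TH.
  by split; [rewrite /F; auto | rewrite /F (sn_Z Hk)// sg1 mul1r NkI].
have FL (f g : VF) : inH k f -> Nk (f - f0) < eps -> inH k g -> Nk (g - f0) < eps ->
    Nk (F f - F g) <= `|L| * Nk (f - g).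
  move=> fH fB gH gB; have [Tf _] := Ta (conj fH fB); have [Tg _] := Ta (conj gH gB).
  have TfgH := sn_PB Hk Tf Tg.
  have -> : F f - F g = sg *: mulI (T f - T g) by rewrite /F -scalerBr mulIB.
  rewrite (sn_Z Hk); last exact: mulI_inH.
  rewrite sg1 mul1r NkI//; apply: (le_trans (T_lip (conj fH fB) (conj gH gB))).
  by rewrite ler_wpM2r ?ler_norm//; apply: (sn_ge0 Hk); auto.
have compl : rapidly_complete (inH k : VF -> Prop) Nk by rewrite NkE; exact: hk_complete.
have [y [K [y0 yr yF]]] :=
  ode_exists Hk compl f0H FP FL M0 (normr_ge0 L) lifespan_gt0 Mar.
have l0 := ltW lifespan_gt0.
have yB t : 0 <= t <= lifespan -> ball (y t) by move=> /yr.
have defect t : 0 <= t <= lifespan -> eqT (wderiv 1 (y t)) (T (y t)).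
  exact: (flow_defect_eq0 sg1 lifespan_gt0 y0 yB yF).
have yH t : 0 <= t <= lifespan -> inH k (y t) by move=> /yr[].
have gL t : 0 <= t <= lifespan -> inL2 (T (y t)).
  by move=> /yB /Ta[TH _]; exact: inH_L2 TH.
have est t' t : 0 <= t' <= lifespan -> 0 <= t <= lifespan ->
    normL2 (y t - y t' - (t - t') *: (sg *: mulI (T (y t')))) <= K * (t - t') ^+ 2.
  move=> ta' ta; rewrite -N2E; apply: le_trans (yF _ _ ta' ta).
  have [FH' _] := FP _ (yH _ ta') (yB _ ta').2.
  have h1 := yH _ ta; have h2 := yH _ ta'.
  by apply: N2_le_Nk; apply: (sn_PB Hk); auto.
have [pE qE] := flow_coef k_ge1 l0 sg2 yH gL defect est n.
have z0 : 0 <= (0 : R) <= lifespan by rewrite lexx.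
have za : 0 <= lifespan <= lifespan by rewrite lexx l0.
have cL : inL2 c by apply: testT_inL2; exact: testT_cos.
have sL : inL2 s by apply: testT_inL2; exact: testT_sin.
have icL := mulI_inL2 cL; have isL := mulI_inL2 sL.
have y0E (h : VF) : inL2 h -> l2ip (y 0) h = l2ip f0 h.
  move=> hL; apply: l2ip_eqT => //; [exact: inH_L2 (yH _ z0)|exact: inH_L2 f0H|].
  apply/(eqT_N2 (inH_L2 (yH _ z0)) (inH_L2 f0H)).
  apply/eqP; rewrite eq_le (sn_ge0 H2) ?andbT; last first.
    by apply: (sn_PB H2); [exact: inH_L2 (yH _ z0)|exact: inH_L2 f0H].
  by have := N2_le_Nk (sn_PB Hk (yH _ z0) f0H); rewrite y0.
have ya : N2 (y lifespan) <= N2 f0 + eps.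
  have h1 := inH_L2 (yH _ za); have h2 := inH_L2 f0H.
  apply: (le_trans (sn_rtri H2 h1 h2)); rewrite addrC lerD2l.
  apply: (le_trans (N2_le_Nk (sn_PB Hk (yH _ za) f0H))).
  by apply: ltW; have [] := yr _ za.
have cN : normL2 c <= Num.sqrt period.
  by apply: normL2_trig_le; [exact: testT_cos | move=> x; exact: cos_max].
have sN : normL2 s <= Num.sqrt period.
  by apply: normL2_trig_le; [exact: testT_sin | move=> x; exact: sin_max].
have bound (h : VF) : inL2 h -> normL2 h <= Num.sqrt period ->
    `|l2ip (y lifespan) h| <= (N2 f0 + eps) * Num.sqrt period.
  move=> hL hN; have yaL := inH_L2 (yH _ za).
  apply: (le_trans (l2_CS yaL hL)); rewrite -N2E; apply: ler_pM => //.
  - exact: (sn_ge0 H2).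
  - exact: (sn_ge0 H2).
  - by rewrite N2E.
have inv (z w : R) : z = expR (n%:R * lifespan) * w -> `|z| <= B -> `|w| <= B * expR (- (n%:R * lifespan)).
  move=> -> h; have -> : w = (expR (n%:R * lifespan) * w) * expR (- (n%:R * lifespan)).
    by rewrite mulrAC -expRD subrr expR0 mul1r.
  by rewrite normrM (ger0_norm (expR_ge0 (- _))) ler_wpM2r ?expR_ge0.
split.
  rewrite -!y0E//; apply: (inv _ _ pE).
  apply: (le_trans (ler_normB _ _)); rewrite normrM sg1 mul1r /B mulr_natr mulr2n.
  by apply: lerD; apply: bound => //; rewrite mulI_norm.
rewrite -!y0E//; apply: (inv _ _ qE).
apply: (le_trans (ler_normD _ _)); rewrite normrM sg1 mul1r /B mulr_natr mulr2n.
by apply: lerD; apply: bound => //; rewrite mulI_norm.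
Qed.
End Evolution.

(** * Trigonometric series with exponentially decaying coefficients *)
Section TailBounds.
Context {R : realType}.
Implicit Types (u c : nat -> R).

Lemma cvg_dist_le u (l b B : R) (J0 : nat) : u @ \oo --> l ->
  (forall J, (J0 <= J)%N -> `|u J - b| <= B) -> `|l - b| <= B.
Proof.
move=> ul H; apply: (@le_of_eps _ _ _ 1) => e e0; rewrite mul1r.
have /cvgrPdist_lt /(_ e e0) [N _ HN] := ul.
pose J := maxn N J0.
have h1 := HN J (leq_maxl _ _); have h2 := H J (leq_maxr _ _).
have -> : l - b = (u J - b) + (l - u J) by ring.
by apply: (le_trans (ler_normD _ _)); rewrite lerD// ltW.
Qed.

Lemma exp_partial_le (x : R) n : 0 <= x -> series (exp_coeff x) n <= expR x.
Proof.
move=> x0; rewrite /expR; apply: nondecreasing_cvgn_le; last exact: is_cvg_series_exp_coeff.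
apply: nondecreasing_series => i _ _; rewrite /exp_coeff /=.
by rewrite divr_ge0 ?exprn_ge0// ler0n.
Qed.

Lemma exp_term_le (x : R) n : 0 <= x -> exp_coeff x n <= expR x.
Proof.
move=> x0; apply: le_trans (exp_partial_le n.+1 x0).
rewrite /series /= big_nat_recr//= lerDr; apply: sumr_ge0 => i _.
by rewrite divr_ge0 ?exprn_ge0// ler0n.
Qed.

(** Splitting off [2 ^- M] from the tail of an exponential-type series costs
    only a doubling of the argument. *)
Lemma exp_tail_le c (h l : R) M : (forall m, `|c m| <= exp_coeff `|h| m) ->
  series c @ \oo --> l -> `|l - series c M| <= 2 ^- M * expR (2 * `|h|).
Proof.
move=> ch cl; apply: (cvg_dist_le (J0 := M) cl) => J MJ.
rewrite sub_series_geq//; apply: (le_trans (ler_norm_sum _ _ _)).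
have h2 : 0 <= 2 * `|h| by rewrite mulr_ge0.
apply: (@le_trans _ _ (2 ^- M * series (exp_coeff (2 * `|h|)) J)); last first.
  by rewrite ler_wpM2l ?invr_ge0 ?exprn_ge0// exp_partial_le.
rewrite /series /= mulr_sumr [leRHS](big_cat_nat (n := M))//=.
apply: ler_wpDl.
  apply: sumr_ge0 => i _; rewrite mulr_ge0 ?invr_ge0 ?exprn_ge0//.
  by rewrite divr_ge0 ?exprn_ge0// ler0n.
rewrite big_nat_cond [leRHS]big_nat_cond; apply: ler_sum => i /andP[/andP[Mi _] _].
apply: (le_trans (ch i)); rewrite /exp_coeff /= exprMn mulrA mulrA.
rewrite ler_wpM2r ?invr_ge0 ?ler0n// ler_peMl ?exprn_ge0//.
by rewrite -ler_pdivrMl ?invr_gt0 ?exprn_gt0// invrK mulr1 ler_eXn2l// ltr1n.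
Qed.

Lemma cos_coeff_le (h : R) m : `|cos_coeff h m| <= exp_coeff `|h| m.
Proof.
rewrite /cos_coeff /exp_coeff /= !normrM normfV normrX normrN1 expr1n mulr1 !normr_nat.
rewrite normrX ler_wpM2r ?invr_ge0// ler_piMl ?exprn_ge0//.
by case: (odd m).
Qed.
Lemma sin_coeff_le (h : R) m : `|sin_coeff h m| <= exp_coeff `|h| m.
Proof.
rewrite /sin_coeff /exp_coeff /= !normrM normfV normrX normrN1 expr1n mulr1 !normr_nat.
rewrite normrX ler_wpM2r ?invr_ge0// ler_piMl ?exprn_ge0//.
by case: (odd m).
Qed.

Lemma cos_tail_le (h : R) M : `|cos h - series (cos_coeff h) M| <= 2 ^- M * expR (2 * `|h|).
Proof.
apply: exp_tail_le => [m|]; first exact: cos_coeff_le.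
by rewrite cos.unlock; exact: is_cvg_series_cos_coeff.
Qed.
Lemma sin_tail_le (h : R) M : `|sin h - series (sin_coeff h) M| <= 2 ^- M * expR (2 * `|h|).
Proof.
apply: exp_tail_le => [m|]; first exact: sin_coeff_le.
by rewrite sin.unlock; exact: is_cvg_series_sin_coeff.
Qed.

Lemma cos_coeffM (n h : R) m : cos_coeff (n * h) m = cos_coeff n m * h ^+ m.
Proof. by rewrite /cos_coeff /= exprMn; ring. Qed.
Lemma sin_coeffM (n h : R) m : sin_coeff (n * h) m = sin_coeff n m * h ^+ m.
Proof. by rewrite /sin_coeff /= exprMn; ring. Qed.

Lemma geometric_cvg u (K r : R) : 0 < r < 1 -> (forall n, `|u n| <= K * r ^+ n) ->
  cvgn (series u) /\ forall J, `|limn (series u) - series u J| <= K / (1 - r) * r ^+ J.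
Proof.
move=> /andP[r0 r1] H.
have nr : `|r| < 1 by rewrite gtr0_norm.
have K0 : 0 <= K by have := le_trans (normr_ge0 _) (H 0%N); rewrite expr0 mulr1.
have cu : cvgn (series u).
  apply: (normed_cvg (V := R^o)); apply: series_le_cvg (is_cvg_geometric_series (a := K) nr) => [n|n|n] /=.
  - exact: normr_ge0.
  - by rewrite mulr_ge0// exprn_ge0// ltW.
  - exact: H.
split=> // J; apply: (cvg_dist_le (J0 := J) cu) => J' JJ'.
rewrite sub_series_geq//; apply: (le_trans (ler_norm_sum _ _ _)).
apply: (@le_trans _ _ (\sum_(J <= i < J') K * r ^+ i)).
  by apply: ler_sum => i _; exact: H.
have r10 : 0 < 1 - r by rewrite subr_gt0.
rewrite -mulr_sumr -mulrA ler_wpM2l// ler_pdivlMl//.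
elim: J' JJ' => [|J' IH].
  by rewrite leqn0 => /eqP ->; rewrite big_geq// mulr0.
rewrite leq_eqVlt => /predU1P[->|]; first by rewrite big_geq// mulr0 exprn_ge0// ltW.
rewrite ltnS => JJ'.
suff E m : (J <= m)%N -> (1 - r) * (\sum_(J <= i < m) r ^+ i) = r ^+ J - r ^+ m.
  by rewrite E ?(leq_trans JJ')// lerBlDr lerDl exprn_ge0// ltW.
elim: m => [|m IHm]; first by rewrite leqn0 => /eqP ->; rewrite big_geq// mulr0 subrr.
rewrite leq_eqVlt => /predU1P[->|]; first by rewrite big_geq// mulr0 subrr.
rewrite ltnS => Jm; rewrite big_nat_recr//= mulrDr IHm// exprS; ring.
Qed.

Lemma series_lin_cvg (c : R) u v (l l' : R) : series u @ \oo --> l -> series v @ \oo --> l' ->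
  series (fun n => c * u n + v n) @ \oo --> c * l + l'.
Proof.
move=> ul vl.
rewrite (_ : series _ = fun J => c * series u J + series v J).
  by apply: cvgD => //; apply: cvgM => //; exact: cvg_cst.
by apply/funext => J; rewrite /series /= big_split /= mulr_sumr.
Qed.

Section TrigSeries.
Variables (al be : nat -> R) (K a : R).
Hypotheses (a0 : 0 < a) (al_le : forall n, `|al n| <= K * expR (- (n%:R * a)))
  (be_le : forall n, `|be n| <= K * expR (- (n%:R * a))).

Definition trig_term (x : R) (n : nat) : R := al n * cos (n%:R * x) + be n * sin (n%:R * x).
Definition trig_sum (x : R) : R := limn (series (trig_term x)).

Let r : R := expR (- (a / 2)).
Let r01 : 0 < r < 1.
Proof. by rewrite expR_gt0 -expR0 ltr_expR oppr_lt0 divr_gt0. Qed.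
Let rE (n : nat) : r ^+ n = expR (- (n%:R * (a / 2))).
Proof. by rewrite /r -expRM_natl mulrN. Qed.
Let e_le (n : nat) : expR (- (n%:R * a)) <= r ^+ n.
Proof.
rewrite rE ler_expR lerN2 ler_wpM2l//; have := a0; lra.
Qed.
Let K0 : 0 <= K.
Proof. by have := le_trans (normr_ge0 _) (al_le 0%N); rewrite mul0r oppr0 expR0 mulr1. Qed.

Let lin_le (x y c s B : R) : `|x| <= B -> `|y| <= B -> `|c| <= 1 -> `|s| <= 1 ->
  `|x * c + y * s| <= 2 * B.
Proof.
move=> xB yB c1 s1; apply: (le_trans (ler_normD _ _)); rewrite !normrM mulr_natl mulr2n.
by apply: lerD; [apply: le_trans xB | apply: le_trans yB]; rewrite ler_piMr.
Qed.

Lemma trig_term_le x n : `|trig_term x n| <= 2 * K * r ^+ n.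
Proof.
rewrite -mulrA; apply: lin_le; rewrite ?cos_max ?sin_max//.
  by apply: (le_trans (al_le n)); rewrite ler_wpM2l.
by apply: (le_trans (be_le n)); rewrite ler_wpM2l.
Qed.

Lemma trig_sum_cvg x : series (trig_term x) @ \oo --> trig_sum x.
Proof. by have [] := geometric_cvg r01 (trig_term_le x). Qed.

Lemma trig_sum_unif x J :
  `|trig_sum x - series (trig_term x) J| <= 2 * K / (1 - r) * r ^+ J.
Proof. by have [_] := geometric_cvg r01 (trig_term_le x). Qed.

Lemma trig_sum_periodic : periodic trig_sum period.
Proof.
move=> x; congr (limn (series _)); apply/funext => n.
rewrite /trig_term mulrDr /period (mulr_natl (pi *+ 2)).
by rewrite (periodicn (@cosD2pi R)) (periodicn (@sinD2pi R)).
Qed.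

(** Around [x0] the n-th term is a combination of [cos (n h)] and [sin (n h)], whose
    power series of order [M] has remainder at most [2 ^- M exp (2 n |h|)] by
    [exp_tail_le].  For [|h| <= a / 4] the factor [exp (2 n |h|)] is absorbed by half of the decay
    [exp (- n a)], so that the remainders can be summed over [n]. *)
Lemma trig_sum_analytic (x0 : R) : exists (c : nat -> R) (S : R), forall h, `|h| <= a / 4 ->
  forall M, `|\sum_(m < M) c m * h ^+ m - trig_sum (x0 + h)| <= S * 2 ^- M.
Proof.
pose A n := al n * cos (n%:R * x0) + be n * sin (n%:R * x0).
pose B n := be n * cos (n%:R * x0) + (- al n) * sin (n%:R * x0).
pose en n : R := expR (- (n%:R * a)).
have A_le n : `|A n| <= 2 * (K * en n) by apply: lin_le; rewrite ?cos_max ?sin_max ?normrN.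
have B_le n : `|B n| <= 2 * (K * en n) by apply: lin_le; rewrite ?cos_max ?sin_max ?normrN.
have termE h n : trig_term (x0 + h) n = A n * cos (n%:R * h) + B n * sin (n%:R * h).
  by rewrite /trig_term mulrDr cosD sinD /A /B; ring.
pose f m n := A n * cos_coeff n%:R m + B n * sin_coeff n%:R m.
pose b := a / 2.
have b0 : 0 < b by rewrite divr_gt0.
have coef_le m (n : nat) : exp_coeff `|n%:R : R| m <= b ^- m * expR (n%:R * b).
  rewrite normr_nat mulrC ler_pdivlMr ?exprn_gt0//.
  have := @exp_term_le (n%:R * b) m; rewrite /exp_coeff /= exprMn mulrAC.
  by apply; rewrite mulr_ge0// ltW.
have enb n : en n * expR (n%:R * b) = r ^+ n.
  by rewrite rE /en -expRD; congr expR; rewrite /b; field.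
have f_le m n : `|f m n| <= 4 * K * b ^- m * r ^+ n.
  have X : 0 <= 2 * (K * en n) by rewrite !mulr_ge0// expR_ge0.
  have Y z w : `|z| <= 2 * (K * en n) -> `|w| <= exp_coeff `|n%:R : R| m ->
      `|z * w| <= 2 * (K * en n) * (b ^- m * expR (n%:R * b)).
    by move=> h1 h2; rewrite normrM; apply: ler_pM => //; apply: le_trans h2 _.
  apply: (le_trans (ler_normD _ _)).
  apply: (le_trans (lerD (Y _ _ (A_le n) (cos_coeff_le _ _)) (Y _ _ (B_le n) (sin_coeff_le _ _)))).
  by rewrite -enb le_eqVlt; apply/orP; left; apply/eqP; ring.
have f_cvg m : series (f m) @ \oo --> limn (series (f m)).
  by have [] := geometric_cvg r01 (f_le m).
exists (fun m => limn (series (f m))), (4 * K / (1 - r)) => h ha M.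
pose t n := A n * (series (cos_coeff (n%:R * h)) M - cos (n%:R * h)) +
            B n * (series (sin_coeff (n%:R * h)) M - sin (n%:R * h)).
have fin : forall M, series (fun n => \sum_(m < M) f m n * h ^+ m) @ \oo --> \sum_(m < M) limn (series (f m)) * h ^+ m.
  elim=> [|M' IH].
    rewrite big_ord0 (_ : series _ = fun=> 0); first exact: cvg_cst.
    by apply/funext => J; rewrite /series /= big1// => n _; rewrite big_ord0.
  rewrite big_ord_recr /= addrC [_ * h ^+ M']mulrC.
  rewrite (_ : (fun n => \sum_(m < M'.+1) f m n * h ^+ m) =
    fun n => h ^+ M' * f M' n + \sum_(m < M') f m n * h ^+ m).
    exact: series_lin_cvg.
  by apply/funext => n; rewrite big_ord_recr /= addrC mulrC.
have t_le n : `|t n| <= 4 * K * 2 ^- M * r ^+ n.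
  have hn : expR (2 * `|n%:R * h|) <= expR (n%:R * b).
    rewrite ler_expR normrM normr_nat mulrCA ler_wpM2l// /b; lra.
  have Y z (w w' : R) : `|z| <= 2 * (K * en n) -> `|w' - w| <= 2 ^- M * expR (2 * `|n%:R * h|) ->
      `|z * (w - w')| <= 2 * (K * en n) * (2 ^- M * expR (n%:R * b)).
    move=> h1 h2; rewrite normrM distrC; apply: ler_pM => //.
    by apply: (le_trans h2); rewrite ler_wpM2l// invr_ge0 exprn_ge0.
  apply: (le_trans (ler_normD _ _)).
  apply: (le_trans (lerD (Y _ _ _ (A_le n) (cos_tail_le _ _)) (Y _ _ _ (B_le n) (sin_tail_le _ _)))).
  by rewrite -enb le_eqVlt; apply/orP; left; apply/eqP; ring.
have [tc tl] := geometric_cvg r01 t_le.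
have tlim : series t @ \oo --> \sum_(m < M) limn (series (f m)) * h ^+ m - trig_sum (x0 + h).
  rewrite addrC -mulN1r.
  rewrite (_ : t = fun n => -1 * trig_term (x0 + h) n + \sum_(m < M) f m n * h ^+ m).
    by apply: series_lin_cvg => //; exact: trig_sum_cvg.
  apply/funext => n; rewrite termE /t /series /= !big_mkord !mulrBr !mulr_sumr.
  have -> : \sum_(m < M) f m n * h ^+ m =
    \sum_(m < M) A n * cos_coeff (n%:R * h) m + \sum_(m < M) B n * sin_coeff (n%:R * h) m.
    rewrite -big_split; apply: eq_bigr => m _ /=.
    by rewrite cos_coeffM sin_coeffM /f; ring.
  ring.
have := tl 0%N; rewrite (cvg_lim _ tlim)// /series /= big_geq// subr0 expr0 mulr1.
move=> /le_trans; apply; rewrite le_eqVlt; apply/orP; left; apply/eqP; ring.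
Qed.
End TrigSeries.
End TailBounds.

(** * Fourier coefficients of a trigonometric series *)
Section TrigOrthogonality.
Context {R : realType}.
Local Notation leb := (@lebesgue_measure R).
Local Notation circle := (@circle R).

Lemma intC_derive (F f : R -> R) : (forall x : R, is_derive x 1 F (f x)) -> continuous f ->
  intC f = F period - F 0.
Proof.
move=> dF cf.
have cF x : F @ x --> F x.
  by apply: differentiable_continuous; apply/derivable1_diffP; have [] := dF x.
rewrite /intC /Rintegral /circle (@continuous_FTC2 _ f F 0 period) ?period_gt0//.
- by apply: continuous_subspaceT => x; exact: cf.
- split=> [x _||]; first by have [] := dF x.
  + by apply: cvg_at_right_filter; exact: cF.
  + by apply: cvg_at_left_filter; exact: cF.
- by move=> x _; rewrite derive1E; have [_ ->] := dF x.
Qed.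

Lemma cos_continuous (k : R) : continuous (fun x => cos (k * x)).
Proof.
by move=> x; apply: continuous_comp; [exact: mulrl_continuous | exact: continuous_cos].
Qed.
Lemma sin_continuous (k : R) : continuous (fun x => sin (k * x)).
Proof.
by move=> x; apply: continuous_comp; [exact: mulrl_continuous | exact: continuous_sin].
Qed.

Lemma cos_int_period (k : int) : cos (k%:~R * period : R) = 1 /\ sin (k%:~R * period : R) = 0.
Proof.
have nat_case (n : nat) : cos (n%:R * period : R) = 1 /\ sin (n%:R * period : R) = 0.
  rewrite mulr_natl -[_ *+ n]add0r (periodicn (@cosD2pi R)) (periodicn (@sinD2pi R)).
  by rewrite cos0 sin0.
case: k => n; first exact: nat_case.
by rewrite NegzE mulrNz mulNr cosN sinN; have [-> ->] := nat_case n.+1; rewrite oppr0.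
Qed.

Lemma intC_cos (k : int) : intC (fun x => cos (k%:~R * x)) = if k == 0 then period else 0 :> R.
Proof.
case: eqVneq => [->|k0].
  by under [X in intC X]eq_fun do rewrite mul0r cos0; rewrite intC_cst mul1r.
have kr : k%:~R != 0 :> R by rewrite intr_eq0.
have d (x : R) : is_derive x 1 (fun x : R => k%:~R^-1 * sin (k%:~R * x)) (cos (k%:~R * x) : R).
  by apply: is_derive_eq; rewrite /GRing.scale /=; field.
rewrite (intC_derive d (@cos_continuous _)).
by have [_ ->] := cos_int_period k; rewrite !mulr0 sin0 mulr0 subr0.
Qed.

Lemma intC_sin (k : int) : intC (fun x => sin (k%:~R * x)) = 0 :> R.
Proof.
have [->|k0] := eqVneq k 0.
  by under [X in intC X]eq_fun do rewrite mul0r sin0; rewrite intC_cst mul0r.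
have kr : k%:~R != 0 :> R by rewrite intr_eq0.
have d (x : R) : is_derive x 1 (fun x : R => - k%:~R^-1 * cos (k%:~R * x)) (sin (k%:~R * x) : R).
  by apply: is_derive_eq; rewrite /GRing.scale /=; field.
rewrite (intC_derive d (@sin_continuous _)).
by have [-> _] := cos_int_period k; rewrite mulr0 cos0 subrr.
Qed.

Lemma intC_half (f g : R -> R) (c : R) : bounded_measurable f -> bounded_measurable g ->
  intC (fun x => 2^-1 * (f x + c * g x)) = 2^-1 * (intC f + c * intC g).
Proof.
move=> /integrableC_bounded If /integrableC_bounded Ig.
rewrite intCZ; last by apply: integrableCD => //; exact: integrableCZ.
by rewrite intCD ?intCZ//; exact: integrableCZ.
Qed.

(** The integral over the circle of [cos (n x) ^ 2]. *)
Definition trig_norm (n : nat) : R := if n == 0%N then period else pi.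

Let dif (n m : nat) (x : R) : (n%:Z - m%:Z)%:~R * x = n%:R * x - m%:R * x.
Proof. by rewrite intrB mulrBl. Qed.
Let sum (n m : nat) (x : R) : (n%:Z + m%:Z)%:~R * x = n%:R * x + m%:R * x.
Proof. by rewrite intrD mulrDl. Qed.
Let sum0 (n m : nat) : (n%:Z + m%:Z == 0) = (n == 0%N) && (m == 0%N).
Proof. by rewrite -PoszD eqz_nat addn_eq0. Qed.

Lemma intC_cos_cos (n m : nat) :
  intC (fun x => cos (n%:R * x) * cos (m%:R * x)) = if n == m then trig_norm m else 0.
Proof.
transitivity (intC (fun x : R => 2^-1 * (cos ((n%:Z - m%:Z)%:~R * x) + 1 * cos ((n%:Z + m%:Z)%:~R * x)))).
  by congr intC; apply/funext => x; rewrite dif sum cosB cosD; field.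
rewrite intC_half ?intC_cos; [|exact: bm_cos|exact: bm_cos].
rewrite subr_eq0 eqz_nat sum0 mul1r /trig_norm /period.
by case: eqVneq => [->|nm]; case: eqVneq => [n0|n0] //=; rewrite ?andbb ?n0 ?eqxx /=;
  first [by field | by case: eqVneq => [m0|m0]; [move: nm; rewrite n0 m0 eqxx|field] | by field].
Qed.

Lemma intC_sin_sin (n m : nat) :
  intC (fun x => sin (n%:R * x) * sin (m%:R * x)) = if (n == m) && (m != 0%N) then trig_norm m else 0.
Proof.
transitivity (intC (fun x : R => 2^-1 * (cos ((n%:Z - m%:Z)%:~R * x) + -1 * cos ((n%:Z + m%:Z)%:~R * x)))).
  by congr intC; apply/funext => x; rewrite dif sum cosB cosD; field.
rewrite intC_half ?intC_cos; [|exact: bm_cos|exact: bm_cos].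
rewrite subr_eq0 eqz_nat sum0 /trig_norm /period.
by case: eqVneq => [->|nm]; case: eqVneq => [n0|n0] //=; rewrite ?andbb ?n0 ?eqxx /=;
  first [by field | by case: eqVneq => [m0|m0]; [move: nm; rewrite n0 m0 eqxx|field] | by field].
Qed.

Lemma intC_sin_cos (n m : nat) :
  intC (fun x => sin (n%:R * x) * cos (m%:R * x)) = 0 :> R.
Proof.
transitivity (intC (fun x : R => 2^-1 * (sin ((n%:Z - m%:Z)%:~R * x) + 1 * sin ((n%:Z + m%:Z)%:~R * x)))).
  by congr intC; apply/funext => x; rewrite dif sum sinB sinD; field.
rewrite intC_half ?intC_sin; [|exact: bm_sin|exact: bm_sin].
by rewrite mulr0 addr0 mulr0.
Qed.

Section Coefficients.
Variables (al be : nat -> R) (K a : R).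
Hypotheses (a0 : 0 < a) (al_le : forall n, `|al n| <= K * expR (- (n%:R * a)))
  (be_le : forall n, `|be n| <= K * expR (- (n%:R * a))).
Local Notation G := (trig_sum al be).
Local Notation term := (trig_term al be).

Let bm_term n : bounded_measurable (fun x => term x n).
Proof.
by apply: bmD; apply: bmM; [exact: bm_cst|exact: bm_cos|exact: bm_cst|exact: bm_sin].
Qed.

Let bm_partial J : bounded_measurable (fun x => series (term x) J).
Proof.
elim: J => [|J IH].
  rewrite (_ : (fun _ => _) = fun=> 0); first exact: bm_cst.
  by apply/funext => x; rewrite /series /= big_geq.
rewrite (_ : (fun _ => _) = fun x => series (term x) J + term x J); first exact: bmD.
by apply/funext => x; rewrite /series /= big_nat_recr.
Qed.

Lemma bm_trig_sum : bounded_measurable G.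
Proof.
split.
  apply: (measurable_fun_cvg (h := fun J x => series (term x) J)).
    by move=> J; have [] := bm_partial J.
  by move=> x _; exact: (trig_sum_cvg a0 al_le be_le).
have [_ [B HB]] := bm_partial 0.
exists (2 * K / (1 - expR (- (a / 2))) * expR (- (a / 2)) ^+ 0 + B) => x.
have -> : G x = (G x - series (term x) 0) + series (term x) 0 by rewrite subrK.
apply: (le_trans (ler_normD _ _)); apply: lerD => //.
exact: (trig_sum_unif a0 al_le be_le).
Qed.

Lemma intC_partial (p : R -> R) J : bounded_measurable p ->
  intC (fun x => series (term x) J * p x) =
  \sum_(n < J) (al n * intC (fun x => cos (n%:R * x) * p x) +
                be n * intC (fun x => sin (n%:R * x) * p x)).
Proof.
move=> bp; elim: J => [|J IH].
  rewrite big_ord0; under [X in intC X]eq_fun do rewrite /series /= big_geq// mul0r.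
  by rewrite intC_cst mul0r.
rewrite big_ord_recr /= -IH.
have I1 : integrableC (fun x => cos (J%:R * x) * p x).
  by apply: integrableC_bounded; apply: bmM => //; exact: bm_cos.
have I2 : integrableC (fun x => sin (J%:R * x) * p x).
  by apply: integrableC_bounded; apply: bmM => //; exact: bm_sin.
have I3 : integrableC (fun x => series (term x) J * p x).
  by apply: integrableC_bounded; apply: bmM => //.
rewrite -!intCZ// -[X in _ = _ + X]intCD; [|exact: integrableCZ|exact: integrableCZ].
rewrite -intCD//; last by apply: integrableCD; exact: integrableCZ.
congr intC; apply/funext => x; rewrite /series /= big_nat_recr//= /trig_term; ring.
Qed.

(** The partial sums converge uniformly, so that an integral that is eventually
    constant along them has this value for the sum. *)
Lemma intC_trig_sum (p : R -> R) (A : R) (m : nat) : bounded_measurable p ->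
  (forall x, `|p x| <= 1) ->
  (forall J, (m < J)%N -> intC (fun x => series (term x) J * p x) = A) ->
  intC (fun x => G x * p x) = A.
Proof.
move=> bp p1 HA.
apply/eqP; rewrite -subr_eq0 -normr_eq0 eq_le normr_ge0 andbT.
pose r := expR (- (a / 2)).
have r01 : 0 < r < 1 by rewrite expR_gt0 -expR0 ltr_expR oppr_lt0 divr_gt0.
pose C := 2 * K / (1 - r) * period.
have Hb J : (m < J)%N -> `|intC (fun x => G x * p x) - A| <= C * r ^+ J.
  move=> mJ; rewrite -(HA J mJ).
  have I1 : integrableC (fun x => G x * p x).
    by apply: integrableC_bounded; apply: bmM => //; exact: bm_trig_sum.
  have I2 : integrableC (fun x => series (term x) J * p x).
    by apply: integrableC_bounded; apply: bmM => //.
  have -> : intC (fun x => G x * p x) - intC (fun x => series (term x) J * p x) =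
      intC (fun x => (G x * p x) + -1 * (series (term x) J * p x)).
    by rewrite intCD// ?intCZ ?mulN1r//; exact: integrableCZ.
  have I3 := integrableCD I1 (integrableCZ (-1) I2).
  apply: (le_trans (le_normr_Rintegral mcircle I3)).
  rewrite /C mulrAC -intC_cst; apply: le_Rintegral => //.
  - exact: mcircle.
  - exact: (integrable_norm I3).
  - by apply: integrableC_bounded; exact: bm_cst.
  - move=> x _ /=; rewrite mulN1r -mulrBl normrM.
    have := trig_sum_unif a0 al_le be_le x J; rewrite -/r => h.
    by apply: le_trans h; rewrite ler_piMr.
have : (fun J => C * r ^+ (J + m.+1)) @ \oo --> C * 0.
  apply: cvgM; first exact: cvg_cst.
  have /andP[r0 r1] := r01.
  have : (GRing.exp r : R ^nat) @ \oo --> (0 : R) by apply: cvg_expr; rewrite gtr0_norm.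
  by rewrite -(cvg_shiftn m.+1).
rewrite mulr0 => /cvg_lim <-//.
apply: limr_ge; last by near=> J; apply: Hb; rewrite addnS ltnS leq_addl.
apply: is_cvgM; first exact: is_cvg_cst.
have /andP[r0 r1] := r01.
have : (GRing.exp r : R ^nat) @ \oo --> (0 : R) by apply: cvg_expr; rewrite gtr0_norm.
by rewrite -(cvg_shiftn m.+1) => /cvgP.
Unshelve. all: by end_near. Qed.

Lemma intC_trig_sum_cos m : intC (fun x => G x * cos (m%:R * x)) = al m * trig_norm m.
Proof.
apply: (intC_trig_sum (m := m)); [exact: bm_cos|by move=> x; exact: cos_max|].
move=> J mJ; rewrite intC_partial; last exact: bm_cos.
rewrite (bigD1 (Ordinal mJ))//= intC_cos_cos intC_sin_cos eqxx mulr0 addr0 big1 ?addr0// => n nm.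
rewrite intC_cos_cos intC_sin_cos ifF ?mulr0 ?addr0//.
by apply/negbTE; apply: contra nm => /eqP nm; apply/eqP/val_inj.
Qed.

Lemma intC_trig_sum_sin m : intC (fun x => G x * sin (m%:R * x)) =
  if m == 0%N then 0 else be m * trig_norm m.
Proof.
have sc n : intC (fun x : R => cos (n%:R * x) * sin (m%:R * x)) = 0.
  by rewrite -(intC_sin_cos m n); congr intC; apply/funext => x; rewrite mulrC.
apply: (intC_trig_sum (m := m)); [exact: bm_sin|by move=> x; exact: sin_max|].
move=> J mJ; rewrite intC_partial; last exact: bm_sin.
rewrite (bigD1 (Ordinal mJ))//= intC_sin_sin sc eqxx mulr0 add0r big1 => [|n nm].
  by case: eqVneq => _ //=; rewrite ?mulr0 addr0.
rewrite intC_sin_sin sc ifF ?mulr0 ?addr0//.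
by apply/negbTE; apply: contra nm => /andP[/eqP nm _]; apply/eqP/val_inj.
Qed.
End Coefficients.

(** The trigonometric series with the normalised Fourier coefficients of [w] has the
    same coefficients as [w]; [trig_uniqueness] concludes. *)
Theorem ae_eq_trig_sum (w : R -> R) (K a : R) : integrableC w -> 0 < a ->
  (forall n : nat, `|intC (fun x => w x * cos (n%:R * x))| <= K * expR (- (n%:R * a))) ->
  (forall n : nat, `|intC (fun x => w x * sin (n%:R * x))| <= K * expR (- (n%:R * a))) ->
  exists al be : nat -> R,
    [/\ forall n, `|al n| <= K * expR (- (n%:R * a)),
        forall n, `|be n| <= K * expR (- (n%:R * a)) &
        ae_eq leb circle w (trig_sum al be)].
Proof.
move=> Iw a0 Hc Hs.
have norm_ge1 n : 1 <= trig_norm n.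
  have p2 := pi_ge2 R; have p0 := pi_gt0 R.
  by rewrite /trig_norm /period; case: eqP => _; lra.
pose al n := intC (fun x => w x * cos (n%:R * x)) / trig_norm n.
pose be n := intC (fun x => w x * sin (n%:R * x)) / trig_norm n.
have div_le (z B : R) n : `|z| <= B -> `|z / trig_norm n| <= B.
  move=> zB; rewrite normrM normfV (ger0_norm (le_trans ler01 (norm_ge1 n))).
  rewrite ler_pdivrMr; last by apply: lt_le_trans (norm_ge1 n).
  apply: (le_trans zB); rewrite ler_peMr//.
  exact: le_trans zB.
have al_le n : `|al n| <= K * expR (- (n%:R * a)) by exact: div_le.
have be_le n : `|be n| <= K * expR (- (n%:R * a)) by exact: div_le.
exists al, be; split=> //.
have n0 n : trig_norm n != 0 by rewrite gt_eqF// (lt_le_trans ltr01).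
have bG := bm_trig_sum a0 al_le be_le.
have IG := integrableC_bounded bG.
have Iv : integrableC (fun x => w x + -1 * trig_sum al be x).
  by apply: integrableCD => //; exact: integrableCZ.
have diff (p : R -> R) : bounded_measurable p ->
    intC (fun x => w x * p x) = intC (fun x => trig_sum al be x * p x) ->
    intC (fun x => (w x + -1 * trig_sum al be x) * p x) = 0.
  move=> bp E.
  transitivity (intC (fun x => w x * p x + -1 * (trig_sum al be x * p x))).
    by congr intC; apply/funext => x; ring.
  have I1 := integrableCM Iw bp; have I2 := integrableCM IG bp.
  by rewrite intCD ?intCZ ?E ?mulN1r ?subrr//; exact: integrableCZ.
have Hcos n : intC (fun x => (w x + -1 * trig_sum al be x) * cos (n%:R * x)) = 0.
  by apply: diff; [exact: bm_cos | rewrite (intC_trig_sum_cos a0 al_le be_le) /al divfK].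
have Hsin n : intC (fun x => (w x + -1 * trig_sum al be x) * sin (n%:R * x)) = 0.
  apply: diff; first exact: bm_sin.
  rewrite (intC_trig_sum_sin a0 al_le be_le); case: eqVneq => [->|_]; last by rewrite /be divfK.
  by under [X in intC X]eq_fun do rewrite mul0r sin0 mulr0; rewrite intC_cst mul0r.
have := trig_uniqueness Iv Hcos Hsin.
apply: (@filterS _ _ (ae_filter_ringOfSetsType leb)) => x H cx.
by have := H cx => /= /eqP; rewrite mulN1r subr_eq0 => /eqP.
Qed.
End TrigOrthogonality.

(** * Conclusion *)
Section Analytic.
Context {R : realType}.
Local Notation VF := (R -> Rcomplex R).
Local Notation re := (@complex.Re R).
Local Notation im := (@complex.Im R).

Lemma normc_le_re_im (z : R[i]) : normc z <= `|re z| + `|im z|.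
Proof.
have h : 0 <= `|re z| + `|im z| by rewrite addr_ge0.
have n0 : 0 <= normc z by case: z {h} => x y; exact: sqrtr_ge0.
rewrite -(@ler_pXn2r _ 2)// ?nnegrE//.
rewrite normc_sqr sqrrD !real_normK ?num_real// lerD2r lerDl.
by rewrite mulrn_wge0// mulr_ge0.
Qed.

Lemma re_sum (I : eqType) (s : seq I) (F : I -> R[i]) : re (\sum_(i <- s) F i) = \sum_(i <- s) re (F i).
Proof. by elim/big_rec2: _ => // i x y _ <-; rewrite ReD. Qed.
Lemma im_sum (I : eqType) (s : seq I) (F : I -> R[i]) : im (\sum_(i <- s) F i) = \sum_(i <- s) im (F i).
Proof. by elim/big_rec2: _ => // i x y _ <-; rewrite ImD. Qed.

(** Real and imaginary part are treated separately; their power series at each point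
    have a common disc of convergence, since its radius [a / 4] depends on the rate
    of decay alone. *)
Theorem analytic_of_decay (f : VF) (K a : R) : inL2 f -> 0 < a ->
  (forall n : nat, let c := toC (fun x => cos (n%:R * x)) in let s := toC (fun x => sin (n%:R * x)) in
    let e := K * expR (- (n%:R * a)) in
    [/\ `|l2ip f c| <= e, `|l2ip f s| <= e, `|l2ip f (mulI c)| <= e & `|l2ip f (mulI s)| <= e]) ->
  real_analyticT f.
Proof.
move=> fL a0 H.
have /inL2P[pf [sr si]] := fL.
have [al1 [be1 [A1 B1 E1]]] : exists al be : nat -> R,
    [/\ forall n, `|al n| <= K * expR (- (n%:R * a)),
        forall n, `|be n| <= K * expR (- (n%:R * a)) &
        ae_eq (@lebesgue_measure R) circle (fun x => re (f x)) (trig_sum al be)].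
  apply: ae_eq_trig_sum => // [|n|n]; first exact: sq_integrableW.
    by rewrite -(l2ip_toC f); have [] := H n.
  by rewrite -(l2ip_toC f); have [] := H n.
have [al2 [be2 [A2 B2 E2]]] : exists al be : nat -> R,
    [/\ forall n, `|al n| <= K * expR (- (n%:R * a)),
        forall n, `|be n| <= K * expR (- (n%:R * a)) &
        ae_eq (@lebesgue_measure R) circle (fun x => im (f x)) (trig_sum al be)].
  apply: ae_eq_trig_sum => // [|n|n]; first exact: sq_integrableW.
    by rewrite -(l2ip_mulI_toC f); have [] := H n.
  by rewrite -(l2ip_mulI_toC f); have [] := H n.
exists (fun x => trig_sum al1 be1 x +i* trig_sum al2 be2 x); split.
- by move=> x; rewrite !trig_sum_periodic.
- move=> x0; exists (a / 4); first by rewrite divr_gt0.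
  have [c1 [S1 H1]] := trig_sum_analytic a0 A1 B1 x0.
  have [c2 [S2 H2]] := trig_sum_analytic a0 A2 B2 x0.
  exists (fun n => c1 n +i* c2 n) => x xx0.
  have {}H1 := H1 (x - x0) (ltW xx0); have {}H2 := H2 (x - x0) (ltW xx0).
  have xE : x0 + (x - x0) = x by rewrite addrC subrK.
  rewrite xE in H1 H2.
  have termE n : (c1 n +i* c2 n) * (x - x0)%:C ^+ n =
      (c1 n * (x - x0) ^+ n) +i* (c2 n * (x - x0) ^+ n).
    rewrite -rmorphXn /=; apply: complex_eq => /=; first by rewrite mulr0 subr0.
    by rewrite mulr0 add0r.
  apply: (@squeeze_cvgr _ _ _ _ (fun=> 0) (fun N => (S1 + S2) * 2 ^- N)).
  + near=> N; apply/andP; split; first exact: normc_nonneg.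
    apply: (le_trans (normc_le_re_im _)); rewrite mulrDl.
    rewrite ReD ImD ReN ImN re_sum im_sum /=.
    apply: lerD.
      have -> : \sum_(i <- index_enum 'I_N) re ((c1 i +i* c2 i) * (x - x0)%:C ^+ i) =
                \sum_(i < N) c1 i * (x - x0) ^+ i by apply: eq_bigr => i _; rewrite termE.
      exact: H1.
    have -> : \sum_(i <- index_enum 'I_N) im ((c1 i +i* c2 i) * (x - x0)%:C ^+ i) =
              \sum_(i < N) c2 i * (x - x0) ^+ i by apply: eq_bigr => i _; rewrite termE.
    exact: H2.
  + exact: cvg_cst.
  + rewrite -[X in _ --> X](mulr0 (S1 + S2)); apply: cvgM; first exact: cvg_cst.
    rewrite (_ : (fun N => 2 ^- N) = (GRing.exp (2^-1 : R) : R ^nat)).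
      by apply: cvg_expr; rewrite ger0_norm ?invr_ge0// invf_lt1// ltr1n.
    by apply/funext => N; rewrite exprVn.
move: E1 E2; apply: (@filterS2 _ _ (ae_filter_ringOfSetsType (@lebesgue_measure R))) => x h1 h2 cx.
by apply: complex_eq => /=; [exact: h1 | exact: h2].
Unshelve. all: by end_near. Qed.
End Analytic.
Theorem theorem10p1 (R : realType)
    (T : (R -> R[i]) -> R -> R[i])
    (D : (R -> R[i]) -> (R -> R[i]) -> R -> R[i])
    (eps : R) (k : nat) (f0 : R -> R[i])
    (eps_gt0 : 0 < eps) (k_ge1 : (1 <= k)%N) (f0H : inH k f0)
    (Ta : exists C : R, forall f, inH k f -> normH k (f \- f0) < eps ->
       inH k (T f) /\ normH k (T f) <= C)
    (Tb : forall f, inH k f -> normH k (f \- f0) < eps ->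
       is_frechet k T f (D f))
    (Tb_bound : exists C : R, forall f, inH k f -> normH k (f \- f0) < eps ->
       forall h, inH k h -> normH k (D f h) <= C * normH k h)
    (Tc : exists C : R, forall f, inH k f -> normH k (f \- f0) < eps ->
       forall h, inH k h -> normL2 (D f h) <= C * normL2 h)
    (Td : forall f, inH k f -> normH k (f \- f0) < eps ->
       exists2 E : (R -> R[i]) -> R -> R[i], is_L2_extension k (D f) E &
         eqT (wderiv 1 (T f)) (E (wderiv 1 f)))
    (Te : forall f, inH k f -> normH k (f \- f0) < eps ->
       forall h, inH k h -> eqT ('i%C \*o D f h) (D f ('i%C \*o h)))
    (f0_eq : eqT (wderiv 1 f0) (T f0)) :
  real_analyticT f0.
Proof.
pose VF := R -> Rcomplex R.
have f0B0 : normH k (f0 \- f0) < eps.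
  have E0 : f0 \- f0 = (0 : VF) := subrr (f0 : VF).
  by rewrite E0 (sn_0 (hk_seminorm k)).
have [C1 HC1] := Ta; have [C2 HC2] := Tb_bound; have [C3 HC3] := Tc.
pose M := Num.max 0 C1; pose L := Num.max 0 C2; pose C := Num.max 0 C3.
have M0 : 0 <= M by rewrite le_max lexx.
have L0 : 0 <= L by rewrite le_max lexx.
have C0 : 0 <= C by rewrite le_max lexx.
pose Bl (f : VF) := inBall (inH k : VF -> Prop) (@normH R k) f0 eps f.
have f0B : Bl f0 by split.
have Ta' (f : VF) : Bl f -> inH k (T f) /\ normH k (T f) <= M.
  move=> [fH fB]; have [TH TC] := HC1 f fH fB; split=> //.
  by apply: le_trans TC _; rewrite le_max lexx orbT.
have Din (f : VF) : Bl f -> forall h : VF, inH k h -> inH k (D f h).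
  by move=> [fH fB] h hH; have [[[HD _] _] _] := Tb f fH fB; exact: HD.
have Dlin (f : VF) : Bl f -> forall (c : R) (h1 h2 : VF), inH k h1 -> inH k h2 ->
    eqT (D f (c *: h1 + h2)) (c *: (D f h1 : VF) + D f h2 : VF).
  move=> [fH fB] c h1 h2 h1H h2H; have [[[_ lin] _] _] := Tb f fH fB.
  by have := lin c h1 h2 h1H h2H; rewrite !scalerE.
have Dfre (f : VF) : Bl f -> forall e, 0 < e -> exists2 d, 0 < d &
    forall h : VF, inH k h -> normH k h < d ->
      normH k ((T (f + h) : VF) - T f - D f h) <= e * normH k h.
  move=> [fH fB] e e0; have [_ fre] := Tb f fH fB; have [d d0 Hd] := fre e e0.
  by exists d => // h hH hd; have [] := Hd h hH hd.
have DL (f : VF) : Bl f -> forall h : VF, inH k h -> inH k (D f h) /\ normH k (D f h) <= L * normH k h.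
  move=> Bf h hH; split; first exact: Din.
  have [fH fB] := Bf; apply: (le_trans (HC2 f fH fB h hH)).
  by apply: ler_wpM2r; [exact: sqrtr_ge0 | rewrite le_max lexx orbT].
have Tlip (f g : VF) : Bl f -> Bl g ->
    normH k ((T f : VF) - T g) <= L * normH k (f - g).
  apply: (frechet_lipschitz (hk_seminorm k) f0H _ DL Dfre).
  by move=> h Bh; have [] := Ta' h Bh.
have DC (f : VF) : Bl f -> forall h : VF, inH k h -> normL2 (D f h) <= C * normL2 h.
  move=> [fH fB] h hH; apply: (le_trans (HC3 f fH fB h hH)).
  by apply: ler_wpM2r; [exact: sqrtr_ge0 | rewrite le_max lexx orbT].
have Td' (f : VF) : Bl f -> exists E : VF -> VF,
  [/\ forall h : VF, inL2 h -> inL2 (E h) /\ normL2 (E h) <= C * normL2 h,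
      forall h1 h2 : VF, inL2 h1 -> inL2 h2 -> eqT (E (h1 - h2)) (E h1 - E h2 : VF),
      forall h : VF, inH k h -> eqT (E h) (D f h) &
      eqT (wderiv 1 (T f)) (E (wderiv 1 f))].
  move=> Bf; have [fH fB] := Bf; have [E [[El Elin] Eag Eb] Ewd] := Td f fH fB.
  exists E; split=> //.
    by move=> h hL; split; [exact: El | apply: Eb => // h' h'H; exact: DC].
  move=> h1 h2 h1L h2L; have := Elin (-1) h2 h1 h2L h1L.
  have -> : (-1)%:C \*o h2 \+ h1 = h1 - h2 by rewrite -scalerE scaleN1r addrC.
  have -> // : (-1)%:C \*o E h2 \+ E h1 = (E h1 : VF) - E h2.
  by rewrite -scalerE scaleN1r addrC.
have Te' (f : VF) : Bl f -> forall h : VF, inH k h -> eqT (mulI (D f h)) (D f (mulI h)).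
  by move=> [fH fB] h hH; exact: Te.
pose a := lifespan eps M.
have decay sg n : `|sg| = 1 -> _ :=
  @coef_decay R k _ _ erefl erefl T D eps f0 k_ge1 f0H M L C M0 C0 f0B Ta' Tlip Din Dlin Dfre DC Td' Te' f0_eq eps_gt0 sg n.
apply: (@analytic_of_decay R f0 ((normL2 f0 + eps) * Num.sqrt period * 2) a (inH_L2 f0H)).
  exact: lifespan_gt0.
move=> n c s e.
have [p1 q1] := decay 1 n (normr1 _).
have [p2 q2] := decay (-1) n (normrN1 _).
rewrite -/c -/s -/a -/e !mul1r !mulN1r opprK in p1 q1 p2 q2.
have half (x y : R) : `|x - y| <= e -> `|x + y| <= e -> `|x| <= e /\ `|y| <= e.
  by rewrite !ler_norml => /andP[h1 h2] /andP[h3 h4]; split; apply/andP; split; lra.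
(* The signs sg = 1 and sg = -1 control the difference and the sum of two coefficients. *)
have [x1 x2] := half _ _ p1 p2; have [x3 x4] := half _ _ q2 q1.
by split.
Qed.
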